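(* Let $W$ be a weighted small-step walk in the quadrant with probability matrix $P_\infty$ and associated group $G_W$. The group $G_W$ is finite if and only if one of the following holds, and in each case the order of $G_W$ is as indicated: (a) (order $4$) $\det\begin{pmatrix} p_{11} & p_{1,-1} \\ p_{-1,1} & p_{-1,-1} \end{pmatrix}=\det P_\infty=0$; equivalently, for some real parameters $\alpha,\mu,\nu,\rho,\sigma$, $$P_\infty=\begin{pmatrix} \mu\rho & \alpha\rho & \nu\rho \\ p_{01} & p_{00} & p_{0,-1} \\ \mu\sigma & \alpha\sigma & \nu\sigma \end{pmatrix}\quad\text{or}\quad P_\infty=\begin{pmatrix} \mu\rho & p_{10} & \nu\rho \\ \mu\alpha & p_{00} & \nu\alpha \\ \mu\sigma & p_{-1,0} & \nu\sigma \end{pmatrix}.$$ (b) (order $6$) Up to the symmetries, $P_\infty$ is of one of the forms $$\begin{pmatrix} 0 & p_{10} & 0 \\ 0 & p_{00} & p_{0,-1} \\ p_{-1,1} & 0 & 0 \end{pmatrix},\qquad p_{10}\,p_{0,-1}\,p_{-1,1}\neq0;$$ $$\begin{pmatrix} 0 & p_{10} & p_{1,-1} \\ 0 & p_{00} & p_{0,-1} \\ p_{-1,1} & \dfrac{2p_{1,-1}p_{-1,1}}{p_{10}} & \dfrac{p_{1,-1}^{2}\,p_{-1,1}}{p_{10}^{2}} \end{pmatrix},\qquad p_{10}\,p_{1,-1}\,p_{-1,1}\neq0;$$ $$\begin{pmatrix} 0 & \dfrac{p_{1,-1}p_{-1,1}}{p_{-1,0}} & p_{1,-1} \\ \dfrac{p_{1,-1}p_{-1,1}}{p_{0,-1}}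 & p_{00} & p_{0,-1} \\ p_{-1,1} & p_{-1,0} & 0 \end{pmatrix},\qquad p_{1,-1}\,p_{-1,1}\,p_{0,-1}\,p_{-1,0}\neq0.$$ (c) (order $8$) Up to the symmetries, $$P_\infty=\begin{pmatrix} 0 & p_{10} & p_{1,-1} \\ 0 & p_{00} & 0 \\ p_{-1,1} & \dfrac{p_{1,-1}p_{-1,1}}{p_{10}} & 0 \end{pmatrix},\qquad p_{10}\,p_{1,-1}\,p_{-1,1}\neq0.$$ (d) (order $10$) Up to the symmetries, $$P_\infty=\frac1Z\begin{pmatrix} 0 & S^3R & S^2 \\ S^3R^3 & P & 2SR \\ S^2R^4 & 2SR^3 & R^2 \end{pmatrix}$$ for some real $S>0$, $R>0$, $P\ge0$, where $Z=S^3R+S^2+S^3R^3+P+2SR+S^2R^4+2SR^3+R^2$. In particular, there are no weighted small-step walks in the quadrant whose group $G_W$ is finite of order higher than $10$.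
   Context: A weighted small-step walk $W$ in the quadrant is given by real weights $p_{ij}\ge 0$, $i,j\in\{-1,0,1\}$, with $\sum_{i,j=-1}^{1}p_{ij}=1$. Its probability matrix is $$P_\infty=\begin{pmatrix} p_{11} & p_{10} & p_{1,-1} \\ p_{01} & p_{00} & p_{0,-1} \\ p_{-1,1} & p_{-1,0} & p_{-1,-1} \end{pmatrix}.$$ Its inventory is $$\chi_W(x,y)=\sum_{i,j=-1}^1 p_{ij}x^iy^j = xA_1(y)+B_1(y)+\frac{C_1(y)}{x}=yA_2(x)+B_2(x)+\frac{C_2(x)}{y},$$ where $A_1,B_1,C_1$ are Laurent polynomials in $y$ and $A_2,B_2,C_2$ are Laurent polynomials in $x$. It is assumed that none of $A_1,C_1,A_2,C_2$ is identically zero, so that $$\varphi_1(x,y)=\left(\frac{C_1(y)}{xA_1(y)},\,y\right),\qquad \varphi_2(x,y)=\left(x,\,\frac{C_2(x)}{yA_2(x)}\right)$$ are birational involutions of the $(x,y)$-plane. The group of $W$ is $G_W=\langle\varphi_1,\varphi_2\rangle$, the group of birational transformations of the $(x,y)$-plane generated by them. ''Up to the symmetries'' means up to the action of the eight symmetries of the square on the index set $\{-1,0,1\}^2$ of the weights, generated by $(i,j)\mapsto(-i,j)$, $(i,j)\mapsto(i,-j)$ and $(i,j)\mapsto(j,i)$ (i.e. reversing the order of the rows, reversing the order of the columns, and transposing $P_\infty$). *)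

(* Defs.v *)
From HB Require Import structures.
From mathcomp Require Import all_boot all_order all_algebra.
From mathcomp Require Import mpoly.
From mathcomp Require Import boolp classical_sets functions cardinality reals.

Set Implicit Arguments.
Unset Strict Implicit.
Unset Printing Implicit Defensive.

Import Order.TTheory GRing.Theory Num.Theory.
Local Open Scope classical_set_scope.
Local Open Scope ring_scope.

(* The field R(x, y). *)
Notation ratfun R := {fraction {mpoly R[2]}}.

Section RationalMaps.
Variable R : fieldType.
Implicit Types (h : ratfun R) (f g : ratfun R * ratfun R).

Definition rcst (c : R) : ratfun R := tofrac (c%:MP).
Definition xvar : ratfun R := tofrac 'X_(ord0 : 'I_2).
Definition yvar : ratfun R := tofrac 'X_(ord_max : 'I_2).

Definition polysubst (q : {mpoly R[2]}) g : ratfun R :=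
  mmap rcst (fun i : 'I_2 => if i == ord0 then g.1 else g.2) q.

(* h(g_1, g_2). A representative numerator/denominator of h is used; when g is
   dominant (in particular birational) no nonzero denominator vanishes at g,
   and the value does not depend on the representative. *)
Definition ratsubst h g : ratfun R :=
  polysubst (\n_(repr h)) g / polysubst (\d_(repr h)) g.

(* The pair f stands for the rational map (x, y) |-> (f_1(x, y), f_2(x, y)). *)
Definition mapid : ratfun R * ratfun R := (xvar, yvar).

(* f after g *)
Definition mapcomp f g : ratfun R * ratfun R :=
  (ratsubst f.1 g, ratsubst f.2 g).

Definition subgroup_closed (G : set (ratfun R * ratfun R)) : Prop :=
  [/\ G mapid,
      forall f g, G f -> G g -> G (mapcomp f g) &
      forall f g, G f -> mapcomp f g = mapid -> mapcomp g f = mapid -> G g].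

(* When the maps in S are birational, this is the subgroup that S generates in
   the group of birational transformations of the plane. *)
Definition generated_group (S : set (ratfun R * ratfun R)) :
    set (ratfun R * ratfun R) :=
  smallest subgroup_closed S.

End RationalMaps.

Arguments xvar {R}.
Arguments yvar {R}.

Definition steps : seq int := [:: -1; 0; 1].

(* The weight p_ij is [p i j]; only the values at i, j in {-1, 0, 1} are ever
   used. *)
Definition weights (R : realType) : Type := int -> int -> R.

Section Walks.
Variable R : realType.
Implicit Types p q : weights R.

Definition walk_weights p : Prop :=
  (forall i j, i \in steps -> j \in steps -> 0 <= p i j) /\
  \sum_(i <- steps) \sum_(j <- steps) p i j = 1.

Definition mx_of_rows m n (rows : seq (seq R)) : 'M[R]_(m, n) :=
  \matrix_(i < m, j < n) nth 0 (nth [::] rows i) j.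

Definition Pinf p : 'M[R]_3 := mx_of_rows 3 3
  [:: [:: p 1 1;    p 1 0;    p 1 (-1)];
      [:: p 0 1;    p 0 0;    p 0 (-1)];
      [:: p (-1) 1; p (-1) 0; p (-1) (-1)]].

Definition inventory p : ratfun R :=
  \sum_(i <- steps) \sum_(j <- steps) rcst (p i j) * xvar ^ i * yvar ^ j.

(* The coefficient of x^i, a Laurent polynomial in y. *)
Definition xcoef p (i : int) : ratfun R :=
  \sum_(j <- steps) rcst (p i j) * yvar ^ j.

(* The coefficient of y^j, a Laurent polynomial in x. *)
Definition ycoef p (j : int) : ratfun R :=
  \sum_(i <- steps) rcst (p i j) * xvar ^ i.

Definition A1 p := xcoef p 1.
Definition B1 p := xcoef p 0.
Definition C1 p := xcoef p (-1).
Definition A2 p := ycoef p 1.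
Definition B2 p := ycoef p 0.
Definition C2 p := ycoef p (-1).

Lemma inventory_x p : inventory p = xvar * A1 p + B1 p + C1 p / xvar.
Proof.
have e i : \sum_(j <- steps) rcst (p i j) * xvar ^ i * yvar ^ j
         = xcoef p i * xvar ^ i.
  by rewrite /xcoef mulr_suml; apply: eq_bigr => j _; rewrite mulrAC.
rewrite /inventory (eq_bigr _ (fun i _ => e i)) !big_cons big_nil.
by rewrite expr0z expr1z exprN1 mulr1 addr0 addrC [B1 p + _]addrC [_ * xvar]mulrC.
Qed.

Lemma inventory_y p : inventory p = yvar * A2 p + B2 p + C2 p / yvar.
Proof.
have e j : \sum_(i <- steps) rcst (p i j) * xvar ^ i * yvar ^ j
         = ycoef p j * yvar ^ j.
  by rewrite /ycoef mulr_suml.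
rewrite /inventory exchange_big /= (eq_bigr _ (fun i _ => e i)) !big_cons big_nil.
by rewrite expr0z expr1z exprN1 mulr1 addr0 addrC [B2 p + _]addrC [_ * yvar]mulrC.
Qed.

Definition phi1 p : ratfun R * ratfun R := (C1 p / (xvar * A1 p), yvar).
Definition phi2 p : ratfun R * ratfun R := (xvar, C2 p / (yvar * A2 p)).

Definition walk_group p : set (ratfun R * ratfun R) :=
  generated_group [set phi1 p; phi2 p].

Inductive symmetric_weights p : weights R -> Prop :=
| sym_refl : symmetric_weights p p
| sym_rows q : symmetric_weights p q ->
    symmetric_weights p (fun i j => q (- i) j)
| sym_cols q : symmetric_weights p q ->
    symmetric_weights p (fun i j => q i (- j))
| sym_tr q : symmetric_weights p q ->
    symmetric_weights p (fun i j => q j i).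

Definition up_to_symmetries (F : weights R -> Prop) p : Prop :=
  exists2 q, symmetric_weights p q & F q.

Definition case_a p : Prop :=
  \det (mx_of_rows 2 2 [:: [:: p 1 1;    p 1 (-1)];
                           [:: p (-1) 1; p (-1) (-1)]]) = 0 /\
  \det (Pinf p) = 0.

Definition case_a_param p : Prop :=
  exists alpha mu nu rho sigma : R,
    Pinf p = mx_of_rows 3 3
      [:: [:: mu * rho;   alpha * rho;   nu * rho];
          [:: p 0 1;      p 0 0;         p 0 (-1)];
          [:: mu * sigma; alpha * sigma; nu * sigma]] \/
    Pinf p = mx_of_rows 3 3
      [:: [:: mu * rho;   p 1 0;    nu * rho];
          [:: mu * alpha; p 0 0;    nu * alpha];
          [:: mu * sigma; p (-1) 0; nu * sigma]].

Definition form_b1 p : Prop :=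
  Pinf p = mx_of_rows 3 3
    [:: [:: 0;        p 1 0; 0];
        [:: 0;        p 0 0; p 0 (-1)];
        [:: p (-1) 1; 0;     0]] /\
  p 1 0 * p 0 (-1) * p (-1) 1 != 0.

Definition form_b2 p : Prop :=
  Pinf p = mx_of_rows 3 3
    [:: [:: 0; p 1 0; p 1 (-1)];
        [:: 0; p 0 0; p 0 (-1)];
        [:: p (-1) 1;
            2 * p 1 (-1) * p (-1) 1 / p 1 0;
            p 1 (-1) ^+ 2 * p (-1) 1 / p 1 0 ^+ 2]] /\
  p 1 0 * p 1 (-1) * p (-1) 1 != 0.

Definition form_b3 p : Prop :=
  Pinf p = mx_of_rows 3 3
    [:: [:: 0; p 1 (-1) * p (-1) 1 / p (-1) 0; p 1 (-1)];
        [:: p 1 (-1) * p (-1) 1 / p 0 (-1); p 0 0; p 0 (-1)];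
        [:: p (-1) 1; p (-1) 0; 0]] /\
  p 1 (-1) * p (-1) 1 * p 0 (-1) * p (-1) 0 != 0.

Definition case_b : weights R -> Prop :=
  up_to_symmetries (fun q => [\/ form_b1 q, form_b2 q | form_b3 q]).

Definition form_c p : Prop :=
  Pinf p = mx_of_rows 3 3
    [:: [:: 0;        p 1 0;                           p 1 (-1)];
        [:: 0;        p 0 0;                           0];
        [:: p (-1) 1; p 1 (-1) * p (-1) 1 / p 1 0; 0]] /\
  p 1 0 * p 1 (-1) * p (-1) 1 != 0.

Definition case_c : weights R -> Prop := up_to_symmetries form_c.

Definition form_d p : Prop :=
  exists s r t : R, [/\ 0 < s, 0 < r, 0 <= t &
    let Z := s ^+ 3 * r + s ^+ 2 + s ^+ 3 * r ^+ 3 + t + 2 * s * r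
             + s ^+ 2 * r ^+ 4 + 2 * s * r ^+ 3 + r ^+ 2 in
    Pinf p = Z^-1 *: mx_of_rows 3 3
      [:: [:: 0;                 s ^+ 3 * r;     s ^+ 2];
          [:: s ^+ 3 * r ^+ 3;   t;              2 * s * r];
          [:: s ^+ 2 * r ^+ 4;   2 * s * r ^+ 3; r ^+ 2]]].

Definition case_d : weights R -> Prop := up_to_symmetries form_d.

End Walks.

(* Main.v *)
Require Import Defs.
From HB Require Import structures.
From mathcomp Require Import all_boot all_order all_algebra.
From mathcomp Require Import mpoly.
From mathcomp Require Import boolp classical_sets functions cardinality reals.
From mathcomp Require Import generic_quotient ring lra zify.

Set Implicit Arguments.
Unset Strict Implicit.
Unset Printing Implicit Defensive.

Import Order.TTheory GRing.Theory Num.Theory.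
Local Open Scope classical_set_scope.
Local Open Scope card_scope.
Local Open Scope ring_scope.

(** Write F(y) = C1(y) / A1(y) and G(x) = C2(x) / A2(x); these are quotients of
    trinomials with nonnegative coefficients. The two involutions send (x, y)
    to (F(y) / x, y) and to (x, G(x) / y). Both preserve the open quadrant
    x, y > 0, no denominator vanishes there, and the quadrant is Zariski dense,
    so that the group acts faithfully on it ([repmap_inj], [generated_words]).
    The group is therefore dihedral: it is finite iff the product [turn] of the
    involutions has a finite order m on the quadrant, and it then has 2 m
    elements ([finite_period], [card_walk_group]). It is convenient to unfold
    an orbit of the product into one sequence z_0 = x, z_1 = y,
    z_(n+2) z_n = F(z_(n+1)) or G(z_(n+1)) according to the parity of n; the
    order divides m iff this sequence has period 2 m.

    The vanishing pattern of the weights leaves one candidate for m. When y is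
    large and x exceeds a large power of y, F and G behave like powers of their
    argument, and each z_n has the order of growth of a monomial x^i y^j whose
    exponents are given by a piecewise linear recurrence. If that recurrence
    returns to its initial values after m turns, the m-th iterate tau of the
    turn has coordinates comparable to x and y, so tau maps such a region into
    a similar one. A bivariate polynomial has a constant sign far out in the
    region ([ev2_sign]), hence so has each coordinate of tau(u) - u; if it were
    not identically zero the coordinate would be monotone along the orbits of
    tau, which contradicts finiteness. So tau is the identity
    ([period_of_exponents], [walk_period_of_exponents]). If all four
    corner weights are positive then m = 2; otherwise the symmetries of the
    square lead to p_11 = 0 and to a few patterns, with m = 2, 3, 4, 5, 7 or 8.
      Some patterns support the walk in a half plane
    through the origin and have no finite order for a monotonicity reason
    ([half_plane_aperiodic]).

    Once m is known, the equation between z_(2m) and z_0 is an identity of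
    rational functions in x and y, and one can specialize (x, y) to points where
    F or G has a zero or a pole. The values of the sequence at such a point,
    possibly infinite, are computed forward from z_0, z_1 and backward from
    z_(2m) = z_0, z_(2m+1) = z_1, and must agree in the middle. Comparing them
    yields the polynomial relations between the weights that define the forms of
    order 6, 8 and 10, and contradictions when m is 7 or 8 and for one of the
    patterns with m = 4 ([orbit_b2], [orbit_b3], [orbit_c], [orbit_d],
    [orbit_d_corner], [orbit_not7_h] and their companions, combined in
    [tame_listed]). For m = 2 the condition reads F(G(u) / y) = F(y); it
    forces F or G to be constant, which means that the extreme rows or the
    extreme columns are proportional ([period2_proportional]).

    Conversely each listed form makes F and G simple enough to write down the
    whole orbit; the form of order 10 is the recurrence z'' z = z' + 1 of
    period 5 in suitable coordinates ([form_d_period]). *)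

(** * Places and abstract orbits *)

(** A local abbreviation whose body stays hidden from [field] and from
    unification. *)
Definition named (T : Type) (x : T) : {y : T | y = x} := exist _ x erefl.

(** [td u a] means that u is regular at the place and takes the value a there. A
    relation rather than a function, because an element with a pole has no
    value; a pole of u is the statement [td u^-1 0]. *)
Record is_place (k K : fieldType) (io : {rmorphism k -> K})
    (td : K -> k -> Prop) : Prop := IsPlace {
  td_cst : forall a, td (io a) a;
  td_add : forall u v a b, td u a -> td v b -> td (u + v) (a + b);
  td_mul : forall u v a b, td u a -> td v b -> td (u * v) (a * b);
  td_inv : forall u a, td u a -> a != 0 -> td u^-1 a^-1;
  td_uniq : forall u a b, td u a -> td u b -> a = b }.

(** With a = 0 it also serves for linear factors. *)
Definition quad (K : nzRingType) (a b c u : K) : K := a * u ^+ 2 + b * u + c.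

Section Place.
Variables (k K : fieldType) (io : {rmorphism k -> K}) (td : K -> k -> Prop).
Hypothesis P : is_place io td.

Lemma td_opp u a : td u a -> td (- u) (- a).
Proof.
move=> ua; have := td_mul P (td_cst P (-1)) ua.
by rewrite rmorphN1 !mulN1r.
Qed.

Lemma td_sub u v a b : td u a -> td v b -> td (u - v) (a - b).
Proof. by move=> ua vb; apply: (td_add P) => //; apply: td_opp. Qed.

Lemma td_one : td 1 1.
Proof. by rewrite -(rmorph1 io); apply: td_cst P _. Qed.

Lemma td_zero : td 0 0.
Proof. by rewrite -(rmorph0 io); apply: td_cst P _. Qed.

Lemma td_div u v a b : td u a -> td v b -> b != 0 -> td (u / v) (a / b).
Proof. by move=> ua vb b0; apply: (td_mul P) => //; apply: (td_inv P). Qed.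

Lemma td_exp u a n : td u a -> td (u ^+ n) (a ^+ n).
Proof.
move=> ua; elim: n => [|n IH]; first by rewrite !expr0; apply: td_one.
by rewrite !exprS; apply: (td_mul P).
Qed.

Lemma td_eq u v a b : td u a -> u = v -> a = b -> td v b.
Proof. by move=> h <- <-. Qed.

Lemma td_val u a b : td u a -> a = b -> td u b.
Proof. by move=> h <-. Qed.

Lemma td_quad a b c u v : td u v ->
  td (quad (io a) (io b) (io c) u) (quad a b c v).
Proof.
move=> uv; apply: (td_add P); last exact: td_cst P _.
apply: (td_add P); apply: (td_mul P) => //; try exact: td_cst P _.
exact: td_exp.
Qed.

Lemma td_neq0 u a : td u a -> a != 0 -> u != 0.
Proof.
move=> ua; apply: contraNneq => u0; apply/eqP.
by apply: (td_uniq P ua); rewrite u0; apply: td_zero.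
Qed.

Lemma td_pole u a : u != 0 -> td u^-1 0 -> td u a -> False.
Proof.
move=> u0 h1 h2; have := td_mul P h1 h2; rewrite mulVf // mul0r => h.
by have /eqP := td_uniq P td_one h; rewrite oner_eq0.
Qed.

(** At a pole of u the quotient by the top power keeps the leading coefficient;
    this is how values of the form infinity / infinity are computed. *)
Lemma td_quad_inf a b c u : u != 0 -> td u^-1 0 ->
  td (quad (io a) (io b) (io c) u / u ^+ 2) a.
Proof.
move=> u0 iu.
apply: (@td_eq (io a + io b * u^-1 + io c * u^-1 ^+ 2)
               _ (a + b * 0 + c * 0 ^+ 2)).
- apply: (td_add P); last by apply: (td_mul P); [exact: td_cst P _ | exact: td_exp].
  by apply: (td_add P); [exact: td_cst P _ | apply: (td_mul P) => //; exact: td_cst P _].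
- by rewrite /quad; field.
- by rewrite expr0n /= !mulr0 !addr0.
Qed.

Lemma td_lin_inf b c u : u != 0 -> td u^-1 0 ->
  td (quad 0 (io b) (io c) u / u) b.
Proof.
move=> u0 iu.
apply: (@td_eq (io b + io c * u^-1) _ (b + c * 0)).
- apply: (td_add P); first exact: td_cst P _.
  by apply: (td_mul P) => //; exact: td_cst P _.
- by rewrite /quad; field.
- by rewrite mulr0 addr0.
Qed.

End Place.
Arguments td_eq {k K td} u {v a b}.

Ltac value_step P := first
  [ eassumption
  | apply: (td_cst P) | apply: (td_one P) | apply: (td_zero P) | apply: (td_quad P)
  | apply: (td_exp P) | apply: (td_sub P) | apply: (td_opp P)
  | (apply: (td_mul P); [ | eassumption])
  | apply: (td_div P) | apply: (td_inv P) | apply: (td_mul P) | apply: (td_add P) ].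
Ltac beta_goal := match goal with |- ?G => let G' := eval cbv beta in G in change G' end.
(** Decomposes [td u a] along the operations of u, instantiating a along the way
    and leaving the nonvanishing of the denominators. *)
Ltac values P := repeat value_step P; beta_goal.

(** What is retained of the orbit of a generic point (x, y) under a walk: the
    recurrence, the fact that polynomials with nonnegative coefficients do not
    vanish on it (all entries are positive on the quadrant), the period, and the
    possibility of specializing x and y to arbitrary constants. *)
Record orbit (k : realFieldType) (K : fieldType) (io : {rmorphism k -> K})
    (F G : K -> K) (m : nat) (z : nat -> K) : Prop := Orbit {
  orb_F : forall n, z n.*2.+2 = F (z n.*2.+1) / z n.*2;
  orb_G : forall n, z n.*2.+3 = G (z n.*2.+2) / z n.*2.+1;
  orb_pos : forall n a b c, 0 <= a -> 0 <= b -> 0 <= c -> 0 < a + b + c ->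
    quad (io a) (io b) (io c) (z n) != 0;
  orb_per : forall n, z (n + m.*2)%N = z n;
  orb_place : forall x y, exists td, [/\ is_place io td, td (z 0) x & td (z 1) y] }.

Section Orbit.
Variables (k : realFieldType) (K : fieldType) (io : {rmorphism k -> K}).
Variables (F G : K -> K) (m : nat) (z : nat -> K).
Hypothesis O : orbit io F G m z.

Lemma orb_neq0 n : z n != 0.
Proof.
have -> : z n = quad (io 0) (io 1) (io 0) (z n).
  by rewrite /quad rmorph0 rmorph1; ring.
by apply: (orb_pos O); lra.
Qed.

Lemma orb_lin n b c : 0 <= b -> 0 <= c -> 0 < b + c ->
  quad 0 (io b) (io c) (z n) != 0.
Proof.
move=> b0 c0 bc; have := @orb_pos _ _ _ _ _ _ _ O n 0 b c.
by rewrite rmorph0 add0r; apply.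
Qed.

(** The recurrence is symmetric in its outer terms, so it runs backward as
    well. *)
Lemma orb_Fb n : z n.*2 = F (z n.*2.+1) / z n.*2.+2.
Proof.
have := orb_neq0 n.*2.+2; rewrite (orb_F O) => h.
have Fn : F (z n.*2.+1) != 0 by move: h; apply: contraNneq => ->; rewrite mul0r.
by rewrite invf_div mulrCA mulfV // mulr1.
Qed.

Lemma orb_Gb n : z n.*2.+1 = G (z n.*2.+2) / z n.*2.+3.
Proof.
have := orb_neq0 n.*2.+3; rewrite (orb_G O) => h.
have Gn : G (z n.*2.+2) != 0 by move: h; apply: contraNneq => ->; rewrite mul0r.
by rewrite invf_div mulrCA mulfV // mulr1.
Qed.

Lemma orb_eqF F' G' : (forall n, F (z n) = F' (z n)) ->
  (forall n, G (z n) = G' (z n)) -> orbit io F' G' m z.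
Proof.
move=> eF eG; split; case: O => // hF hG *.
  by rewrite hF eF.
by rewrite hG eG.
Qed.

End Orbit.

(** * Constraints on the coefficients of a periodic orbit *)

Lemma quadl (K : nzRingType) (b c u : K) : quad 0 b c u = b * u + c.
Proof. by rewrite /quad mul0r add0r. Qed.

Ltac conjs := repeat (apply/andP; split); rewrite ?andbT //.

Section Cross.
Variables (k : realFieldType) (K : fieldType) (io : {rmorphism k -> K}).
Variables b c d e f g h : k.
Let N (u : K) := quad (io f) (io g) (io h) u.
Let D (u : K) := quad 0 (io b) (io c) u.
Let M (u : K) := quad (io c) (io e) (io h) u.
Let E (u : K) := quad 0 (io d) (io f) u.
Let S (x y : K) := io b * x + io c * x / y + io d * y + io e / y + io f * y / x
   + io g / x + io h / (x * y).

(** S is the inventory without its constant term; each involution permutes the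
    two solutions of S(x, y) = const in one of the variables. *)
Lemma inv_F x x' y : x != 0 -> y != 0 -> N y != 0 -> D y != 0 -> x' = N y / D y / x ->
  S x' y = S x y.
Proof.
rewrite /S /N /D quadl /quad => x0 y0 n0 d0 ->; field; conjs.
Qed.

Lemma inv_G x y y' : x != 0 -> y != 0 -> M x != 0 -> E x != 0 -> y' = M x / E x / y ->
  S x y' = S x y.
Proof.
rewrite /S /M /E quadl /quad => x0 y0 n0 d0 ->; field; conjs.
Qed.

Variables r s : k.
Hypotheses (br : b * r + c = 0) (ds : d * s + f = 0).
Hypotheses (b0 : b != 0) (c0 : c != 0) (d0 : d != 0) (f0 : f != 0).
Hypothesis Ms : quad c e h s != 0.
Hypothesis Nr : quad f g h r != 0.

(** Starting where both denominators vanish, z_2 and z_3 are infinite, z_4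
    returns to the root s because the leading coefficients of F and G match, and
    z_5 returns to the root r by the invariance of S. *)
Lemma crossing_step td (P : is_place io td) u0 u1 u2 u3 u4 u5 :
  u0 != 0 -> u1 != 0 -> u2 != 0 -> u3 != 0 -> u4 != 0 -> u5 != 0 ->
  D u1 != 0 -> D u3 != 0 -> E u2 != 0 -> E u4 != 0 ->
  u2 = N u1 / D u1 / u0 -> u3 = M u2 / E u2 / u1 ->
  u4 = N u3 / D u3 / u2 -> u5 = M u4 / E u4 / u3 ->
  td u0 s -> td u1 r -> [/\ td u2^-1 0, td u4 s & td u5 r].
Proof.
move=> n0 n1 n2 n3 n4 n5 Dn1 Dn3 En2 En4 e2 e3 e4 e5 t0 t1.
have r0 : r != 0.
  by move: c0; apply: contraNneq => r0; rewrite -br r0 mulr0 add0r.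
have s0 : s != 0.
  by move: f0; apply: contraNneq => s0; rewrite -ds s0 mulr0 add0r.
have N1 : N u1 != 0 by move: n2; rewrite e2; apply: contraNneq => ->; rewrite !mul0r.
have M2 : M u2 != 0 by move: n3; rewrite e3; apply: contraNneq => ->; rewrite !mul0r.
have N3 : N u3 != 0 by move: n4; rewrite e4; apply: contraNneq => ->; rewrite !mul0r.
have M4 : M u4 != 0 by move: n5; rewrite e5; apply: contraNneq => ->; rewrite !mul0r.
have tD1 : td (D u1) 0.
  by rewrite /D quadl -br; values P.
have w2 : td u2^-1 0.
  rewrite e2 !invf_div; apply: td_val; [values P|by rewrite mul0r mulr0].
have a2 := td_quad_inf P c e h n2 w2.
have l2 := td_lin_inf P d f n2 w2.
have q3 : td (u3 / u2) (c / d / r).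
  apply: (td_eq ((M u2 / u2 ^+ 2) / (E u2 / u2) / u1)); last by [].
    by values P.
  by rewrite e3; field; conjs.
have w3 : td u3^-1 0.
  apply: (td_eq (u2^-1 * (u3 / u2)^-1)).
    by values P; rewrite !mulf_neq0 ?invr_eq0.
  - by field; conjs.
  - by rewrite mul0r.
have a3 := td_quad_inf P f g h n3 w3.
have l3 := td_lin_inf P b c n3 w3.
have t4 : td u4 s.
  apply: (td_eq ((N u3 / u3 ^+ 2) / (D u3 / u3) * (u3 / u2))).
  - by values P.
  - by rewrite e4; field; conjs.
  - have -> : f = - (d * s) by apply/eqP; rewrite -addr_eq0 addrC ds.
    have -> : c = - (b * r) by apply/eqP; rewrite -addr_eq0 addrC br.
    by field; conjs.
split=> //.
have i5 : td u5^-1 r^-1.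
  pose B (x : K) := io b * x + io g / x.
  pose C (x : K) := io c * x + io e + io h / x.
  have C4 : td (C u4) (c * s + e + h / s) by rewrite /C; values P.
  have s0C : c * s + e + h / s != 0.
    apply: contraNneq Ms => Cs; have -> : quad c e h s = (c * s + e + h / s) * s.
      by rewrite /quad; field.
    by rewrite Cs mul0r.
  apply: (td_eq ((S u0 u1 - B u4 - C u4 / u3) / C u4)).
  - by rewrite /S /B; values P; rewrite ?mulf_neq0.
  - have C4n : C u4 != 0 by apply: (td_neq0 P C4).
    rewrite -(inv_F n0 n1 N1 Dn1 e2) -(inv_G n2 n1 M2 En2 e3) -(inv_F n2 n3 N3 Dn3 e4).
    rewrite e5; apply: (canLR (mulfK C4n)); rewrite /S /B /C /M /E quadl /quad; field.
    by move: M4 En4; rewrite /M /E quadl /quad => *; conjs.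
  - rewrite mulr0 subr0; apply: (canLR (mulfK s0C)).
    have -> : f = - (d * s) by apply/eqP; rewrite -addr_eq0 addrC ds.
    by field; conjs.
rewrite -[u5]invrK -[r]invrK; apply: (td_inv P) => //; by rewrite invr_eq0.
Qed.

End Cross.

Section CrossPeriod.
Variables (k : realFieldType) (K : fieldType) (io : {rmorphism k -> K}).
Variables b c d e f g h : k.
Hypotheses (b0 : 0 < b) (c0 : 0 < c) (d0 : 0 < d) (f0 : 0 < f).
Variables (m : nat) (z : nat -> K).

(** If neither numerator vanishes at the root of its denominator, the crossing
    pattern repeats every four terms from (s, r) and every z_(4k+2) is infinite.
    For odd m this includes z_(2m) = z_0, which is finite. *)
Lemma odd_period_cancels :
  orbit io (fun u => quad (io f) (io g) (io h) u / quad 0 (io b) (io c) u)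
           (fun u => quad (io c) (io e) (io h) u / quad 0 (io d) (io f) u) m z ->
  odd m -> quad f g h (- c / b) = 0 \/ quad c e h (- f / d) = 0.
Proof.
move=> O om; have [r rE] := named (- c / b).
have [s sE] := named (- f / d).
rewrite -rE -sE.
case: (eqVneq (quad f g h r) 0) => [|Nr]; first by left.
case: (eqVneq (quad c e h s) 0) => [|Ms]; first by right.
exfalso.
have br : b * r + c = 0 by rewrite rE; field; exact: lt0r_neq0.
have ds : d * s + f = 0 by rewrite sE; field; exact: lt0r_neq0.
have [td [P t0 t1]] := orb_place O s r.
have step n : td (z (n.*2)) s -> td (z n.*2.+1) r ->
  [/\ td (z n.*2.+2)^-1 0, td (z n.*2.+4) s & td (z n.*2.+1.+4) r].
  have n0 := orb_neq0 O.
  have lb i := orb_lin O i (ltW b0) (ltW c0) (addr_gt0 b0 c0).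
  have ld i := orb_lin O i (ltW d0) (ltW f0) (addr_gt0 d0 f0).
  by apply: (crossing_step br ds _ _ _ _ Ms Nr P (n0 _) (n0 _) (n0 _) (n0 _)
    (n0 _) (n0 _) (lb _) (lb _) (ld _) (ld _) (orb_F O n) (orb_G O n)
    (orb_F O n.+1) (orb_G O n.+1)); exact: lt0r_neq0.
have all j : td (z (j.*2).*2) s /\ td (z (j.*2).*2.+1) r.
  elim: j => [|j [h1 h2]]; first by split.
  by have [] := step _ h1 h2.
have [h1 h2] := all m./2; have [h3 _ _] := step _ h1 h2.
have em : (m./2.*2).*2.+2 = (0 + m.*2)%N.
  by rewrite -[m in RHS]odd_double_half om add0n doubleD.
rewrite em (orb_per O) in h3.
by apply: (td_pole P (orb_neq0 O 0) h3 t0).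
Qed.
End CrossPeriod.

Section CommonRoot.
Variables (k : realFieldType) (K : fieldType) (io : {rmorphism k -> K}).

Lemma middle_coef (b c f g h : k) : b != 0 -> c != 0 ->
  quad f g h (- c / b) = 0 -> g = f * c / b + b * h / c.
Proof.
move=> b0 c0 N0.
apply/eqP; rewrite -subr_eq0; apply/eqP.
transitivity (- (b / c) * quad f g h (- c / b)); last by rewrite N0 mulr0.
by rewrite /quad; field; conjs.
Qed.

(** The numerator is then a multiple of the denominator. *)
Lemma fraction_linear (b c f g h : k) (u : K) : b != 0 -> c != 0 ->
  quad f g h (- c / b) = 0 -> quad 0 (io b) (io c) u != 0 ->
  quad (io f) (io g) (io h) u / quad 0 (io b) (io c) u = io (f / b) * u + io (h / c).
Proof.
move=> b0 c0 N0; rewrite quadl => D0.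
rewrite (middle_coef b0 c0 N0); apply: (canLR (mulfK D0)); rewrite /quad.
have b1 : io b != 0 by rewrite fmorph_eq0.
have c1 : io c != 0 by rewrite fmorph_eq0.
by field; conjs.
Qed.

End CommonRoot.

Section Period3.
Variables (k : realFieldType) (K : fieldType) (io : {rmorphism k -> K}).
Variables b c e f g h : k.
Hypotheses (b0 : 0 < b) (c0 : 0 < c) (f0 : 0 < f) (e0 : 0 <= e).
Let G (u : K) := quad (io c) (io e) (io h) u / io f.
Variable z : nat -> K.

(** Specialize y to the root r of the denominator of F. Forward, z_2, z_3 and
    z_4 are infinite if the numerator does not vanish at r; backward, z_5 = G(x)
    / y and z_4 = F(z_5) / x are finite for a suitable x. *)
Lemma period3_cancels :
  orbit io (fun u => quad (io f) (io g) (io h) u / quad 0 (io b) (io c) u) G 3 z ->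
  quad f g h (- c / b) = 0.
Proof.
move=> O; have [r rE] := named (- c / b).
have bn := lt0r_neq0 b0; have cn := lt0r_neq0 c0; have fn := lt0r_neq0 f0.
have r0 : r != 0 by rewrite rE mulf_neq0 ?invr_eq0 ?oppr_eq0.
have br : b * r + c = 0 by rewrite rE; field.
rewrite -rE; apply/eqP; case: (eqVneq (quad f g h r) 0) => // Nr; exfalso.
(* G(x0) / y avoids the root of the denominator of F for one of x0 = 1, 2,
   because G is increasing *)
have [x0 x0p hx] : exists2 x0, 0 < x0 & quad c e h x0 / f / r * b + c != 0.
  case: (eqVneq (quad c e h 1 / f / r * b + c) 0) => [h1|]; last by exists 1.
  exists 2 => //; apply/eqP => h2.
  have : quad c e h 1 = quad c e h 2.
    apply: (mulIf (invr_neq0 fn)); apply: (mulIf (invr_neq0 r0)).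
    by apply: (mulIf bn); apply: (addIr c); rewrite h1 h2.
  by move: c0 e0; rewrite /quad; lra.
have [td [P t0 t1]] := orb_place O x0 r.
have n0 := orb_neq0 O.
have lb i := orb_lin O i (ltW b0) (ltW c0) (addr_gt0 b0 c0).
have io_f : io f != 0 by rewrite fmorph_eq0.
have e2 : z 2 = _ / z 0 := orb_F O 0.
have e3 : z 3 = _ / z 1 := orb_G O 0.
have e4 : z 4 = _ / z 2 := orb_F O 1.
have e5 : z 5 = _ / z 7 := orb_Gb O 2.
have e4' : z 4 = _ / z 6 := orb_Fb O 2.
have p6 : z 6 = z 0 := orb_per O 0.
have p7 : z 7 = z 1 := orb_per O 1.
have N1 : quad (io f) (io g) (io h) (z 1) != 0.
  by move: (n0 2); rewrite e2; apply: contraNneq => ->; rewrite !mul0r.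
have N3 : quad (io f) (io g) (io h) (z 3) != 0.
  by move: (n0 4); rewrite e4; apply: contraNneq => ->; rewrite !mul0r.
have M2 : quad (io c) (io e) (io h) (z 2) != 0.
  by move: (n0 3); rewrite e3 /G; apply: contraNneq => ->; rewrite /G !mul0r.
have x0n := lt0r_neq0 x0p.
have tD1 : td (quad 0 (io b) (io c) (z 1)) 0 by rewrite quadl -br; values P.
have w2 : td (z 2)^-1 0.
  rewrite e2 !invf_div; apply: td_val; first by values P.
  by rewrite mul0r mulr0.
have a2 := td_quad_inf P c e h (n0 2) w2.
have q3 : td ((z 3)^-1 * z 2) 0.
  apply: (td_eq (io f * z 1 * (z 2)^-1 / (quad (io c) (io e) (io h) (z 2) / z 2 ^+ 2))).
  - by values P.
  - by rewrite e3 /G; field; conjs.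
  - by rewrite mulr0 mul0r.
have w3 : td (z 3)^-1 0.
  apply: (td_eq ((z 3)^-1 * z 2 * (z 2)^-1)); first by values P.
    by field; conjs.
  by rewrite mul0r.
have a3 := td_quad_inf P f g h (n0 3) w3.
have l3 := td_lin_inf P b c (n0 3) w3.
have w4 : td (z 4)^-1 0.
  apply: (td_eq ((quad 0 (io b) (io c) (z 3) / z 3) /
    (quad (io f) (io g) (io h) (z 3) / z 3 ^+ 2) * ((z 3)^-1 * z 2))).
  - by values P.
  - by rewrite e4; field; conjs.
  - by rewrite mulr0.
have t5 : td (z 5) (quad c e h x0 / f / r).
  by rewrite e5 p6 p7 /G; values P.
apply: (td_pole P (n0 4) w4).
rewrite e4' p6 quadl; values P.
by rewrite mulrC.
Qed.

(** At y = - be / al one has z_2 = 0 and z_3 = h / (f y), while the backward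
    computation shows that z_4 is finite; hence al z_3 + be = z_4 z_2
    vanishes. *)
Lemma period3_linear_root al be : al != 0 -> be != 0 ->
  orbit io (fun u => io al * u + io be) G 3 z ->
  h / f = (be / al) ^+ 2.
Proof.
move=> al0 be0 O; have [y0 y0E] := named (- be / al).
have fn := lt0r_neq0 f0.
have y0n : y0 != 0 by rewrite y0E mulf_neq0 ?invr_eq0 ?oppr_eq0.
have [td [P t0 t1]] := orb_place O 1 y0.
have n0 := orb_neq0 O.
have e2 : z 2 = _ / z 0 := orb_F O 0.
have e3 : z 3 = _ / z 1 := orb_G O 0.
have e4 : z 4 = _ / z 2 := orb_F O 1.
have e5 : z 5 = _ / z 7 := orb_Gb O 2.
have e4' : z 4 = _ / z 6 := orb_Fb O 2.
have p6 : z 6 = z 0 := orb_per O 0.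
have p7 : z 7 = z 1 := orb_per O 1.
have F0 : al * y0 + be = 0 by rewrite y0E; field.
have t2 : td (z 2) 0.
  by rewrite e2 -(mul0r (1^-1)) -{1}F0; values P; rewrite oner_eq0.
have t3 : td (z 3) (h / f / y0).
  rewrite e3 /G; apply: td_val; first by values P.
  by rewrite /quad expr0n /= !mulr0 !add0r.
have t5 : td (z 5) (quad c e h 1 / f / y0).
  by rewrite e5 p6 p7 /G; values P.
have t4 : td (z 4) (al * (quad c e h 1 / f / y0) + be).
  by rewrite e4' p6; apply: td_val; [values P; rewrite oner_eq0 | rewrite divr1].
have e43 : io al * z 3 + io be = z 4 * z 2 by rewrite e4; field; conjs.
have h1 : td (io al * z 3 + io be) (al * (h / f / y0) + be) by values P.
have h2 : td (io al * z 3 + io be) 0.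
  rewrite e43; apply: td_val; first by values P.
  by rewrite mulr0.
have := td_uniq P h1 h2 => hE.
have -> : h / f = (al * (h / f / y0) + be) * (y0 / al) - be * y0 / al by field; conjs.
by rewrite hE y0E; field.
Qed.
End Period3.

Section Period3Monomial.
Variables (k : realFieldType) (K : fieldType) (io : {rmorphism k -> K}).
Variables al c d e f : k.
Hypotheses (a0 : 0 < al) (c0 : 0 < c) (d0 : 0 < d) (f0 : 0 < f) (e0 : 0 < e).
Variable z : nat -> K.

(** Take x at the root s of the denominator of G, and y such that z_2 is the
    root - e / c of its numerator. Forward, z_3 = 0; backward, z_5 and z_4 are
    infinite and z_3 is nonzero. Only the coincidence of the two roots avoids
    this. *)
Lemma period3_monomial_root :
  orbit io (fun u => io al * u) (fun u => quad (io c) (io e) (io 0) u / quad 0 (io d) (io f) u)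
    3 z ->
  c * f = d * e.
Proof.
move=> O; have [s sE] := named (- f / d).
have [y0 y0E] := named (- e * s / (c * al)).
have an := lt0r_neq0 a0; have cn := lt0r_neq0 c0; have fn := lt0r_neq0 f0.
have dn := lt0r_neq0 d0; have en := lt0r_neq0 e0.
have s0 : s != 0 by rewrite sE mulf_neq0 ?invr_eq0 ?oppr_eq0.
have y0n : y0 != 0 by rewrite y0E !mulf_neq0 ?invr_eq0 ?oppr_eq0 ?mulf_neq0.
have ds : d * s + f = 0 by rewrite sE; field.
apply/eqP; case: (eqVneq (c * f) (d * e)) => // ne; exfalso.
have Ms : quad c e 0 s != 0.
  apply: contra ne => /eqP h1; rewrite -subr_eq0; apply/eqP.
  transitivity (- (d / s) * quad c e 0 s); last by rewrite h1 mulr0.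
  by rewrite /quad sE; field; conjs.
have [td [P t0 t1]] := orb_place O s y0.
have n0 := orb_neq0 O.
have ld i := orb_lin O i (ltW d0) (ltW f0) (addr_gt0 d0 f0).
have ioa : io al != 0 by rewrite fmorph_eq0.
have e2 : z 2 = _ / z 0 := orb_F O 0.
have e3 : z 3 = _ / z 1 := orb_G O 0.
have e5 : z 5 = _ / z 7 := orb_Gb O 2.
have e4 : z 4 = _ / z 6 := orb_Fb O 2.
have e3' : z 3 = _ / z 5 := orb_Gb O 1.
have p6 : z 6 = z 0 := orb_per O 0.
have p7 : z 7 = z 1 := orb_per O 1.
have M0 : quad (io c) (io e) (io 0) (z 0) != 0.
  by move: (n0 5); rewrite e5 p6 p7; apply: contraNneq => ->; rewrite !mul0r.
have tE : td (quad 0 (io d) (io f) (z 0)) 0 by rewrite quadl -ds; values P.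
have w5 : td (z 5)^-1 0.
  rewrite e5 p6 p7 !invf_div; apply: td_val; first by values P.
  by rewrite mul0r mulr0.
have w4 : td (z 4)^-1 0.
  apply: (td_eq (z 0 / io al * (z 5)^-1)); first by values P.
    by rewrite e4 p6; field; conjs.
  by rewrite mulr0.
have a4 := td_quad_inf P c e 0 (n0 4) w4.
have l4 := td_lin_inf P d f (n0 4) w4.
have t3 : td (z 3) (c / d * (al / s)).
  apply: (td_eq ((quad (io c) (io e) (io 0) (z 4) / z 4 ^+ 2) /
    (quad 0 (io d) (io f) (z 4) / z 4) * (io al / z 0))); [by values P| |by []].
  rewrite e3'; set X := quad _ _ _ _; set Y := quad _ _ _ _.
  have Y0 : Y != 0 by apply: ld.
  by rewrite e4 p6; field; conjs.
have t2 : td (z 2) (- e / c).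
  rewrite e2; apply: td_val; first by values P.
  by rewrite y0E; field; conjs.
have t3' : td (z 3) 0.
  have D2 : d * (- e / c) + f != 0.
    apply: contra ne => /eqP h1; rewrite -subr_eq0; apply/eqP.
    transitivity (c * (d * (- e / c) + f)); last by rewrite h1 mulr0.
    by field.
  rewrite e3 quadl; apply: td_val; first by values P.
  by rewrite (_ : quad c e 0 _ = 0) ?mul0r //; rewrite /quad; field.
have /eqP := td_uniq P t3 t3'.
by rewrite !mulf_eq0 !invr_eq0 (negbTE an) (negbTE cn) (negbTE dn) (negbTE s0).
Qed.
End Period3Monomial.

Section Period7Monomial.
Variables (k : realFieldType) (K : fieldType) (io : {rmorphism k -> K}).
Variables al c d f : k.
Hypotheses (a0 : 0 < al) (c0 : 0 < c) (d0 : 0 < d) (f0 : 0 < f).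
Variable z : nat -> K.

(** The even terms u_n = z_(2n) satisfy u_(n+1) u_(n-1) (d u_n + f) = q. With
    u_0 at the root of d u + f, going back from u_7 = u_0 and u_8 = u_1 gives
    u_6 infinite, u_5 = u_4 = 0 and u_2 = u_0, whereas going forward u_2 depends
    on u_1 as q / ((d u_1 + f) u_0). *)
Lemma monomial_period7_false :
  orbit io (fun u => io al * u) (fun u => io c * u ^+ 2 / quad 0 (io d) (io f) u) 7 z -> False.
Proof.
move=> O; have [s sE] := named (- f / d).
have [q qE] := named (al ^+ 2 * c).
(* t is chosen so that u_2 (d t + f) = q / sigma and u_2 = sigma conflict *)
have [t tE] := named (q * d / f ^+ 2).
have [y0 y0E] := named (t * s / al).
have an := lt0r_neq0 a0; have cn := lt0r_neq0 c0; have fn := lt0r_neq0 f0.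
have dn := lt0r_neq0 d0; have qp : 0 < q by rewrite qE mulr_gt0 ?exprn_gt0.
have qn := lt0r_neq0 qp.
have tp : 0 < t by rewrite tE divr_gt0 ?exprn_gt0 ?mulr_gt0.
have tn := lt0r_neq0 tp.
have s0 : s != 0 by rewrite sE mulf_neq0 ?invr_eq0 ?oppr_eq0.
have ds : d * s + f = 0 by rewrite sE; field.
have [td [P t0 t1]] := orb_place O s y0.
have n0 := orb_neq0 O.
have ld i : io d * z i + io f != 0.
  by have := orb_lin O i (ltW d0) (ltW f0) (addr_gt0 d0 f0); rewrite quadl.
have ioa : io al != 0 by rewrite fmorph_eq0.
have rec n : z n.*2.+4 * z n.*2 * (io d * z n.*2.+2 + io f) = io q.
  have := orb_F O n.+1; have := orb_F O n; have := orb_G O n.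
  have := n0 n.*2.+1; have := n0 n.*2; have := n0 n.*2.+2; have := ld n.*2.+2; rewrite doubleS.
  move=> l2 m2 m0 m1 -> E ->; rewrite quadl qE in l2 *.
  have -> : z n.*2.+1 = z n.*2.+2 * z n.*2 / io al by rewrite E; field; conjs.
  by field; conjs.
have r6 : z 16 * z 12 * (io d * z 14 + io f) = io q := rec 6%N.
have r5 : z 14 * z 10 * (io d * z 12 + io f) = io q := rec 5%N.
have r4 : z 12 * z 8 * (io d * z 10 + io f) = io q := rec 4%N.
have r3 : z 10 * z 6 * (io d * z 8 + io f) = io q := rec 3%N.
have r2 : z 8 * z 4 * (io d * z 6 + io f) = io q := rec 2%N.
have r0 : z 4 * z 0 * (io d * z 2 + io f) = io q := rec 0%N.
have p14 : z 14 = z 0 := orb_per O 0.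
have p16 : z 16 = z 2 := orb_per O 2.
rewrite p16 p14 in r6; rewrite p14 in r5.
have e2 : z 2 = _ / z 0 := orb_F O 0.
have t2 : td (z 2) t.
  rewrite e2; apply: td_val; first by values P.
  by rewrite y0E; field; conjs.
have ioq : io q != 0 by rewrite fmorph_eq0.
move: (n0 0%N) (n0 2) (n0 4) (n0 6) (n0 8) (n0 10) (n0 12) (ld 0%N) (ld 2) (ld 4) (ld 6) (ld 8)
  (ld 10) (ld 12).
move=> m0 m2 m4 m6 m8 m10 m12 l0 l2 l4 l6 l8 l10 l12.
have w12 : td (z 12)^-1 0.
  apply: (td_eq (z 2 * (io d * z 0 + io f) / io q)); first by values P.
    by rewrite -r6; field; conjs.
  by rewrite ds mulr0 mul0r.
have q1012 : td (z 10 * z 12) (q / (d * s)).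
  apply: (td_eq (io q / ((io d + io f * (z 12)^-1) * z 0))).
  - by values P; rewrite mulr0 addr0 !mulf_neq0.
  - by rewrite -r5; field; conjs.
  - by rewrite mulr0 addr0.
have t10 : td (z 10) 0.
  apply: (td_eq ((z 10 * z 12) * (z 12)^-1)); first by values P.
    by field.
  by rewrite mulr0.
have q812 : td (z 8 * z 12) (q / f).
  apply: (td_eq (io q / (io d * z 10 + io f))).
  - by values P; rewrite mulr0 add0r.
  - by rewrite -r4; field; conjs.
  - by rewrite mulr0 add0r.
have t8 : td (z 8) 0.
  apply: (td_eq ((z 8 * z 12) * (z 12)^-1)); first by values P.
    by field.
  by rewrite mulr0.
have q610 : td (z 6 * z 10) (q / f).
  apply: (td_eq (io q / (io d * z 8 + io f))).
  - by values P; rewrite mulr0 add0r.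
  - by rewrite -r3; field; conjs.
  - by rewrite mulr0 add0r.
have dsn : d * s != 0 by rewrite mulf_neq0.
have t4 : td (z 4) s.
  apply: (td_eq (io q / (io d * ((z 6 * z 10) * (z 8 * z 12) / (z 10 * z 12)) + io f * z 8))).
  - values P; first by rewrite mulf_neq0 // invr_eq0.
    by rewrite mulr0 addr0 !mulf_neq0 // ?invr_eq0 // mulf_neq0 // invr_eq0.
  - by rewrite -r2; field; conjs; rewrite mulrA -mulrDl mulf_neq0.
  - by rewrite mulr0 addr0 sE; field; conjs.
have t4' : td (z 4) (q / ((d * t + f) * s)).
  have tf : d * t + f != 0 by apply: lt0r_neq0; rewrite addr_gt0 ?mulr_gt0.
  apply: (td_eq (io q / ((io d * z 2 + io f) * z 0))); last by [].
  - by values P; rewrite mulf_neq0.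
  - by rewrite -r0; field; conjs.
have := td_uniq P t4 t4' => E.
have tf : d * t + f != 0 by apply: lt0r_neq0; rewrite addr_gt0 ?mulr_gt0.
have : s ^+ 2 * (d * t + f) = q by rewrite expr2 {1}E; field; conjs.
have -> : s ^+ 2 * (d * t + f) = q + f ^+ 3 / d ^+ 2 by rewrite sE tE; field; conjs.
have : 0 < f ^+ 3 / d ^+ 2 by rewrite divr_gt0 ?exprn_gt0.
by lra.
Qed.
End Period7Monomial.

Section Period4.
Variables (k : realFieldType) (K : fieldType) (io : {rmorphism k -> K}).
Variables b c f g q x0 : k.
Hypotheses (b0 : 0 < b) (c0 : 0 < c) (f0 : 0 < f) (g0 : 0 < g).
Hypotheses (x00 : x0 != 0) (x0E : x0 ^+ 2 = g / b) (qE : q = c / f).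
Variable z : nat -> K.

(** With y at the pole r of F and x^2 = g / b, forward z_2 and z_3 are infinite
    and z_5 = r; backward z_7 is the root - g / f of the numerator of F, so that
    z_6 and z_5 vanish. This is consistent only if that root is r. *)
Lemma period4_cancels :
  orbit io (fun u => quad (io f) (io g) (io 0) u / quad 0 (io b) (io c) u)
    (fun u => io q * u ^+ 2) 4 z -> b * g = c * f.
Proof.
move=> O; have [r rE] := named (- c / b).
have bn := lt0r_neq0 b0; have cn := lt0r_neq0 c0; have fn := lt0r_neq0 f0.
have gn := lt0r_neq0 g0.
have qn : q != 0 by rewrite qE mulf_neq0 ?invr_eq0.
have r0 : r != 0 by rewrite rE mulf_neq0 ?invr_eq0 ?oppr_eq0.
have br : b * r + c = 0 by rewrite rE; field.
apply/eqP; case: (eqVneq (b * g) (c * f)) => // ne; exfalso.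
have Nr : quad f g 0 r != 0.
  apply: contra ne => /eqP h1; rewrite -subr_eq0; apply/eqP.
  transitivity ((b / r) * quad f g 0 r); last by rewrite h1 mulr0.
  by rewrite /quad rE; field; conjs.
have [td [P t0 t1]] := orb_place O x0 r.
have n0 := orb_neq0 O.
have lb i := orb_lin O i (ltW b0) (ltW c0) (addr_gt0 b0 c0).
have ioq : io q != 0 by rewrite fmorph_eq0.
have e2 : z 2 = _ / z 0 := orb_F O 0.
have e3 : z 3 = _ / z 1 := orb_G O 0.
have e4 : z 4 = _ / z 2 := orb_F O 1.
have e5 : z 5 = _ / z 3 := orb_G O 1.
have e7 : z 7 = _ / z 9 := orb_Gb O 3.
have e6 : z 6 = _ / z 8 := orb_Fb O 3.
have e5' : z 5 = _ / z 7 := orb_Gb O 2.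
have p8 : z 8 = z 0 := orb_per O 0.
have p9 : z 9 = z 1 := orb_per O 1.
rewrite p8 p9 in e7 e6.
have N1 : quad (io f) (io g) (io 0) (z 1) != 0.
  by move: (n0 2); rewrite e2; apply: contraNneq => ->; rewrite !mul0r.
have tD : td (quad 0 (io b) (io c) (z 1)) 0 by rewrite quadl -br; values P.
have w2 : td (z 2)^-1 0.
  rewrite e2 !invf_div; apply: td_val; first by values P.
  by rewrite mul0r mulr0.
have w3 : td (z 3)^-1 0.
  apply: (td_eq (z 1 / io q * (z 2)^-1 ^+ 2)); first by values P.
    by rewrite e3; field; conjs.
  by rewrite expr0n mulr0.
have a3 := td_quad_inf P f g 0 (n0 3) w3.
have l3 := td_lin_inf P b c (n0 3) w3.
have q42 : td (z 4 / z 2) (f / b * (q / r)).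
  apply: (td_eq ((quad (io f) (io g) (io 0) (z 3) / z 3 ^+ 2) /
    (quad 0 (io b) (io c) (z 3) / z 3) * (io q / z 1))); [by values P| |by []].
  rewrite e4; have := lb 3; set X := quad _ _ _ _; set Y := quad _ _ _ _ => Y0.
  by rewrite e3; field; conjs.
have t5 : td (z 5) r.
  apply: (td_eq ((z 4 / z 2) ^+ 2 * z 1)); first by values P.
    by rewrite e5 e3; field; conjs.
  by rewrite qE rE; field; conjs.
have t7 : td (z 7) (- g / f).
  rewrite e7; apply: td_val; first by values P.
  by rewrite x0E qE rE; field; conjs.
have Period7Affine : b * (- g / f) + c != 0.
  apply: contra ne => /eqP h1; rewrite -subr_eq0; apply/eqP.
  transitivity (- f * (b * (- g / f) + c)); last by rewrite h1 mulr0.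
  by field.
have t6 : td (z 6) 0.
  rewrite e6 quadl; apply: td_val; first by values P.
  rewrite (_ : quad f g 0 _ = 0) ?mul0r //.
  by rewrite /quad; field.
have t5' : td (z 5) 0.
  rewrite e5'; apply: td_val; first by values P; rewrite mulf_neq0 ?invr_eq0 ?oppr_eq0.
  by rewrite expr0n mulr0 mul0r.
by move/eqP: (td_uniq P t5 t5'); rewrite (negbTE r0).
Qed.
End Period4.

Section Period4Square.
Variables (k : realFieldType) (K : fieldType) (io : {rmorphism k -> K}).
Variables b c e f : k.
Hypotheses (b0 : 0 < b) (c0 : 0 < c) (f0 : 0 < f) (e0 : 0 < e).
Variable z : nat -> K.

(** With y at the pole r of F and x at the root - e / c of G, forward z_2, z_3,
    z_4 are infinite and z_5 = r; backward z_7, z_6 and z_5 vanish. *)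
Lemma square_period4_false :
  orbit io (fun u => io f * u ^+ 2 / quad 0 (io b) (io c) u)
    (fun u => quad (io c) (io e) (io 0) u / io f) 4 z -> False.
Proof.
move=> O; have [r rE] := named (- c / b).
have [x0 x0E] := named (- e / c).
have bn := lt0r_neq0 b0; have cn := lt0r_neq0 c0; have fn := lt0r_neq0 f0.
have en := lt0r_neq0 e0.
have r0 : r != 0 by rewrite rE mulf_neq0 ?invr_eq0 ?oppr_eq0.
have x00 : x0 != 0 by rewrite x0E mulf_neq0 ?invr_eq0 ?oppr_eq0.
have br : b * r + c = 0 by rewrite rE; field.
have [td [P t0 t1]] := orb_place O x0 r.
have n0 := orb_neq0 O.
have lb i := orb_lin O i (ltW b0) (ltW c0) (addr_gt0 b0 c0).
have iof : io f != 0 by rewrite fmorph_eq0.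
have e2 : z 2 = _ / z 0 := orb_F O 0.
have e3 : z 3 = _ / z 1 := orb_G O 0.
have e4 : z 4 = _ / z 2 := orb_F O 1.
have e5 : z 5 = _ / z 3 := orb_G O 1.
have e7 : z 7 = _ / z 9 := orb_Gb O 3.
have e6 : z 6 = _ / z 8 := orb_Fb O 3.
have e5' : z 5 = _ / z 7 := orb_Gb O 2.
have p8 : z 8 = z 0 := orb_per O 0.
have p9 : z 9 = z 1 := orb_per O 1.
rewrite p8 p9 in e7 e6.
have tD : td (quad 0 (io b) (io c) (z 1)) 0 by rewrite quadl -br; values P.
have w2 : td (z 2)^-1 0.
  apply: (td_eq (quad 0 (io b) (io c) (z 1) * (z 0 / (io f * z 1 ^+ 2)))).
  - by values P; rewrite mulf_neq0 // expf_neq0.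
  - by rewrite e2; move: (lb 1%N) => l1; field; conjs.
  - by rewrite mul0r.
have a2 := td_quad_inf P c e 0 (n0 2) w2.
have q32 : td (z 3 / z 2 ^+ 2) (c / (f * r)).
  apply: (td_eq ((quad (io c) (io e) (io 0) (z 2) / z 2 ^+ 2) / (io f * z 1)));
    [by values P; rewrite mulf_neq0| |by []].
  by rewrite e3; field; conjs.
have q320 : c / (f * r) != 0 by rewrite mulf_neq0 // invr_eq0 mulf_neq0.
have w3 : td (z 3)^-1 0.
  apply: (td_eq ((z 3 / z 2 ^+ 2)^-1 * (z 2)^-1 ^+ 2)); first by values P.
    by field; conjs.
  by rewrite expr0n mulr0.
have l3 := td_lin_inf P b c (n0 3) w3.
have q42 : td (z 4 / z 2) (f / b * (c / (f * r))).
  apply: (td_eq (io f / (quad 0 (io b) (io c) (z 3) / z 3) * (z 3 / z 2 ^+ 2)));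
    [by values P| |by []].
  by rewrite e4; have := lb 3; set Y := quad _ _ _ _ => Y0; field; conjs.
have q420 : f / b * (c / (f * r)) != 0 by rewrite !(mulf_neq0, invr_neq0).
have w4 : td (z 4)^-1 0.
  apply: (td_eq ((z 4 / z 2)^-1 * (z 2)^-1)); first by values P.
    by field; conjs.
  by rewrite mulr0.
have a4 := td_quad_inf P c e 0 (n0 4) w4.
have t5 : td (z 5) r.
  apply: (td_eq ((quad (io c) (io e) (io 0) (z 4) / z 4 ^+ 2) / io f * (z 4 / z 2) ^+ 2 /
    (z 3 / z 2 ^+ 2))); first by values P.
    by rewrite e5; field; conjs.
  by rewrite rE; field; conjs.
have t7 : td (z 7) 0.
  rewrite e7; apply: td_val; first by values P.
  by rewrite /quad x0E; field; conjs.
have q67 : td (z 6 / z 7) 0.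
  apply: (td_eq (io f * z 7 / ((io b * z 7 + io c) * z 0))).
  - by values P; rewrite mulr0 add0r mulf_neq0.
  - by rewrite e6; have := lb 7; rewrite quadl => l7; field; conjs.
  - by rewrite mulr0 mul0r.
have t6 : td (z 6) 0.
  apply: (td_eq (z 6 / z 7 * z 7)); first by values P.
    by field.
  by rewrite mulr0.
have t5' : td (z 5) 0.
  apply: (td_eq ((io c * z 6 + io e) / io f * (z 6 / z 7))); first by values P.
    by rewrite e5' /quad rmorph0; field; conjs.
  by rewrite mulr0.
by move/eqP: (td_uniq P t5 t5'); rewrite (negbTE r0).
Qed.
End Period4Square.

Section Period5.
Variables (k : realFieldType) (K : fieldType) (io : {rmorphism k -> K}).
Variables al be c d e f h : k.
Hypotheses (a0 : 0 < al) (be0 : 0 < be) (c0 : 0 < c) (d0 : 0 < d) (f0 : 0 < f) (h0 : 0 < h).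
Hypothesis beE : be = h / c.
Variable z : nat -> K.

(** Suppose that the numerator of G does not vanish at the root s of its
    denominator, and specialize x to s. Backward, z_9 and z_8 are infinite, z_7
    = r = - c al / f, z_6 = 0 and z_5 = h / (f r). If F(r) is nonzero, take y at
    the root of F: then z_2 = 0, z_3 = r, and z_4, z_5 are infinite. If F(r) =
    0, the backward computation makes z_4 infinite, but it is finite forward for
    a positive y. *)
Lemma period5_cancels :
  orbit io (fun u => io al * u + io be)
    (fun u => quad (io c) (io e) (io h) u / quad 0 (io d) (io f) u) 5 z ->
  quad c e h (- f / d) = 0.
Proof.
move=> O.
have [s sE] := named (- f / d).
have [r rE] := named (- (c * al / f)).
have [y0 y0E] := named (- be / al).
have an := lt0r_neq0 a0; have cn := lt0r_neq0 c0; have fn := lt0r_neq0 f0.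
have dn := lt0r_neq0 d0; have hn := lt0r_neq0 h0; have bn := lt0r_neq0 be0.
have s0 : s != 0 by rewrite sE mulf_neq0 ?invr_eq0 ?oppr_eq0.
have r0 : r != 0 by rewrite rE oppr_eq0 !mulf_neq0 ?invr_eq0.
have y0n : y0 != 0 by rewrite y0E mulf_neq0 ?invr_eq0 ?oppr_eq0.
have ds : d * s + f = 0 by rewrite sE; field.
rewrite -sE; apply/eqP; case: (eqVneq (quad c e h s) 0) => // Ms; exfalso.
have n0 := orb_neq0 O.
have ld i := orb_lin O i (ltW d0) (ltW f0) (addr_gt0 d0 f0).
have ioa : io al != 0 by rewrite fmorph_eq0.
have e2 : z 2 = (io al * z 1 + io be) / z 0 := orb_F O 0.
have e3 : z 3 = quad (io c) (io e) (io h) (z 2) / quad 0 (io d) (io f) (z 2) / z 1 := orb_G O 0.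
have e4 : z 4 = (io al * z 3 + io be) / z 2 := orb_F O 1.
have e5 : z 5 = quad (io c) (io e) (io h) (z 4) / quad 0 (io d) (io f) (z 4) / z 3 := orb_G O 1.
have p10 : z 10 = z 0 := orb_per O 0.
have p11 : z 11 = z 1 := orb_per O 1.
have e9 : z 9 = quad (io c) (io e) (io h) (z 0) / quad 0 (io d) (io f) (z 0) / z 1.
  by rewrite -p10 -p11; exact: orb_Gb O 4.
have e8 : z 8 = (io al * z 9 + io be) / z 0 by rewrite -p10; exact: orb_Fb O 4.
have e7 : z 7 = quad (io c) (io e) (io h) (z 8) / quad 0 (io d) (io f) (z 8) / z 9 := orb_Gb O 3.
have e6 : z 6 = (io al * z 7 + io be) / z 8 := orb_Fb O 3.
have e5' : z 5 = quad (io c) (io e) (io h) (z 6) / quad 0 (io d) (io f) (z 6) / z 7 := orb_Gb O 2.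
have e4' : z 4 = (io al * z 5 + io be) / z 6 := orb_Fb O 2.
have M0 : quad (io c) (io e) (io h) (z 0) != 0.
  by move: (n0 9); rewrite e9; apply: contraNneq => ->; rewrite !mul0r.
have M4 : quad (io c) (io e) (io h) (z 4) != 0.
  by move: (n0 5); rewrite e5; apply: contraNneq => ->; rewrite !mul0r.
(* the backward values do not depend on y *)
have back td : is_place io td -> forall y, y != 0 -> td (z 0) s -> td (z 1) y ->
    [/\ td (z 8)^-1 0, td (z 7) r, td (z 6) 0 & td (z 5) (h / f / r)].
  move=> P y yn t0 t1.
  have tE : td (quad 0 (io d) (io f) (z 0)) 0 by rewrite quadl -ds; values P.
  have w9 : td (z 9)^-1 0.
    rewrite e9 !invf_div; apply: td_val; first by values P.
    by rewrite mul0r mulr0.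
  have q89 : td (z 8 / z 9) (al / s).
    apply: (td_eq ((io al + io be * (z 9)^-1) / z 0)); first by values P.
      by rewrite e8; field; conjs.
    by rewrite mulr0 addr0.
  have w8 : td (z 8)^-1 0.
    apply: (td_eq ((z 8 / z 9)^-1 * (z 9)^-1)); first by values P; rewrite mulf_neq0 ?invr_neq0.
      by field; conjs.
    by rewrite mulr0.
  have a8 := td_quad_inf P c e h (n0 8) w8.
  have l8 := td_lin_inf P d f (n0 8) w8.
  have t7 : td (z 7) r.
    apply: (td_eq ((quad (io c) (io e) (io h) (z 8) / z 8 ^+ 2) /
      (quad 0 (io d) (io f) (z 8) / z 8) * (z 8 / z 9))); first by values P.
      by rewrite e7; move: (ld 8) => l; field; conjs.
    by rewrite rE sE; field; conjs.
  have t6 : td (z 6) 0.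
    rewrite e6; apply: td_val; first by values P.
    by rewrite mulr0.
  split=> //; rewrite e5' quadl; apply: td_val.
    by values P; rewrite mulr0 add0r.
  by rewrite /quad expr0n /= !mulr0 !add0r.
case: (eqVneq (al * r + be) 0) => [Fr|Fr].
  have hE : h = r ^+ 2 * f.
    have -> : h = be * c by rewrite beE; field.
    have -> : be = - (al * r) by apply/eqP; rewrite -addr_eq0 addrC Fr.
    by rewrite rE; field.
  (* one of y = 1, 2 keeps z_2 away from the pole of G *)
  have [y yp] : exists2 y, 0 < y & d * ((al * y + be) / s) + f != 0.
    case: (eqVneq (d * ((al * 1 + be) / s) + f) 0) => [h1|]; last by exists 1.
    exists 2 => //; apply/eqP => h2.
    have : al * 1 + be = al * 2 + be.
      apply: (mulIf (invr_neq0 s0)); apply: (mulfI dn).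
      by apply: (addIr f); rewrite h1 h2.
    by move: a0; lra.
  have yn := lt0r_neq0 yp.
  have [td [P t0 t1]] := orb_place O s y.
  have [w8 t7 t6 t5] := back td P y yn t0 t1 => E2.
  have t2 : td (z 2) ((al * y + be) / s) by rewrite e2; values P.
  have v2 : (al * y + be) / s != 0.
    by rewrite mulf_neq0 ?invr_neq0 // lt0r_neq0 // addr_gt0 // mulr_gt0.
  (* z_4 z_7 = al (c z_6 + e - r^2 d) / (d z_6 + f) - r z_8: the zero of F at r
     cancels the pole of 1 / z_6, and z_8 is the only infinite term left *)
  have w4 : td (z 4)^-1 0.
    have z6E : z 6 * z 8 = io al * (z 7 - io r).
      rewrite e6 -[io be]/(io be) (_ : io be = - (io al * io r)); first by field.
      by rewrite -rmorphM -rmorphN; congr (io _); apply/eqP; rewrite -addr_eq0 addrC Fr.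
    apply: (td_eq (z 7 * (z 8)^-1 / (io al * (io c * z 6 + io e - io r ^+ 2 * io d) /
      (io d * z 6 + io f) * (z 8)^-1 - io r))).
    - by values P; rewrite mulr0 ?add0r ?sub0r ?oppr_eq0.
    - have := ld 6; rewrite quadl => l6.
      have z7E : z 7 = io r + z 6 * z 8 / io al by rewrite z6E; field.
      have ioh : io h = io r ^+ 2 * io f by rewrite hE rmorphM rmorphXn.
      have iobe : io be = - (io al * io r).
        by rewrite -rmorphM -rmorphN; congr (io _); apply/eqP; rewrite -addr_eq0 addrC Fr.
      have z4E : z 4 * z 7 = io al * (io c * z 6 + io e - io r ^+ 2 * io d) /
        (io d * z 6 + io f) - io r * z 8.
        rewrite e4' e5' quadl /quad iobe ioh.
        apply: (mulIf (n0 6)); rewrite -[RHS]mulrC.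
        have := n0 7; rewrite z7E => n7.
        field; conjs.
        by move: n7; apply: contraNneq => n7; rewrite -(mul0r (io al)^-1) -n7; apply/eqP; field.
      have z47 : z 4 * z 7 != 0 by rewrite mulf_neq0.
      have -> : z 7 / z 8 / (io al * (io c * z 6 + io e - io r ^+ 2 * io d) /
        (io d * z 6 + io f) / z 8 - io r) = z 7 / (z 4 * z 7).
        rewrite z4E; move: z47; rewrite z4E; set X := _ / (io d * z 6 + io f) => X0.
        by field; conjs.
      by field; conjs.
    - by rewrite mulr0 mul0r.
  apply: (td_pole P (n0 4) w4).
  rewrite e4 e3 quadl; values P.
have [td [P t0 t1]] := orb_place O s y0.
have [w8 t7 t6 t5] := back td P y0 y0n t0 t1.
have t2 : td (z 2) 0.
  rewrite e2; apply: td_val; first by values P.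
  by rewrite y0E; field; conjs.
have t3 : td (z 3) r.
  rewrite e3 quadl; apply: td_val; first by values P; rewrite mulr0 add0r.
  by rewrite /quad rE y0E beE; field; conjs.
have w4 : td (z 4)^-1 0.
  rewrite e4 invf_div; apply: td_val; first by values P.
  by rewrite mul0r.
have a4 := td_quad_inf P c e h (n0 4) w4.
have l4 := td_lin_inf P d f (n0 4) w4.
have w5 : td (z 5)^-1 0.
  apply: (td_eq (z 3 * (quad 0 (io d) (io f) (z 4) / z 4) /
    (quad (io c) (io e) (io h) (z 4) / z 4 ^+ 2) * (z 4)^-1)); first by values P.
    by rewrite e5; move: (ld 4) => l; field; conjs.
  by rewrite mulr0.
exact: (td_pole P (n0 5) w5 t5).
Qed.
End Period5.

Section Lyness.
Variables (k : realFieldType) (K : fieldType) (io : {rmorphism k -> K}).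
Variables al be ga de : k.
Hypotheses (a0 : 0 < al) (b0 : 0 < be) (g0 : 0 < ga) (d0 : 0 < de).
Variable z : nat -> K.

(** With F and G linear, take y at the root of F and x with G(x) = y^2. Forward,
    z_2 = 0, z_4 and z_5 are infinite, z_6 is finite and z_7 = 0; backward, z_9
    = y, z_8 = 0 and z_7 = de / y. The point is admissible as soon as x is
    nonzero, that is, unless the stated relation holds. *)
Lemma lyness_period5 :
  orbit io (fun u => io al * u + io be) (fun u => io ga * u + io de) 5 z ->
  be ^+ 2 = al ^+ 2 * de.
Proof.
move=> O.
have [y0 y0E] := named (- be / al).
have [x0 x0E] := named ((y0 ^+ 2 - de) / ga).
have an := lt0r_neq0 a0; have bn := lt0r_neq0 b0; have gn := lt0r_neq0 g0.
have dn := lt0r_neq0 d0.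
have y0n : y0 != 0 by rewrite y0E mulf_neq0 ?invr_eq0 ?oppr_eq0.
apply/eqP; case: (eqVneq (be ^+ 2) (al ^+ 2 * de)) => // ne; exfalso.
have x0n : x0 != 0.
  rewrite x0E mulf_neq0 ?invr_eq0 // subr_eq0; apply: contra ne => /eqP h1.
  by rewrite -h1 y0E; apply/eqP; field.
have [td [P t0 t1]] := orb_place O x0 y0.
have n0 := orb_neq0 O.
have e2 : z 2 = (io al * z 1 + io be) / z 0 := orb_F O 0.
have e3 : z 3 = (io ga * z 2 + io de) / z 1 := orb_G O 0.
have e4 : z 4 = (io al * z 3 + io be) / z 2 := orb_F O 1.
have e5 : z 5 = (io ga * z 4 + io de) / z 3 := orb_G O 1.
have e6 : z 6 = (io al * z 5 + io be) / z 4 := orb_F O 2.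
have e7 : z 7 = (io ga * z 6 + io de) / z 5 := orb_G O 2.
have p10 : z 10 = z 0 := orb_per O 0.
have p11 : z 11 = z 1 := orb_per O 1.
have e9 : z 9 = (io ga * z 0 + io de) / z 1 by rewrite -p10 -p11; exact: orb_Gb O 4.
have e8 : z 8 = (io al * z 9 + io be) / z 0 by rewrite -p10; exact: orb_Fb O 4.
have e7' : z 7 = (io ga * z 8 + io de) / z 9 := orb_Gb O 3.
have t2 : td (z 2) 0.
  rewrite e2; apply: td_val; first by values P.
  by rewrite y0E; field; conjs.
have t3 : td (z 3) (de / y0).
  rewrite e3; apply: td_val; first by values P.
  by rewrite mulr0 add0r.
have v3 : de / y0 != 0 by rewrite mulf_neq0 ?invr_neq0.
have F3 : al * (de / y0) + be != 0.
  apply: contra ne => /eqP h1; rewrite -subr_eq0; apply/eqP.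
  transitivity (be * (al * (de / y0) + be)); last by rewrite h1 mulr0.
  by rewrite y0E; field; conjs.
have w4 : td (z 4)^-1 0.
  rewrite e4 invf_div; apply: td_val; first by values P.
  by rewrite mul0r.
have q54 : td (z 5 / z 4) (ga / (de / y0)).
  apply: (td_eq ((io ga + io de * (z 4)^-1) / z 3)); first by values P.
    by rewrite e5; field; conjs.
  by rewrite mulr0 addr0.
have w5 : td (z 5)^-1 0.
  apply: (td_eq ((z 5 / z 4)^-1 * (z 4)^-1)).
  - by values P; rewrite mulf_neq0 ?invr_neq0.
  - by field; conjs.
  - by rewrite mulr0.
have t6 : td (z 6) (al * (ga / (de / y0))).
  apply: (td_eq (io al * (z 5 / z 4) + io be * (z 4)^-1)); first by values P.
    by rewrite e6; field; conjs.
  by rewrite mulr0 addr0.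
have t7 : td (z 7) 0.
  rewrite e7; apply: td_val; first by values P.
  by rewrite mulr0.
have t9 : td (z 9) y0.
  rewrite e9; apply: td_val; first by values P.
  by rewrite x0E; field; conjs.
have t8 : td (z 8) 0.
  rewrite e8; apply: td_val; first by values P.
  by rewrite y0E; field; conjs.
have t7' : td (z 7) (de / y0).
  rewrite e7'; apply: td_val; first by values P.
  by rewrite mulr0 add0r.
by move/eqP: v3; apply; apply: (td_uniq P t7' t7).
Qed.
End Lyness.

Section Period8.
Variables (k : realFieldType) (K : fieldType) (io : {rmorphism k -> K}).
Variables al be ga : k.
Hypotheses (a0 : 0 < al) (b0 : 0 < be) (g0 : 0 < ga).
Variable z : nat -> K.

(** The odd terms w_n = z_(2n+1) satisfy a recurrence that is symmetric under
    time reversal. Start with two consecutive terms w_7 = w_8 at the root of F: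
    forward the next values are 0, infinity, 0 and the root again (w_12),
    backward they are 0, infinity, 0 (w_4), but w_12 = w_4. *)
Lemma affine_period8_false :
  orbit io (fun u => io al * u + io be) (fun u => io ga * u) 8 z -> False.
Proof.
move=> O.
have [y0 y0E] := named (- be / al).
have [x0 x0E] := named (y0 ^+ 2 / ga).
have an := lt0r_neq0 a0; have bn := lt0r_neq0 b0; have gn := lt0r_neq0 g0.
have y0n : y0 != 0 by rewrite y0E mulf_neq0 ?invr_eq0 ?oppr_eq0.
have Fy : al * y0 + be = 0 by rewrite y0E; field.
have [td [P t0 t1]] := orb_place O x0 y0.
have n0 := orb_neq0 O.
have iog : io ga != 0 by rewrite fmorph_eq0.
pose w n := z n.*2.+1.
have w0 n : w n != 0 by apply: n0.
have rec n : w n.+2 * w n.+1 ^+ 2 * w n = io ga ^+ 2 * (io al * w n.+1 + io be).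
  have := orb_G O n; have := orb_F O n.+1; have := orb_G O n.+1; rewrite doubleS.
  move=> E1 E2 E3.
  have := n0 n.*2.+2; have := n0 n.*2.+4 => m4 m2.
  have -> : w n.+2 * w n.+1 ^+ 2 * w n = (w n.+2 * w n.+1) * (w n.+1 * w n) by ring.
  have -> : w n.+2 * w n.+1 = io ga * z n.*2.+4.
    by rewrite /w !doubleS E1; field; exact: n0.
  have -> : w n.+1 * w n = io ga * z n.*2.+2.
    by rewrite /w !doubleS E3; field; exact: n0.
  by rewrite E2 /w doubleS; field; exact: m2.
have chain s0 s1 s2 s3 s4 : s0 != 0 -> s1 != 0 -> s2 != 0 -> s3 != 0 -> s4 != 0 ->
    s2 * s1 ^+ 2 * s0 = io ga ^+ 2 * (io al * s1 + io be) ->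
    s3 * s2 ^+ 2 * s1 = io ga ^+ 2 * (io al * s2 + io be) ->
    s4 * s3 ^+ 2 * s2 = io ga ^+ 2 * (io al * s3 + io be) ->
    td s0 y0 -> td s1 y0 -> [/\ td s3^-1 0, td s4 0 & td (s4 ^+ 2 * s3) (- ga ^+ 2 * al)].
  move=> n_0 n_1 n_2 n_3 n_4 r2 r3 r4 u0 u1.
  have u2 : td s2 0.
    apply: (td_eq (io ga ^+ 2 * (io al * s1 + io be) / (s1 ^+ 2 * s0))).
    - by values P; rewrite mulf_neq0 ?expf_neq0.
    - by rewrite -r2; field; conjs.
    - by rewrite Fy mulr0 mul0r.
  have q322 : td (s3 * s2 ^+ 2) (- ga ^+ 2 * al).
    apply: (td_eq (io ga ^+ 2 * (io al * s2 + io be) / s1)); first by values P.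
      by rewrite -r3; field; conjs.
    by rewrite mulr0 add0r y0E; field; conjs.
  have q3220 : - ga ^+ 2 * al != 0 by rewrite mulf_neq0 // oppr_eq0 expf_neq0.
  have w3 : td s3^-1 0.
    apply: (td_eq ((s3 * s2 ^+ 2)^-1 * s2 ^+ 2)); first by values P.
      by field; conjs.
    by rewrite expr0n mulr0.
  have q42 : td (s4 / s2) (- 1).
    apply: (td_eq (io ga ^+ 2 * (io al + io be * s3^-1) / (s3 * s2 ^+ 2))); first by values P.
      have -> : io ga ^+ 2 * (io al + io be * s3^-1) = io ga ^+ 2 * (io al * s3 + io be) /
        s3 by field.
      by rewrite -r4; field; conjs.
    by field; conjs.
  split=> //.
    apply: (td_eq (s4 / s2 * s2)); first by values P.
      by field.
    by rewrite mulr0.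
  apply: (td_eq ((s4 / s2) ^+ 2 * (s3 * s2 ^+ 2))); first by values P.
    by field.
  by rewrite sqrrN expr1n mul1r.
have per n : w (n + 8)%N = w n.
  by rewrite /w doubleD addnC -addnS addnC; exact: orb_per O _.
have e7 : w 7 = io ga * z 0 / z 1.
  have := orb_Gb O 7; rewrite -[z 7.*2.+1]/(w 7) => ->.
  by rewrite (orb_per O 0) (orb_per O 1).
have t7 : td (w 7) y0.
  rewrite e7; apply: td_val; first by values P.
  by rewrite x0E; field; conjs.
have t8 : td (w 8) y0 by rewrite (per 0%N).
have [h1 h2 h3] := chain _ _ _ _ _ (w0 7) (w0 8) (w0 9) (w0 10) (w0 11) (rec 7) (rec 8) (rec 9)
  t7 t8.
have rec' n : w n * w n.+1 ^+ 2 * w n.+2 = io ga ^+ 2 * (io al * w n.+1 + io be).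
  by rewrite -rec; ring.
have [h1' h2' _] := chain _ _ _ _ _ (w0 8) (w0 7) (w0 6) (w0 5) (w0 4) (rec' 6%N) (rec' 5)
  (rec' 4) t8 t7.
have t12 : td (w 12) y0.
  apply: (td_eq (io ga ^+ 2 * (io al * w 11 + io be) / (w 11 ^+ 2 * w 10))).
  - by values P; rewrite mulf_neq0 // oppr_eq0 expf_neq0.
  - by rewrite -(rec 10); have := w0 11; have := w0 10 => ? ?; field; conjs.
  - by rewrite mulr0 add0r y0E; field; conjs.
rewrite (per 4) in t12.
by move/eqP: y0n; apply; apply: (td_uniq P t12 h2').
Qed.
End Period8.

Section Period7Affine.
Variables (k : realFieldType) (K : fieldType) (io : {rmorphism k -> K}).
Variables b d e f g : k.
Hypotheses (b0 : 0 < b) (d0 : 0 < d) (e0 : 0 < e) (f0 : 0 < f) (g0 : 0 < g).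
Variable z : nat -> K.

(** From the pole s of G and the root y0 of F the values are s, y0, 0, 0,
    infinity, infinity and then s, y0 again. This pattern of length 6 makes z_14
    = 0, whereas z_14 = z_0 = s. *)
Lemma affine_period7_false :
  orbit io (fun u => (io f * u + io g) / io b) (fun u => io e * u / quad 0 (io d) (io f) u) 7 z
    -> False.
Proof.
move=> O.
have [s sE] := named (- f / d).
have [y0 y0E] := named (- g / f).
have bn := lt0r_neq0 b0; have gn := lt0r_neq0 g0; have fn := lt0r_neq0 f0.
have dn := lt0r_neq0 d0; have en := lt0r_neq0 e0.
have s0 : s != 0 by rewrite sE mulf_neq0 ?invr_eq0 ?oppr_eq0.
have y0n : y0 != 0 by rewrite y0E mulf_neq0 ?invr_eq0 ?oppr_eq0.
have ds : d * s + f = 0 by rewrite sE; field.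
have Fy : f * y0 + g = 0 by rewrite y0E; field.
have [td [P t0 t1]] := orb_place O s y0.
have n0 := orb_neq0 O.
have ld i : io d * z i + io f != 0.
  by have := orb_lin O i (ltW d0) (ltW f0) (addr_gt0 d0 f0); rewrite quadl.
have lf i : io f * z i + io g != 0.
  by have := orb_lin O i (ltW f0) (ltW g0) (addr_gt0 f0 g0); rewrite quadl.
have iob : io b != 0 by rewrite fmorph_eq0.
have iof : io f != 0 by rewrite fmorph_eq0.
have ioe : io e != 0 by rewrite fmorph_eq0.
(* the inventory without its constant term, invariant along the orbit; it gives
   the value of z_7, which is of the form infinity / infinity *)
pose S (x y : K) := io b * x + io d * y + io e / y + io f * y / x + io g / x.
have step n : td (z n.*2) s -> td (z n.*2.+1) y0 ->
    td (z n.*2.+2) 0 /\ (td (z n.*2.+2.+4) s /\ td (z n.*2.+3.+4) y0).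
  have e2 : z n.*2.+2 = (io f * z n.*2.+1 + io g) / io b / z n.*2 := orb_F O n.
  have e3 : z n.*2.+3 = io e * z n.*2.+2 / quad 0 (io d) (io f) (z n.*2.+2) /
    z n.*2.+1 := orb_G O n.
  have e4 : z n.*2.+4 = (io f * z n.*2.+3 + io g) / io b / z n.*2.+2 := orb_F O n.+1.
  have e5 : z n.*2.+1.+4 = io e * z n.*2.+4 / quad 0 (io d) (io f) (z n.*2.+4) /
    z n.*2.+3 := orb_G O n.+1.
  have e6 : z n.*2.+2.+4 = (io f * z n.*2.+1.+4 + io g) / io b / z n.*2.+4 := orb_F O n.+2.
  have e7 : z n.*2.+3.+4 = io e * z n.*2.+2.+4 / quad 0 (io d) (io f) (z n.*2.+2.+4) /
    z n.*2.+1.+4 := orb_G O n.+2.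
  move: e2 e3 e4 e5 e6 e7.
  move: (n0 n.*2) (n0 n.*2.+1) (n0 n.*2.+2) (n0 n.*2.+3) (n0 n.*2.+4) (n0 n.*2.+1.+4)
    (n0 n.*2.+2.+4) (n0 n.*2.+3.+4).
  move: (ld n.*2.+2) (ld n.*2.+4) (ld n.*2.+2.+4) (lf n.*2.+1) (lf n.*2.+3) (lf n.*2.+1.+4).
  move: (z n.*2) (z n.*2.+1) (z n.*2.+2) (z n.*2.+3) (z n.*2.+4) (z n.*2.+1.+4) (z n.*2.+2.+4)
    (z n.*2.+3.+4).
  move=> u0 u1 u2 u3 u4 u5 u6 u7 l2 l4 l6 m1 m3 m5 n_0 n_1 n_2 n_3 n_4 n_5 n_6 n_7.
  rewrite !quadl => e2 e3 e4 e5 e6 e7 v0 v1.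
  have t2 : td u2 0.
    rewrite e2; apply: td_val; first by values P.
    by rewrite Fy !mul0r.
  have q32 : td (u3 / u2) (e / (f * y0)).
    apply: (td_eq (io e / ((io d * u2 + io f) * u1))).
    - by values P; rewrite mulr0 add0r mulf_neq0.
    - by rewrite e3; field; conjs.
    - by rewrite mulr0 add0r.
  have q320 : e / (f * y0) != 0 by rewrite mulf_neq0 ?invr_eq0 ?mulf_neq0.
  have t3 : td u3 0.
    apply: (td_eq (u3 / u2 * u2)); first by values P.
      by field.
    by rewrite mulr0.
  have w4 : td u4^-1 0.
    apply: (td_eq (u2 * (io b / (io f * u3 + io g)))).
    - by values P; rewrite mulr0 add0r.
    - by rewrite e4; field; conjs.
    - by rewrite mul0r.
  have w5 : td u5^-1 0.
    apply: (td_eq (u3 * ((io d + io f * u4^-1) / io e))); first by values P.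
      by rewrite e5; field; conjs.
    by rewrite mul0r.
  have q54 : td (u5 / u4) (e / d * (b / g) / (e / (f * y0))).
    apply: (td_eq (io e / (io d + io f * u4^-1) * (io b / (io f * u3 + io g)) / (u3 / u2))).
    - by values P; rewrite ?mulr0 ?add0r ?addr0.
    - by rewrite e5 e4; field; conjs; rewrite ?mulf_neq0 //;
         move: l4; rewrite e4; apply: contraNneq => h1;
         apply/eqP; rewrite -(mul0r ((io b * u2)^-1)) -h1; field; conjs.
    - by rewrite !mulr0 add0r addr0.
  have t6 : td u6 s.
    apply: (td_eq (io f / io b * (u5 / u4) + io g / io b * u4^-1)); first by values P.
      by rewrite e6; field; conjs.
    by rewrite sE y0E; field; conjs.
  split=> //; split=> //.
  have S0 : S u6 u5 = S u0 u1.
    have -> : S u0 u1 = S u2 u1 by rewrite /S e2; field; conjs.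
    have -> : S u2 u1 = S u2 u3 by rewrite /S e3; field; conjs.
    have -> : S u2 u3 = S u4 u3 by rewrite /S e4; field; conjs.
    have -> : S u4 u3 = S u4 u5 by rewrite /S e5; field; conjs.
    by rewrite /S e6; field; conjs.
  have w7 : td u7^-1 y0^-1.
    apply: (td_eq ((S u0 u1 - io b * u6 - io g / u6 - io e * u5^-1) / io e)).
    - by rewrite /S; values P.
    - by rewrite -S0 /S e7; field; conjs.
    - rewrite mulr0 subr0; have -> : f = - (d * s) by apply/eqP; rewrite -addr_eq0 addrC ds.
      by field; conjs.
  by rewrite -[u7]invrK -[y0]invrK; apply: (td_inv P); rewrite ?invr_eq0.
have [_ [t6 t7]] := step 0%N t0 t1.
have [_ [t12 t13]] := step 3 t6 t7.
have [t14 _] := step 6 t12 t13.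
have p14 : z 14 = z 0 := orb_per O 0.
have {}t14 : td (z 14) 0 := t14; rewrite p14 in t14.
by move/eqP: s0; apply; apply: (td_uniq P t0 t14).
Qed.
End Period7Affine.

Lemma poly_nat_eq0 (k : realFieldType) (p : {poly k}) :
  (forall n, p.[n.+1%:R] = 0) -> p = 0.
Proof.
move=> H; apply/eqP; apply: contraT => p0.
pose rs := [seq (n.+1%:R : k) | n <- iota 0 (size p)].
have : (size rs < size p)%N.
  apply: max_poly_roots => //.
    by apply/allP => x /mapP [n _ ->]; rewrite rootE H.
  by rewrite map_inj_uniq ?iota_uniq // => m n /eqP; rewrite eqr_nat eqSS => /eqP.
by rewrite size_map size_iota ltnn.
Qed.

Section Period7Pole.
Variables (k : realFieldType) (K : fieldType) (io : {rmorphism k -> K}).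
Variables b e f g h : k.
Hypotheses (b0 : 0 < b) (e0 : 0 < e) (f0 : 0 < f) (g0 : 0 <= g) (h0 : 0 < h).
Variable z : nat -> K.

(** With x at the root x0 of G and y = s arbitrary, the backward computation
    passes through 0 and infinity and yields z_8 = x0 and z_7 = s: going down
    from z_8, z_7 one meets the same values as going up from z_0, z_1, so that
    z_6 = z_2 and z_5 = z_3 there. The relation z_5 z_3 = G(z_4) becomes a
    rational identity in s, which fails at s = 0 once the denominators are
    cleared. *)
Lemma pole_period7_false :
  orbit io (fun u => quad (io f) (io g) (io h) u / (io b * u))
    (fun u => (io e * u + io h) / io f) 7 z -> False.
Proof.
move=> O.
have [x0 x0E] := named (- h / e).
have bn := lt0r_neq0 b0; have hn := lt0r_neq0 h0; have fn := lt0r_neq0 f0.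
have en := lt0r_neq0 e0.
have x0n : x0 != 0 by rewrite x0E mulf_neq0 ?invr_eq0 ?oppr_eq0.
have Gx : e * x0 + h = 0 by rewrite x0E; field.
have n0 := orb_neq0 O.
have iob : io b != 0 by rewrite fmorph_eq0.
have iof : io f != 0 by rewrite fmorph_eq0.
have e2 : z 2 = quad (io f) (io g) (io h) (z 1) / (io b * z 1) / z 0 := orb_F O 0.
have e3 : z 3 = (io e * z 2 + io h) / io f / z 1 := orb_G O 0.
have e4 : z 4 = quad (io f) (io g) (io h) (z 3) / (io b * z 3) / z 2 := orb_F O 1.
have e5 : z 5 = (io e * z 4 + io h) / io f / z 3 := orb_G O 1.
have p14 : z 14 = z 0 := orb_per O 0.
have p15 : z 15 = z 1 := orb_per O 1.
have e13 : z 13 = (io e * z 0 + io h) / io f / z 1.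
  by rewrite -p14 -p15; exact: orb_Gb O 6.
have e12 : z 12 = quad (io f) (io g) (io h) (z 13) / (io b * z 13) / z 0.
  by rewrite -p14; exact: orb_Fb O 6.
have e11 : z 11 = (io e * z 12 + io h) / io f / z 13 := orb_Gb O 5.
have e10 : z 10 = quad (io f) (io g) (io h) (z 11) / (io b * z 11) / z 12 := orb_Fb O 5.
have e9 : z 9 = (io e * z 10 + io h) / io f / z 11 := orb_Gb O 4.
have e8 : z 8 = quad (io f) (io g) (io h) (z 9) / (io b * z 9) / z 10 := orb_Fb O 4.
have e7 : z 7 = (io e * z 8 + io h) / io f / z 9 := orb_Gb O 3.
have e6 : z 6 = quad (io f) (io g) (io h) (z 7) / (io b * z 7) / z 8 := orb_Fb O 3.
have e5' : z 5 = (io e * z 6 + io h) / io f / z 7 := orb_Gb O 2.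
have Nn i : quad (io f) (io g) (io h) (z i) != 0.
  by apply: (orb_pos O) => //; [exact: ltW|exact: ltW|exact: addr_gt0 (ltr_wpDr g0 f0) h0].
(* the invariant inventory again, to evaluate z_7 *)
pose S (x y : K) := io b * x + io f * y / x + io g / x + (io e * x + io h) / (x * y).
have SF x x' y : x != 0 -> y != 0 -> quad (io f) (io g) (io h) y != 0 ->
    x' = quad (io f) (io g) (io h) y / (io b * y) / x -> S x' y = S x y.
  by move=> x1 y1; rewrite /quad => q0 ->; rewrite /S; field; conjs.
have SG x y y' : x != 0 -> y != 0 -> io e * x + io h != 0 ->
    y' = (io e * x + io h) / io f / y -> S x y' = S x y.
  by move=> x1 y1 q0 ->; rewrite /S; field; conjs.
have Mn i : io e * z i + io h != 0.
  by have := orb_lin O i (ltW e0) (ltW h0) (addr_gt0 e0 h0); rewrite quadl.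
have Sinv : S (z 8) (z 9) = S (z 0) (z 1).
  rewrite -(SG _ _ _ (n0 0%N) (n0 1%N) (Mn _) e13) -(SF _ _ _ (n0 0%N) (n0 13) (Nn _) e12).
  rewrite -(SG _ _ _ (n0 12) (n0 13) (Mn _) e11) -(SF _ _ _ (n0 12) (n0 11) (Nn _) e10).
  by rewrite -(SG _ _ _ (n0 10) (n0 11) (Mn _) e9) -(SF _ _ _ (n0 10) (n0 9) (Nn _) e8).
have key s : 0 < s -> let X2 := quad f g h s / (b * s) / x0 in
    let v := (e * X2 + h) / f / s in
    f * v * v ^+ 2 * b * X2 = e * quad f g h v + h * b * v * X2.
  move=> sp X2 v; have sn := lt0r_neq0 sp.
  have [td [P t0 t1]] := orb_place O x0 s.
  have t13 : td (z 13) 0.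
    rewrite e13; apply: td_val; first by values P.
    by rewrite Gx !mul0r.
  have q12 : td (z 12 * z 13) (h / (b * x0)).
    apply: (td_eq (quad (io f) (io g) (io h) (z 13) / (io b * z 0))).
    - by values P; rewrite mulf_neq0.
    - by rewrite e12; field; conjs.
    - by rewrite /quad expr0n /= !mulr0 !add0r.
  have q120 : h / (b * x0) != 0 by rewrite mulf_neq0 // invr_eq0 mulf_neq0.
  have w12 : td (z 12)^-1 0.
    apply: (td_eq (z 13 / (z 12 * z 13))); first by values P.
      by field; conjs.
    by rewrite mul0r.
  have q11 : td (z 11 * z 13 ^+ 2) (e * (h / (b * x0)) / f).
    apply: (td_eq ((io e * (z 12 * z 13) + io h * z 13) / io f)); first by values P.
      by rewrite e11; field; conjs.
    by rewrite mulr0 addr0.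
  have q110 : e * (h / (b * x0)) / f != 0 by rewrite !(mulf_neq0, invr_neq0).
  have w11 : td (z 11)^-1 0.
    apply: (td_eq (z 13 ^+ 2 / (z 11 * z 13 ^+ 2))); first by values P.
      by field; conjs.
    by rewrite expr0n mul0r.
  have a11 := td_quad_inf P f g h (n0 11) w11.
  have q10 : td (z 10 * z 13) (e / b).
    apply: (td_eq ((quad (io f) (io g) (io h) (z 11) / z 11 ^+ 2) / io b * (z 11 * z 13 ^+ 2) /
      (z 12 * z 13))); first by values P.
      by rewrite e10; field; conjs.
    by field; conjs.
  have q9 : td (z 9 / z 13) (- 1).
    apply: (td_eq ((io e * (z 10 * z 13) + io h * z 13) / io f / (z 11 * z 13 ^+ 2)));
      first by values P.
      by rewrite e9; field; conjs.
    by rewrite x0E; field; conjs.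
  have t9 : td (z 9) 0.
    apply: (td_eq (z 9 / z 13 * z 13)); first by values P.
      by field; conjs.
    by rewrite mulr0.
  have eb0 : b * (- 1 * (e / b)) != 0.
    by rewrite !(mulf_neq0, invr_neq0) // oppr_eq0 oner_eq0.
  have t8 : td (z 8) x0.
    apply: (td_eq (quad (io f) (io g) (io h) (z 9) / (io b * (z 9 / z 13 * (z 10 * z 13))))).
    - by values P.
    - by rewrite e8; field; conjs.
    - by rewrite /quad x0E; field; conjs.
  have t7 : td (z 7) s.
    apply: (td_eq ((z 8 * (S (z 0) (z 1) - io b * z 8) - io g - io f * z 9) / io f)).
    - by rewrite /S; values P; rewrite mulf_neq0.
    - by rewrite -Sinv /S e7; field; conjs.
    - by rewrite Gx; field; conjs.
  have t2 : td (z 2) X2 by rewrite e2; values P; rewrite mulf_neq0.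
  have t6 : td (z 6) X2 by rewrite e6; values P; rewrite mulf_neq0.
  have t3 : td (z 3) v by rewrite e3; values P.
  have t5 : td (z 5) v by rewrite e5'; values P.
  have H : io f * z 5 * z 3 ^+ 2 * io b * z 2 = io e * quad (io f) (io g) (io h) (z 3) + io h *
    io b * z 3 * z 2.
    have Q3 := Nn 3; rewrite e5 e4; set X := quad _ _ _ _ in Q3 *.
    by field; conjs.
  have h1 : td (io f * z 5 * z 3 ^+ 2 * io b * z 2) (f * v * v ^+ 2 * b * X2) by values P.
  have h2 : td (io f * z 5 * z 3 ^+ 2 * io b * z 2) (e * quad f g h v + h * b * v * X2).
    by rewrite H; values P.
  exact: (td_uniq P h1 h2).
(* the identity of key times s^7, as a polynomial in s; its value at 0 is the
   term in N^3 Q alone *)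
pose Q : {poly k} := f%:P * 'X^2 + g%:P * 'X + h%:P.
pose N : {poly k} := e%:P * Q + (h * b * x0)%:P * 'X.
pose ka := f * b * x0.
have kan : ka != 0 by rewrite !mulf_neq0.
pose L : {poly k} := (f / (ka ^+ 3 * x0))%:P * N ^+ 3 * Q
   - 'X^3 * (e%:P * ((f / ka ^+ 2)%:P * N ^+ 2 + (g / ka)%:P * N * 'X^2 + h%:P * 'X^4))
   - (h / (ka * x0))%:P * N * Q * 'X^4.
have L0 : L = 0.
  apply: poly_nat_eq0 => n; have sp : 0 < n.+1%:R :> k by rewrite ltr0n.
  move: sp (key _ sp) => /=; move: (n.+1%:R : k) => s sp E.
  have sn := lt0r_neq0 sp.
  have [Qs QsE] := named (f * s ^+ 2 + g * s + h).
  have [Ns NsE] := named (e * Qs + h * b * x0 * s).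
  rewrite /L /N /Q !(hornerD, hornerN, hornerM, horner_exp, hornerX, hornerC) -QsE -NsE.
  move: E; set X2 := quad f g h s / (b * s) / x0; set v := _ / f / s => E.
  have X2E : X2 = Qs / (b * s * x0) by rewrite /X2 /quad -QsE; field; conjs.
  have vE : v = Ns / (ka * s ^+ 2) by rewrite /v X2E NsE /ka; field; conjs.
  transitivity (s ^+ 7 * (f * v * v ^+ 2 * b * X2 - (e * quad f g h v + h * b * v * X2))).
    by rewrite X2E vE /quad /ka; field; conjs.
  by rewrite E subrr mulr0.
have : L.[0] = 0 by rewrite L0 horner0.
rewrite /L /N /Q !(hornerD, hornerN, hornerM, horner_exp, hornerX, hornerC) !(mulr0, mul0r,
  addr0, subr0, add0r).
by apply/eqP; rewrite !(mulf_neq0, invr_neq0, expf_neq0).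
Qed.
End Period7Pole.

Section Constraints.
Variables (k : realFieldType) (K : fieldType) (io : {rmorphism k -> K}).
Variables b c d e f g h : k.
Variable z : nat -> K.
Local Notation Q a b c := (fun u => quad (io a) (io b) (io c) u).
Local Notation frac n d := (fun u => n u / d u).

Lemma quad_io0 x y (u : K) : quad (io 0) (io x) (io y) u = quad 0 (io x) (io y) u.
Proof. by rewrite rmorph0. Qed.

Lemma quad_io00 x (u : K) : quad (io 0) (io 0) (io x) u = io x.
Proof. by rewrite rmorph0 /quad !mul0r !add0r. Qed.

Lemma orbit_crossing m : 0 < b -> 0 < c -> 0 < d -> 0 < f ->
  orbit io (frac (Q f g h) (Q 0 b c)) (frac (Q c e h) (Q 0 d f)) m z ->
  odd m -> quad f g h (- c / b) = 0 \/ quad c e h (- f / d) = 0.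
Proof.
move=> b0 c0 d0 f0 O; apply: (odd_period_cancels (io := io) b0 c0 d0 f0 (z := z)).
by apply: (orb_eqF O) => n; rewrite quad_io0.
Qed.

Lemma orbit_linF m G : 0 < b -> 0 < c -> quad f g h (- c / b) = 0 ->
  orbit io (frac (Q f g h) (Q 0 b c)) G m z ->
  orbit io (fun u => io (f / b) * u + io (h / c)) G m z.
Proof.
move=> b0 c0 N0 O; apply: (orb_eqF O) => // n.
rewrite quad_io0; apply: fraction_linear => //; try exact: lt0r_neq0.
exact: (orb_lin O n (ltW b0) (ltW c0) (addr_gt0 b0 c0)).
Qed.

Lemma orbit_linG m F : 0 < d -> 0 < f -> quad c e h (- f / d) = 0 ->
  orbit io F (frac (Q c e h) (Q 0 d f)) m z ->
  orbit io F (fun u => io (c / d) * u + io (h / f)) m z.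
Proof.
move=> d0 f0 N0 O; apply: (orb_eqF O) => // n.
rewrite quad_io0; apply: fraction_linear => //; try exact: lt0r_neq0.
exact: (orb_lin O n (ltW d0) (ltW f0) (addr_gt0 d0 f0)).
Qed.

Lemma orbit_b2 : 0 < b -> 0 < c -> 0 < f -> 0 < h -> 0 <= e ->
  orbit io (frac (Q f g h) (Q 0 b c)) (frac (Q c e h) (Q 0 0 f)) 3 z ->
  g = 2 * c * f / b /\ h = c ^+ 2 * f / b ^+ 2.
Proof.
move=> b0 c0 f0 h0 e0 O.
have bn := lt0r_neq0 b0; have cn := lt0r_neq0 c0; have fn := lt0r_neq0 f0; have hn := lt0r_neq0 h0.
have O' : orbit io (frac (Q f g h) (Q 0 b c)) (fun u => Q c e h u / io f) 3 z.
  by apply: (orb_eqF O) => n //; rewrite quad_io00.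
have N0 : quad f g h (- c / b) = 0.
  apply: (period3_cancels (io := io) b0 c0 f0 e0 (z := z)).
  by apply: (orb_eqF O') => n //; rewrite quad_io0.
have E := period3_linear_root f0 (mulf_neq0 fn (invr_neq0 bn)) (mulf_neq0 hn (invr_neq0 cn))
  (orbit_linF b0 c0 N0 O').
have hE : h = c ^+ 2 * f / b ^+ 2.
  have : h / f * (c ^+ 2 * f ^+ 2 / (b ^+ 2 * h)) = ((h / c) / (f / b)) ^+ 2 *
    (c ^+ 2 * f ^+ 2 / (b ^+ 2 * h)) by rewrite E.
  have -> : h / f * (c ^+ 2 * f ^+ 2 / (b ^+ 2 * h)) = c ^+ 2 * f / b ^+ 2 by field; conjs.
  by move=> ->; field; conjs.
by split=> //; rewrite (middle_coef bn cn N0) hE; field; conjs.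
Qed.

Lemma orbit_b3 : 0 < b -> 0 < c -> 0 < d -> 0 < e -> 0 < f -> quad f g 0 (- c / b) = 0 ->
  orbit io (frac (Q f g 0) (Q 0 b c)) (frac (Q c e 0) (Q 0 d f)) 3 z ->
  c * f = d * e.
Proof.
move=> b0 c0 d0 e0 f0 N0 O.
apply: (period3_monomial_root (io := io) (divr_gt0 f0 b0) c0 d0 f0 e0 (z := z)).
have := O; move/orb_eqF; apply=> n; last by rewrite quad_io0.
rewrite quad_io0 (fraction_linear (lt0r_neq0 b0) (lt0r_neq0 c0) N0) ?mul0r ?rmorph0 ?addr0 //.
exact: (orb_lin O n (ltW b0) (ltW c0) (addr_gt0 b0 c0)).
Qed.

Lemma orbit_not7_c : 0 < b -> 0 < c -> 0 < d -> 0 < f ->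
  orbit io (frac (Q f g 0) (Q 0 b c)) (frac (Q c 0 0) (Q 0 d f)) 7 z -> False.
Proof.
move=> b0 c0 d0 f0 O.
have [N0|/eqP] : quad f g 0 (- c / b) = 0 \/ quad c 0 0 (- f / d) = 0.
- apply: (odd_period_cancels (io := io) b0 c0 d0 f0 (z := z) (m := 7)) => //.
  by apply: (orb_eqF O) => n; rewrite quad_io0.
- apply: (monomial_period7_false (io := io) (divr_gt0 f0 b0) c0 d0 f0 (z := z)).
  have := O; move/orb_eqF; apply=> n.
    rewrite quad_io0 (fraction_linear (lt0r_neq0 b0) (lt0r_neq0 c0) N0) ?mul0r ?rmorph0 ?addr0 //.
    exact: (orb_lin O n (ltW b0) (ltW c0) (addr_gt0 b0 c0)).
  by rewrite quad_io0 {1}/quad !rmorph0 mul0r !addr0.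
rewrite /quad mul0r !addr0 mulf_eq0 expf_eq0 /= mulf_eq0 oppr_eq0 invr_eq0.
by rewrite !gt_eqF.
Qed.

Lemma orbit_c x0 : 0 < b -> 0 < c -> 0 < f -> 0 < g -> x0 != 0 -> x0 ^+ 2 = g / b ->
  orbit io (frac (Q f g 0) (Q 0 b c)) (frac (Q c 0 0) (Q 0 0 f)) 4 z -> b * g = c * f.
Proof.
move=> b0 c0 f0 g0 xn xE O.
apply: (period4_cancels (io := io) b0 c0 f0 g0 xn xE (erefl (c / f)) (z := z)).
have := O; move/orb_eqF; apply=> n; first by rewrite quad_io0.
by rewrite quad_io00 {1}/quad !rmorph0 mul0r !addr0 rmorphM fmorphV mulrAC.
Qed.

Lemma orbit_not4 : 0 < b -> 0 < c -> 0 < f -> 0 < e ->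
  orbit io (frac (Q f 0 0) (Q 0 b c)) (frac (Q c e 0) (Q 0 0 f)) 4 z -> False.
Proof.
move=> b0 c0 f0 e0 O.
apply: (square_period4_false (io := io) b0 c0 f0 e0 (z := z)).
have := O; move/orb_eqF; apply=> n; last by rewrite quad_io00.
by rewrite quad_io0 {1}/quad !rmorph0 mul0r !addr0.
Qed.

Lemma orbit_d : 0 < b -> 0 < c -> 0 < d -> 0 < f -> 0 < h -> 0 <= e ->
  quad f g h (- c / b) = 0 ->
  orbit io (frac (Q f g h) (Q 0 b c)) (frac (Q c e h) (Q 0 d f)) 5 z ->
  quad c e h (- f / d) = 0.
Proof.
move=> b0 c0 d0 f0 h0 e0 N0 O.
apply: (period5_cancels (io := io) (divr_gt0 f0 b0) (divr_gt0 h0 c0) c0 d0 f0 h0 (erefl _)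
  (z := z)).
have := orbit_linF b0 c0 N0 O; move/orb_eqF; apply=> n //.
by rewrite quad_io0.
Qed.

(** F and G are then both linear, with slopes f / b and c / d and constant terms
    h / c and h / f. *)
Lemma orbit_d_corner : 0 < b -> 0 < c -> 0 < d -> 0 < f -> 0 < h ->
  quad f g h (- c / b) = 0 -> quad c e h (- f / d) = 0 ->
  orbit io (frac (Q f g h) (Q 0 b c)) (frac (Q c e h) (Q 0 d f)) 5 z ->
  h * b ^+ 2 = f * c ^+ 2.
Proof.
move=> b0 c0 d0 f0 h0 N0 M0 O.
have E := lyness_period5 (divr_gt0 f0 b0) (divr_gt0 h0 c0) (divr_gt0 c0 d0) (divr_gt0 h0 f0)
  (orbit_linG d0 f0 M0 (orbit_linF b0 c0 N0 O)).
have bn := lt0r_neq0 b0; have cn := lt0r_neq0 c0; have fn := lt0r_neq0 f0; have hn := lt0r_neq0 h0.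
have : (h / c) ^+ 2 * (c ^+ 2 * b ^+ 2 / h) = (f / b) ^+ 2 * (h / f) *
  (c ^+ 2 * b ^+ 2 / h) by rewrite E.
have -> : (h / c) ^+ 2 * (c ^+ 2 * b ^+ 2 / h) = h * b ^+ 2 by field; conjs.
by move=> ->; field; conjs.
Qed.

Lemma orbit_not8 : 0 < b -> 0 < e -> 0 < f -> 0 < g ->
  orbit io (frac (Q f g 0) (Q 0 b 0)) (frac (Q 0 e 0) (Q 0 0 f)) 8 z -> False.
Proof.
move=> b0 e0 f0 g0 O; have bn := lt0r_neq0 b0; have fn := lt0r_neq0 f0.
apply: (affine_period8_false (io := io) (divr_gt0 f0 b0) (divr_gt0 g0 b0) (divr_gt0 e0 f0)
  (z := z)).
have := O; move/orb_eqF; apply=> n.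
  have ib : io b != 0 by rewrite fmorph_eq0.
  have zn := orb_neq0 O n.
  by rewrite /quad !rmorph0 !rmorphM !fmorphV mul0r !addr0 add0r; field; conjs.
by rewrite quad_io00 /quad !rmorph0 mul0r add0r addr0 rmorphM fmorphV mulrAC.
Qed.

Lemma orbit_not7_g : 0 < b -> 0 < d -> 0 < e -> 0 < f -> 0 < g ->
  orbit io (frac (Q f g 0) (Q 0 b 0)) (frac (Q 0 e 0) (Q 0 d f)) 7 z -> False.
Proof.
move=> b0 d0 e0 f0 g0 O; have bn := lt0r_neq0 b0.
apply: (affine_period7_false (io := io) b0 d0 e0 f0 g0 (z := z)).
have := O; move/orb_eqF; apply=> n.
  have ib : io b != 0 by rewrite fmorph_eq0.
  have zn := orb_neq0 O n.
  by rewrite /quad !rmorph0 mul0r !addr0 add0r; field; conjs.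
by rewrite quad_io0 {1}/quad !rmorph0 mul0r add0r addr0.
Qed.

Lemma orbit_not7_h : 0 < b -> 0 < e -> 0 < f -> 0 <= g -> 0 < h ->
  orbit io (frac (Q f g h) (Q 0 b 0)) (frac (Q 0 e h) (Q 0 0 f)) 7 z -> False.
Proof.
move=> b0 e0 f0 g0 h0 O.
apply: (pole_period7_false (io := io) b0 e0 f0 g0 h0 (z := z)).
have := O; move/orb_eqF; apply=> n.
  by rewrite quad_io0 quadl rmorph0 addr0.
by rewrite quad_io00 quad_io0 quadl.
Qed.

End Constraints.

(** * Orders of growth far out in the quadrant *)

Section Sector.
Variable k : realFieldType.
Implicit Types (x y C : k).

(** The filter of the regions y >= B, x >= y^L: there y is large and x is larger
    than a given power of y. Such a region is called a sector. *)
Definition evt (P : k -> k -> Prop) :=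
  exists L : nat, exists2 B : k, 1 <= B & forall x y, B <= y -> y ^+ L <= x -> P x y.

Lemma evt_and P Q : evt P -> evt Q -> evt (fun x y => P x y /\ Q x y).
Proof.
move=> [L [B B1 HP]] [L' [B' B1' HQ]]; exists (maxn L L'), (Num.max B B').
  by rewrite le_max B1.
move=> x y; rewrite ge_max => /andP [By B'y] yx.
have y1 : 1 <= y := le_trans B1 By.
split; [apply: HP|apply: HQ] => //; apply: le_trans yx;
  by apply: ler_weXn2l; rewrite // ?leq_maxl ?leq_maxr.
Qed.

Lemma evt_mono P Q : evt P ->
  (forall x y, 1 <= x -> 1 <= y -> P x y -> Q x y) -> evt Q.
Proof.
move=> [L [B B1 HP]] H; exists L, B => // x y By yx.
have y1 : 1 <= y := le_trans B1 By.
apply: H => //; last exact: HP.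
by apply: le_trans yx; apply: exprn_ege1.
Qed.

Lemma evt_true (P : k -> k -> Prop) :
  (forall x y, 1 <= x -> 1 <= y -> P x y) -> evt P.
Proof.
move=> H; exists 0%N, 1 => // x y y1; rewrite expr0 => x1.
exact: H.
Qed.

Lemma evt_ex P : evt P -> exists x y, [/\ 1 <= x, 1 <= y & P x y].
Proof.
move=> [L [B B1 HP]]; exists (B ^+ L), B; split=> //; first exact: exprn_ege1.
exact: HP.
Qed.

Definition asym (f g : k -> k -> k) :=
  exists2 C, 0 < C & evt (fun x y => [/\ 0 < f x y, 0 < g x y,
     f x y <= C * g x y & g x y <= C * f x y]).

Lemma asym_trans f g h : asym f g -> asym g h -> asym f h.
Proof.
move=> [C C0 H] [C' C0' H']; exists (C * C'); first exact: mulr_gt0.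
apply: evt_mono (evt_and H H') _ => x y _ _ [[f0 g0 h1 h2] [_ h0 h3 h4]]; split=> //.
  by apply: le_trans h1 _; rewrite -mulrA ler_wpM2l // ltW.
by apply: le_trans h4 _; rewrite [C * C']mulrC -mulrA ler_wpM2l // ltW.
Qed.

Lemma asym_mul f g f' g' : asym f g -> asym f' g' ->
  asym (fun x y => f x y * f' x y) (fun x y => g x y * g' x y).
Proof.
move=> [C C0 H] [C' C0' H']; exists (C * C'); first exact: mulr_gt0.
apply: evt_mono (evt_and H H') _ => x y _ _ [[f0 g0 h1 h2] [f0' g0' h3 h4]].
by split; rewrite ?mulr_gt0 // mulrACA; apply: ler_pM => //; apply: ltW.
Qed.

Lemma asym_inv f g : asym f g ->
  asym (fun x y => (f x y)^-1) (fun x y => (g x y)^-1).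
Proof.
move=> [C C0 H]; exists C => //.
apply: evt_mono H _ => x y _ _ [f0 g0 h1 h2].
split; rewrite ?invr_gt0 //.
  by rewrite -(ler_pM2r f0) mulVf ?gt_eqF // mulrAC -(ler_pM2r g0) mul1r mulfVK ?gt_eqF.
by rewrite -(ler_pM2r g0) mulVf ?gt_eqF // mulrAC -(ler_pM2r f0) mul1r mulfVK ?gt_eqF.
Qed.

Lemma asym_refl f : evt (fun x y => 0 < f x y) -> asym f f.
Proof.
move=> H; exists 1 => //; apply: evt_mono H _ => x y _ _ f0.
by rewrite !mul1r lexx.
Qed.

Lemma asym_ext f f' g : (forall x y, 1 <= x -> 1 <= y -> f x y = f' x y) -> asym f g -> asym f' g.
Proof.
move=> E [C C0 H]; exists C => //.
by apply: evt_mono H _ => x y x1 y1; rewrite E.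
Qed.

Definition mono (e : int * int) (x y : k) : k := x ^ e.1 * y ^ e.2.
Definition emul (t : int) (e : int * int) : int * int := (t * e.1, t * e.2).
Definition esub (e e' : int * int) : int * int := (e.1 - e'.1, e.2 - e'.2).
Definition lexpos (e : int * int) : bool := (0 < e.1) || (e.1 == 0) && (0 < e.2).
Definition eopp (e : int * int) : int * int := (- e.1, - e.2).

Lemma mono_gt0 e x y : 1 <= x -> 1 <= y -> 0 < mono e x y.
Proof. by move=> x1 y1; rewrite mulr_gt0 // exprz_gt0 // (lt_le_trans ltr01). Qed.

Lemma mono_mul t e x y : 1 <= x -> 1 <= y -> mono (emul t e) x y = mono e x y ^ t.
Proof.
by move=> x1 y1; rewrite /mono /emul /= expfzMl !exprz_exp ![t * _]mulrC.
Qed.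

Lemma mono_sub e e' x y : 1 <= x -> 1 <= y -> mono (esub e e') x y = mono e x y / mono e' x y.
Proof.
move=> x1 y1; have x0 : x != 0 by rewrite gt_eqF // (lt_le_trans ltr01).
have y0 : y != 0 by rewrite gt_eqF // (lt_le_trans ltr01).
by rewrite /mono /esub /= !expfzDr // -!invr_expz invfM mulrACA.
Qed.

(** In a sector x outweighs any power of y, so the exponents compare
    lexicographically. *)
Lemma mono_big e M : lexpos e -> evt (fun x y => M <= mono e x y).
Proof.
move=> /orP [i0|/andP [/eqP i0 j0]].
  exists `|e.2|.+1, (Num.max 1 M); first by rewrite le_max lexx.
  move=> x y; rewrite ge_max => /andP [y1 My] yx.
  have y0 : 0 < y := lt_le_trans ltr01 y1.
  have x1 : 1 <= x by apply: le_trans yx; apply: exprn_ege1.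
  apply: le_trans My _; rewrite /mono.
  apply: (@le_trans _ _ (x * y ^ e.2)); last first.
    rewrite ler_pM2r ?exprz_gt0 // -{1}[x]expr1z; apply: ler_weXz2l => //.
  apply: (@le_trans _ _ (y ^+ `|e.2|.+1 * y ^ e.2)); last by rewrite ler_pM2r ?exprz_gt0.
  rewrite -[y ^+ _]/(y ^ (`|e.2|.+1 : int)) -expfzDr ?gt_eqF // -{1}[y]expr1z.
  apply: ler_weXz2l => //; lia.
exists 0%N, (Num.max 1 M); first by rewrite le_max lexx.
move=> x y; rewrite ge_max => /andP [y1 My] _.
rewrite /mono i0 expr0z mul1r; apply: le_trans My _.
by rewrite -{1}[y]expr1z; apply: ler_weXz2l.
Qed.

(** Only the behaviour at infinity and at 0 matters for the growth of an
    orbit. *)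
Definition expo (F : k -> k) (sp sm : int) := exists2 C, 0 < C &
  (forall u, 1 <= u -> [/\ 0 < F u, F u <= C * u ^ sp & u ^ sp <= C * F u]) /\
  (forall u, 0 < u -> u <= 1 -> [/\ 0 < F u, F u <= C * u ^ sm & u ^ sm <= C * F u]).

Lemma asym_expr f g (t : int) : asym f g -> asym (fun x y => f x y ^ t) (fun x y => g x y ^ t).
Proof.
have nat_case (n : nat) f' g' : asym f' g' ->
  asym (fun x y => f' x y ^+ n) (fun x y => g' x y ^+ n).
  move=> H; elim: n => [|n IH].
    by apply: asym_refl; apply: evt_true => x y _ _; rewrite expr0.
  apply: (@asym_ext (fun x y => f' x y * f' x y ^+ n)); first by move=> *; rewrite exprS.
  have [C C0 H'] := asym_mul H IH; exists C => //; apply: evt_mono H' _ => x y _ _.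
  by rewrite exprS.
move=> H; case: t => n; first exact: nat_case.
exact: asym_inv (nat_case n.+1 _ _ H).
Qed.

Lemma expo_pos F sp sm f e : expo F sp sm -> asym f (mono e) -> lexpos e ->
  asym (fun x y => F (f x y)) (mono (emul sp e)).
Proof.
move=> [C C0 [HF _]] H ep; apply: (@asym_trans _ (fun x y => f x y ^ sp)); last first.
  have [D D0 H'] := asym_expr sp H; exists D => //.
  by apply: evt_mono H' _ => x y x1 y1; rewrite mono_mul.
case: H => D D0 H; exists C => //.
apply: evt_mono (evt_and H (mono_big D ep)) _ => x y x1 y1 [[f0 g0 h1 h2] h3].
have f1 : 1 <= f x y by rewrite -(ler_pM2l D0) mulr1 (le_trans h3).
have [F0 k1 k2] := HF _ f1; split=> //; by rewrite exprz_gt0.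
Qed.

Lemma expo_neg F sp sm f e : expo F sp sm -> asym f (mono e) -> lexpos (eopp e) ->
  asym (fun x y => F (f x y)) (mono (emul sm e)).
Proof.
move=> [C C0 [_ HF]] H ep; apply: (@asym_trans _ (fun x y => f x y ^ sm)); last first.
  have [D D0 H'] := asym_expr sm H; exists D => //.
  by apply: evt_mono H' _ => x y x1 y1; rewrite mono_mul.
case: H => D D0 H; exists C => //.
apply: evt_mono (evt_and H (mono_big D ep)) _ => x y x1 y1 [[f0 g0 h1 h2] h3].
have f1 : f x y <= 1.
  apply: le_trans h1 _; move: h3; rewrite (_ : eopp e = emul (-1) e) ?mono_mul //; last first.
    by rewrite /eopp /emul !mulN1r.
  by rewrite exprN1 -(ler_pM2r g0) mulVf ?gt_eqF.
have [F0 k1 k2] := HF _ f0 f1; split=> //; by rewrite exprz_gt0.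
Qed.

Section Exponents.
Variables (F G : k -> k) (sFp sFm sGp sGm : int).
Hypotheses (eF : expo F sFp sFm) (eG : expo G sGp sGm).

Definition theta (u : k * k) : k * k := let x := F u.2 / u.1 in (x, G x / u.2).

Definition exp_image (sp sm : int) e := if lexpos e then emul sp e else emul sm e.
Definition exp_neq0 e := lexpos e || lexpos (eopp e).

(** The recurrence z_(n+2) = F(z_(n+1)) / z_n on the exponents of monomials, run
    for m turns. The exponents to which F or G is applied must be nonzero, since
    a quantity of bounded size may lie on either side of 1. *)
Fixpoint exponents_return (m : nat) (e0 e1 : int * int) : bool :=
  if m is m'.+1 then
    let e2 := esub (exp_image sFp sFm e1) e0 in
    [&& exp_neq0 e1, exp_neq0 e2 & exponents_return m' e2 (esub (exp_image sGp sGm e2) e1)]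
  else (e0 == (1, 0)) && (e1 == (0, 1)).

Lemma expo_asym H sp sm f e : expo H sp sm -> asym f (mono e) -> exp_neq0 e ->
  asym (fun x y => H (f x y)) (mono (exp_image sp sm e)).
Proof.
rewrite /exp_image => eH fe; case: (boolP (lexpos e)) => [ep _|ne /orP [ep|en]].
- exact: expo_pos eH fe ep.
- by rewrite ep in ne.
- exact: expo_neg eH fe en.
Qed.

Lemma asym_div f g e e' : asym f (mono e) -> asym g (mono e') ->
  asym (fun x y => f x y / g x y) (mono (esub e e')).
Proof.
move=> H H'; have [C C0 K] := asym_mul H (asym_inv H'); exists C => //.
by apply: evt_mono K _ => x y x1 y1; rewrite mono_sub.
Qed.

Lemma iter_asym m (U : k -> k -> k * k) e0 e1 : exponents_return m e0 e1 ->
  asym (fun x y => (U x y).1) (mono e0) -> asym (fun x y => (U x y).2) (mono e1) ->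
  asym (fun x y => (iter m theta (U x y)).1) (mono (1, 0)) /\
  asym (fun x y => (iter m theta (U x y)).2) (mono (0, 1)).
Proof.
elim: m U e0 e1 => [|m IH] U e0 e1 /=; first by move=> /andP [/eqP -> /eqP ->].
move=> /and3P [n1 n2 T] H0 H1.
have H2 := asym_div (expo_asym eF H1 n1) H0.
have H3 := asym_div (expo_asym eG H2 n2) H1.
have [] := IH (fun x y => theta (U x y)) _ _ T H2 H3.
by move=> K1 K2; split; [move: K1|move: K2]; apply: asym_ext => x y _ _; rewrite -iterSr.
Qed.

Definition open_quadrant (u : k * k) := 0 < u.1 /\ 0 < u.2.

Definition signed (f : k -> k -> k) :=
  [\/ forall x y, 0 < x -> 0 < y -> f x y = 0, evt (fun x y => 0 < f x y)
    | evt (fun x y => f x y < 0)].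

(** A map whose coordinates are comparable to x and y sends a region of the
    filter into a slightly larger one. *)
Lemma evt_stable (t : k * k -> k * k) (P : k -> k -> Prop) :
  asym (fun x y => (t (x, y)).1) (mono (1, 0)) -> asym (fun x y => (t (x, y)).2) (mono (0, 1)) ->
  evt P -> evt (fun x y => P (t (x, y)).1 (t (x, y)).2).
Proof.
move=> [C C0 H] [D D0 K] [L [B B1 HP]].
pose M := 1 + C + D; pose N := M * B.
have M1 : 1 <= M by rewrite /M; lra.
have M0 : 0 < M by lra.
apply: (@evt_mono (fun x y => ([/\ 0 < (t (x, y)).1, 0 < mono (1, 0) x y,
    (t (x, y)).1 <= C * mono (1, 0) x y & mono (1, 0) x y <= C * (t (x, y)).1] /\
    [/\ 0 < (t (x, y)).2, 0 < mono (0, 1) x y,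
    (t (x, y)).2 <= D * mono (0, 1) x y & mono (0, 1) x y <= D * (t (x, y)).2])
    /\ (N <= y /\ y ^+ (L + L).+1 <= x))).
  apply: evt_and; first exact: evt_and.
  exists (L + L).+1, N => //; rewrite /N -[1]mulr1; apply: ler_pM => //.
move=> x y x1 y1 [[[a0 b0 h1 h2] [c0 d0 h3 h4]] [Ny yx]].
rewrite /mono /= expr1z expr0z mulr1 in h1 h2; rewrite /mono /= expr1z expr0z mul1r in h3 h4.
move: (t (x, y)) a0 c0 h1 h2 h3 h4 => [u v] /= u0 v0 h1 h2 h3 h4.
have CM : C <= M by rewrite /M; lra.
have DM : D <= M by rewrite /M; lra.
have My : M <= y by apply: le_trans Ny; rewrite /N -{1}[M]mulr1 ler_pM2l.
apply: HP.
  rewrite -(ler_pM2l M0); apply: le_trans Ny _; apply: le_trans h4 _.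
  by rewrite ler_pM2r.
rewrite -(ler_pM2l M0); apply: (@le_trans _ _ x); last first.
  by apply: le_trans h2 _; rewrite ler_pM2r.
apply: le_trans yx; rewrite exprS exprD.
apply: ler_pM => //; first exact: ltW.
  by apply: exprn_ge0; apply: ltW.
rewrite -exprMn; apply: lerXn2r; rewrite ?nnegrE ?mulr_ge0 ?(ltW v0) //; try lra.
apply: le_trans h3 _; rewrite ler_pM2r ?(lt_le_trans ltr01) //.
exact: le_trans DM My.
Qed.

(** If phi o t - phi is positive in the sector then phi increases strictly along
    the orbits of t there, which is incompatible with a finite order. *)
Lemma signed_iter (t : k * k -> k * k) (M : nat) (phi : k * k -> k) :
  (forall P, evt P -> evt (fun x y => P (t (x, y)).1 (t (x, y)).2)) ->
  (forall u, open_quadrant u -> iter M.+1 t u = u) ->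
  signed (fun x y => phi (t (x, y)) - phi (x, y)) ->
  forall u, open_quadrant u -> phi (t u) = phi u.
Proof.
move=> stab per.
have no (psi : k * k -> k) : evt (fun x y => psi (x, y) < psi (t (x, y))) -> False.
  move=> H; have Hj j : evt (fun x y => psi (x, y) < psi (iter j.+1 t (x, y))).
    elim: j => [|j IH]; first exact: H.
    have := evt_and H (stab _ IH); move/evt_mono; apply=> x y _ _ [h1 h2].
    apply: lt_trans h1 _; move: h2; rewrite -surjective_pairing.
    by rewrite -iterSr.
  have [x [y [x1 y1]]] := evt_ex (Hj M).
  by rewrite per ?ltxx //; split=> /=; apply: lt_le_trans ltr01 _.
case=> [H [x y] [/= x0 y0]|H|H].
- by have := H x y x0 y0 => /eqP; rewrite subr_eq0 => /eqP.
- exfalso; apply: (no phi); apply: evt_mono H _ => x y _ _; by rewrite subr_gt0.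
- exfalso; apply: (no (fun u => - phi u)); apply: evt_mono H _ => x y _ _.
  by rewrite subr_lt0 ltrN2.
Qed.

Lemma period_of_exponents m M : exponents_return m (1, 0) (0, 1) ->
  (forall u, open_quadrant u -> iter M.+1 theta u = u) ->
  (forall n, signed (fun x y => (iter n theta (x, y)).1 - x)) ->
  (forall n, signed (fun x y => (iter n theta (x, y)).2 - y)) ->
  forall u, open_quadrant u -> iter m theta u = u.
Proof.
move=> T per s1 s2 u qu.
have r1 : asym (fun x y => (pair x y).1) (mono (1, 0)).
  apply: (@asym_ext (mono (1, 0))); first by move=> x y _ _; rewrite /mono /= expr1z expr0z mulr1.
  by apply: asym_refl; apply: evt_true => x y *; apply: mono_gt0.
have r2 : asym (fun x y => (pair x y).2) (mono (0, 1)).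
  apply: (@asym_ext (mono (0, 1))); first by move=> x y _ _; rewrite /mono /= expr1z expr0z mul1r.
  by apply: asym_refl; apply: evt_true => x y *; apply: mono_gt0.
have [h1 h2] := iter_asym T r1 r2.
have st := evt_stable h1 h2.
have perm v : open_quadrant v -> iter M.+1 (iter m theta) v = v.
  move=> qv; rewrite -iterM; elim: m {T h1 h2 st} => [|n IH]; first by rewrite muln0.
  by rewrite mulnS iterD IH per.
have h3 := signed_iter (phi := fst) st perm (s1 m) qu.
have h4 := signed_iter (phi := snd) st perm (s2 m) qu.
by rewrite [LHS]surjective_pairing h3 h4 -surjective_pairing.
Qed.

End Exponents.
End Sector.

(** * Rational maps as maps of the open quadrant *)

Section FracRepr.
Local Open Scope quotient_scope.
(** Numerators and denominators of fractions are only known through the chosen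
    representative; this is the equation that characterizes it. *)
Lemma tofrac_repr (D : idomainType) (h : {fraction D}) :
  h * tofrac \d_(repr h) = tofrac \n_(repr h).
Proof.
rewrite -{1}[h]reprK; unlock tofrac; rewrite -[LHS]FracField.pi_mul.
apply/eqmodP; rewrite /= FracField.equivfE /FracField.mulf.
have d0 := denom_ratioP (repr h).
by rewrite !numden_Ratio ?mulf_neq0 ?oner_eq0 // !mulr1 mulrC.
Qed.
End FracRepr.

Lemma frac_cross (K : fieldType) (a b c d : K) : b != 0 -> d != 0 ->
  (a / b = c / d <-> a * d = c * b).
Proof. by move=> b0 d0; split=> /eqP; rewrite ?eqr_div // => /eqP h; apply/eqP;
  rewrite ?eqr_div // h. Qed.

Lemma mul_fracs (K : fieldType) (a b c d : K) : a / b * (c / d) = (a * c) / (b * d).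
Proof. by rewrite invfM mulrACA. Qed.

Lemma add_fracs (K : fieldType) (a b c d : K) : b != 0 -> d != 0 ->
  a / b + c / d = (a * d + c * b) / (b * d).
Proof. exact: addf_div. Qed.

Lemma frac_mulr (K : fieldType) (a b c : K) : b != 0 -> a / b * c * b = a * c.
Proof. by move=> b0; rewrite mulrAC divfK. Qed.

Definition pt2 (F : fieldType) (x y : F) : 'I_2 -> F := fun i => if i == ord0 then x else y.
Definition ev2 (F : fieldType) (q : {mpoly F[2]}) (x y : F) : F := q.@[pt2 x y].
Definition cst (F : fieldType) : {rmorphism F -> ratfun F} :=
  (@tofrac {mpoly F[2]} \o @mpolyC 2 F).
Arguments cst {F}.

(** What is used of the positive reals: a polynomial that vanishes on the
    quadrant is zero, and products of positive elements are positive. Stating it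
    for an abstract field keeps concrete instances out of the computations with
    fractions. *)
Record dense_cone (F : fieldType) (pos : F -> Prop) : Prop := DenseCone {
  cone1 : pos 1;
  coneM : forall x y, pos x -> pos y -> pos (x * y);
  cone_neq0 : forall x, pos x -> x != 0;
  cone_zariski : forall q : {mpoly F[2]},
    (forall x y, pos x -> pos y -> ev2 q x y = 0) -> q = 0 }.

Section Rep.
Variables (F : fieldType) (pos : F -> Prop).
Hypothesis C : dense_cone pos.
Let pos1 := cone1 C.
Let posM := coneM C.
Let pos_neq0 := cone_neq0 C.
Let zariski := cone_zariski C.
Local Notation K := (ratfun F).
Implicit Types (h : K) (fn : F -> F -> F) (q : {mpoly F[2]}).

Definition quadrant (u : F * F) := pos u.1 /\ pos u.2.

(** h is the rational function that fn evaluates on the quadrant, with a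
    denominator that is positive there. *)
Definition rep h fn := exists n d : {mpoly F[2]},
  [/\ forall x y, pos x -> pos y -> pos (ev2 d x y), h = tofrac n / tofrac d &
      forall x y, pos x -> pos y -> fn x y = ev2 n x y / ev2 d x y].

Lemma den_neq0 (d : {mpoly F[2]}) : (forall x y, pos x -> pos y -> pos (ev2 d x y)) ->
  tofrac d != 0.
Proof.
move=> H; rewrite tofrac_eq0; have := pos_neq0 (H 1 1 pos1 pos1).
by apply: contraNneq => ->; rewrite /ev2 meval0.
Qed.

(** A polynomial identity that holds on the quadrant holds identically. *)
Lemma rep_inj h h' fn fn' : rep h fn -> rep h' fn' ->
  (h = h' <-> forall x y, pos x -> pos y -> fn x y = fn' x y).
Proof.
move=> [n [d [d0 -> E]]] [n' [d' [d0' -> E']]].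
have t0 := den_neq0 d0; have t0' := den_neq0 d0'.
split=> [H x y x0 y0|H].
  have : n * d' = n' * d.
    apply/eqP; rewrite -tofrac_eq 2!tofracM; apply/eqP.
    exact: (frac_cross (tofrac n) (tofrac n') t0 t0').1 H.
  move/(congr1 (fun q => ev2 q x y)); rewrite /ev2 !mevalM => H'.
  have p0 := pos_neq0 (d0 x y x0 y0); have p0' := pos_neq0 (d0' x y x0 y0).
  by rewrite E // E' // /ev2; apply/eqP; rewrite eqr_div // H' eqxx.
have : n * d' - n' * d = 0.
  apply: zariski => x y x0 y0; rewrite /ev2 mevalB !mevalM.
  have p0 := pos_neq0 (d0 x y x0 y0); have p0' := pos_neq0 (d0' x y x0 y0).
  have := H x y x0 y0; rewrite E // E' // => /eqP; rewrite eqr_div // => /eqP.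
  by rewrite /ev2 => ->; rewrite subrr.
move/eqP; rewrite subr_eq0 => /eqP H'.
apply: (frac_cross (tofrac n) (tofrac n') t0 t0').2.
by rewrite -2!tofracM H'.
Qed.

Lemma rep_ext h fn fn' : (forall x y, pos x -> pos y -> fn x y = fn' x y) ->
  rep h fn -> rep h fn'.
Proof.
move=> H [n [d [d0 E1 E2]]]; exists n, d; split=> // x y x0 y0.
by rewrite -H // E2.
Qed.

Lemma rep_poly q : rep (tofrac q) (ev2 q).
Proof.
exists q, 1; split=> [x y _ _||x y _ _].
- by rewrite /ev2 meval1; exact: pos1.
- by rewrite tofrac1 divr1.
- by rewrite /ev2 meval1 divr1.
Qed.

Lemma rep_cst c : rep (cst c) (fun _ _ => c).
Proof. by apply: rep_ext (rep_poly _) => x y _ _; rewrite /ev2 mevalC. Qed.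

Lemma rep_x : rep xvar (fun x _ => x).
Proof. by apply: rep_ext (rep_poly _) => x y _ _; rewrite /ev2 mevalXU. Qed.

Lemma rep_y : rep yvar (fun _ y => y).
Proof. by apply: rep_ext (rep_poly _) => x y _ _; rewrite /ev2 mevalXU. Qed.

Lemma rep_mul h h' fn fn' : rep h fn -> rep h' fn' ->
  rep (h * h') (fun x y => fn x y * fn' x y).
Proof.
move=> [n [d [d0 -> E]]] [n' [d' [d0' -> E']]].
have t0 := den_neq0 d0; have t0' := den_neq0 d0'.
exists (n * n'), (d * d'); split=> [x y x0 y0||x y x0 y0].
- by rewrite /ev2 mevalM; apply: posM; [exact: d0|exact: d0'].
- by rewrite 2!tofracM; exact: mul_fracs.
- by rewrite E // E' // /ev2 !mevalM invfM mulrACA.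
Qed.

Lemma rep_add h h' fn fn' : rep h fn -> rep h' fn' ->
  rep (h + h') (fun x y => fn x y + fn' x y).
Proof.
move=> [n [d [d0 -> E]]] [n' [d' [d0' -> E']]].
have t0 := den_neq0 d0; have t0' := den_neq0 d0'.
exists (n * d' + n' * d), (d * d'); split=> [x y x0 y0||x y x0 y0].
- by rewrite /ev2 mevalM; apply: posM; [exact: d0|exact: d0'].
- by rewrite tofracD 3!tofracM; exact: (add_fracs (tofrac n) (tofrac n') t0 t0').
- rewrite E // E' // /ev2 mevalD !mevalM; field.
  by conjs; apply: pos_neq0; first [exact: d0 | exact: d0'].
Qed.

Lemma rep_inv h fn : rep h fn -> (forall x y, pos x -> pos y -> pos (fn x y)) ->
  rep h^-1 (fun x y => (fn x y)^-1).
Proof.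
move=> [n [d [d0 -> E]]] fn0; exists d, n; split=> [x y x0 y0||x y x0 y0].
- have -> : ev2 n x y = fn x y * ev2 d x y.
    by rewrite E // divfK // pos_neq0 //; exact: d0.
  by apply: posM; [exact: fn0|exact: d0].
- by rewrite invf_div.
- by rewrite E // invf_div.
Qed.

Lemma rep_div h h' fn fn' : rep h fn -> rep h' fn' ->
  (forall x y, pos x -> pos y -> pos (fn' x y)) ->
  rep (h / h') (fun x y => fn x y / fn' x y).
Proof. by move=> H H' p; apply: rep_mul => //; apply: rep_inv. Qed.

Lemma rep_exp h fn m : rep h fn -> rep (h ^+ m) (fun x y => fn x y ^+ m).
Proof.
move=> H; elim: m => [|m IH].
  by rewrite expr0 -(rmorph1 cst); exact: rep_cst.
by rewrite exprS; apply: rep_ext (rep_mul H IH) => x y _ _; rewrite exprS.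
Qed.

Lemma rep_sum (I : Type) (r : seq I) (H : I -> K) (fn : I -> F -> F -> F) :
  (forall i, rep (H i) (fn i)) -> rep (\sum_(i <- r) H i) (fun x y => \sum_(i <- r) fn i x y).
Proof.
move=> hH; elim: r => [|i r IH].
  rewrite big_nil -(rmorph0 cst); apply: rep_ext (rep_cst _) => x y _ _.
  by rewrite big_nil.
rewrite big_cons; apply: rep_ext (rep_add (hH i) IH) => x y _ _.
by rewrite big_cons.
Qed.

Lemma rep_neq0 h fn : rep h fn -> (forall x y, pos x -> pos y -> pos (fn x y)) -> h != 0.
Proof.
move=> H p; have := pos_neq0 (p 1 1 pos1 pos1); apply: contraNneq => h0.
by have := rep_inj H (rep_cst 0); rewrite h0 rmorph0 => -[/(_ (erefl _)) -> //].
Qed.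

Lemma rep_quad a b c h fn : rep h fn ->
  rep (quad (cst a) (cst b) (cst c) h) (fun x y => quad a b c (fn x y)).
Proof.
move=> H; apply: rep_add (rep_cst _); apply: rep_add; apply: rep_mul => //; try exact: rep_cst.
exact: rep_exp.
Qed.

Definition repmap (g : K * K) (t : F * F -> F * F) :=
  rep g.1 (fun x y => (t (x, y)).1) /\ rep g.2 (fun x y => (t (x, y)).2).

Lemma repmap_inj g g' t t' : repmap g t -> repmap g' t' ->
  (g = g' <-> forall u, quadrant u -> t u = t' u).
Proof.
case: g g' => [g1 g2] [g1' g2'] [/= h1 h2] [/= h1' h2'].
have i1 := rep_inj h1 h1'; have i2 := rep_inj h2 h2'.
split=> [[/i1 e1 /i2 e2] [x y] [/= x0 y0]|H].
  by rewrite [t _]surjective_pairing [t' _]surjective_pairing e1 // e2.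
by congr pair; [apply/i1|apply/i2] => x y x0 y0; rewrite H //.
Qed.

Lemma rep_polysubst q g t : repmap g t ->
  rep (polysubst q g) (fun x y => ev2 q (t (x, y)).1 (t (x, y)).2).
Proof.
move=> [h1 h2]; rewrite /polysubst /mmap.
apply: (@rep_ext _ (fun x y => \sum_(m <- msupp q) q@_m *
  ((t (x, y)).1 ^+ m ord0 * (t (x, y)).2 ^+ m ord_max))).
  move=> x y _ _; rewrite /ev2 mevalE; apply: eq_bigr => m _; congr (_ * _).
  by rewrite big_ord_recl big_ord1 (_ : lift ord0 ord0 = ord_max) //; apply: val_inj.
apply: rep_sum => m; apply: rep_mul; first exact: rep_cst.
rewrite /mmap1 big_ord_recl big_ord1 (_ : lift ord0 ord0 = ord_max); last exact: val_inj.
by apply: rep_mul; apply: rep_exp.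
Qed.

Definition onto_quadrant (t : F * F -> F * F) :=
  forall u, quadrant u -> exists2 v, quadrant v & t v = u.
Definition into_quadrant (t : F * F -> F * F) :=
  forall u, quadrant u -> quadrant (t u).

(** A map onto the quadrant is dominant, so no polynomial vanishes on its
    image. *)
Lemma polysubst_neq0 q g t : repmap g t -> onto_quadrant t -> q != 0 -> polysubst q g != 0.
Proof.
move=> H on; apply: contraNneq => q0; apply/eqP/zariski => x y x0 y0.
have [[x' y'] [/= x0' y0'] E] := on (x, y) (conj x0 y0).
have := rep_inj (rep_polysubst q H) (rep_cst 0); rewrite q0 rmorph0 => -[/(_ (erefl _)) H' _].
by rewrite -(H' x' y' x0' y0') E.
Qed.

(** The substitution uses the representative of h, whose denominator may vanish
    at some points of the quadrant; it is compared with the good representative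
    n / d by cross multiplication. *)
Lemma rep_ratsubst h fn g t : rep h fn -> repmap g t -> onto_quadrant t -> into_quadrant t ->
  rep (ratsubst h g) (fun x y => fn (t (x, y)).1 (t (x, y)).2).
Proof.
move=> [n [d [d0 hE fnE]]] H on int; rewrite /ratsubst.
have := tofrac_repr h; have := denom_ratioP (repr h).
move: (\n_(repr h)) (\d_(repr h)) => N D D0 hND.
have t0 := den_neq0 d0.
have ND : N * d = n * D.
  apply/eqP; rewrite -tofrac_eq 2!tofracM -hND {1}hE.
  by apply/eqP; exact: frac_mulr.
have DG := polysubst_neq0 H on D0.
have rN := rep_polysubst N H; have rD := rep_polysubst D H.
have rn := rep_polysubst n H; have rd := rep_polysubst d H.
have pd x y : pos x -> pos y -> pos (ev2 d (t (x, y)).1 (t (x, y)).2).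
  by move=> x0 y0; have [/= ? ?] := int (x, y) (conj x0 y0); apply: d0.
have dG := rep_neq0 rd pd.
have E : polysubst N g * polysubst d g = polysubst n g * polysubst D g.
  apply/(rep_inj (rep_mul rN rd) (rep_mul rn rD)) => x y _ _.
  by rewrite /ev2 -!mevalM ND.
have -> : polysubst N g / polysubst D g = polysubst n g / polysubst d g.
  exact: (frac_cross (polysubst N g) (polysubst n g) DG dG).2 E.
apply: rep_ext (rep_div rn rd pd) => x y x0 y0.
by have [/= ? ?] := int (x, y) (conj x0 y0); rewrite fnE.
Qed.

Lemma repmap_comp f g s t : repmap f s -> repmap g t -> onto_quadrant t -> into_quadrant t ->
  repmap (mapcomp f g) (s \o t).
Proof.
move=> [f1 f2] H on int; split.
  apply: rep_ext (rep_ratsubst f1 H on int) => x y _ _ /=.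
  by rewrite -surjective_pairing.
apply: rep_ext (rep_ratsubst f2 H on int) => x y _ _ /=.
by rewrite -surjective_pairing.
Qed.

Lemma repmap_id : repmap (mapid F) id.
Proof. by split; [apply: rep_x | apply: rep_y]. Qed.

(** [g] is known only through the equation mapcomp g f = id, so it has no
    representation to start with: its coordinates are shown to agree with those
    of the inverse bijection by evaluating on the image of f, which is the whole
    quadrant. *)
Lemma repmap_linv f s g g' s' : repmap f s -> onto_quadrant s ->
  repmap g' s' -> (forall u, quadrant u -> s' (s u) = u) ->
  mapcomp g f = mapid F -> g = g'.
Proof.
move=> H on H' inv E.
have key (h h' : K) fn fn' c : rep c fn -> ratsubst h f = c -> rep h' fn' ->
   (forall x y, pos x -> pos y -> fn' (s (x, y)).1 (s (x, y)).2 = fn x y) -> h = h'.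
  move=> rc; rewrite /ratsubst.
  have := tofrac_repr h; have := denom_ratioP (repr h).
  move: (\n_(repr h)) (\d_(repr h)) => N D D0 hND hc [n [d [d0 h'E fnE]]] vE.
  have DG := polysubst_neq0 H on D0.
  have rN := rep_polysubst N H; have rD := rep_polysubst D H.
  have ND : N * d = n * D.
    apply/eqP; rewrite -subr_eq0; apply/eqP/zariski => x y x0 y0.
    rewrite /ev2 mevalB !mevalM -!/(ev2 _ _ _).
    have [[x' y'] [/= x0' y0'] xyE] := on (x, y) (conj x0 y0).
    have NE : polysubst N f = c * polysubst D f by rewrite -hc; symmetry; exact: divfK.
    move/(rep_inj rN (rep_mul rc rD)): NE => /(_ x' y' x0' y0').
    rewrite xyE /= => ->; rewrite -(vE x' y' x0' y0') xyE /= fnE //.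
    by field; apply: pos_neq0; exact: d0.
  have t0 := den_neq0 d0.
  have tD : tofrac D != 0 by rewrite tofrac_eq0.
  rewrite h'E; apply: (mulIf tD); rewrite hND; apply: (mulIf t0).
  have := congr1 (fun q => tofrac q) ND; rewrite 2!tofracM => ND'.
  exact: etrans ND' (esym (frac_mulr (tofrac n) (tofrac D) t0)).
have [g1 g2] : mapcomp g f = mapid F := E.
case: H' => r1 r2.
case: g g' g1 g2 r1 r2 {E} => [g1 g2] [g1' g2'] /= e1 e2 r1 r2; congr pair.
  apply: (key _ _ _ _ _ rep_x e1 r1) => x y x0 y0.
  by rewrite -surjective_pairing inv.
apply: (key _ _ _ _ _ rep_y e2 r2) => x y x0 y0.
by rewrite -surjective_pairing inv.
Qed.

End Rep.

(** * Groups generated by two involutions *)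

Section Words.
Variables (F : fieldType) (pos : F -> Prop).
Hypothesis C : dense_cone pos.
Local Notation K := (ratfun F).
Local Notation quadrant := (quadrant pos).
Variables (phi : bool -> K * K) (rho : bool -> F * F -> F * F).
Hypothesis phi_rho : forall b, repmap pos (phi b) (rho b).
Hypothesis rho_into : forall b u, quadrant u -> quadrant (rho b u).
Hypothesis rhoK : forall b u, quadrant u -> rho b (rho b u) = u.

Definition act (w : seq bool) u := foldr (fun b v => rho b v) u w.
Fixpoint wmap (w : seq bool) : K * K :=
  if w is b :: w' then mapcomp (phi b) (wmap w') else mapid F.

Lemma act_cat w w' u : act (w ++ w') u = act w (act w' u).
Proof. by rewrite /act foldr_cat. Qed.

Lemma act_into w : into_quadrant pos (act w).
Proof. by move=> u qu; elim: w => //= b w IH; apply: rho_into. Qed.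

Lemma act_rev w u : quadrant u -> act w (act (rev w) u) = u.
Proof.
elim: w u => [|b w IH] u qu //=.
rewrite rev_cons -cats1 act_cat /= IH; first exact: rhoK.
exact: rho_into.
Qed.

Lemma act_onto w : onto_quadrant pos (act w).
Proof. by move=> u qu; exists (act (rev w) u); [exact: act_into | exact: act_rev]. Qed.

Lemma rep_wmap w : repmap pos (wmap w) (act w).
Proof.
elim: w => [|b w IH] /=; first exact: repmap_id C.
by apply: (repmap_comp C (phi_rho b) IH) => //; [exact: act_onto | exact: act_into].
Qed.

(** Birational maps are exchanged here for permutations of the quadrant. *)
Lemma wmap_eq w w' : wmap w = wmap w' <-> forall u, quadrant u -> act w u = act w' u.
Proof. exact: (repmap_inj C (rep_wmap w) (rep_wmap w')). Qed.

Lemma wmap_cat w w' : mapcomp (wmap w) (wmap w') = wmap (w ++ w').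
Proof.
have H : repmap pos (mapcomp (wmap w) (wmap w')) (act w \o act w').
  by apply: (repmap_comp C (rep_wmap w) (rep_wmap w')) => //; [exact: act_onto | exact: act_into].
apply/(repmap_inj C H (rep_wmap _)) => u _ /=.
by rewrite act_cat.
Qed.

(** Words are closed under inverses because the reversed word acts as the
    inverse. *)
Lemma generated_words :
  generated_group [set phi false; phi true] = [set wmap w | w in setT].
Proof.
rewrite eqEsubset; split.
  move=> g; apply; split; last first.
    move=> _ /= [->|->]; [exists [:: false]|exists [:: true]] => //=;
    apply/(repmap_inj C (rep_wmap [:: _]) (phi_rho _)) => u _ //.
  split.
  - by exists [::].
  - by move=> _ _ [w _ <-] [w' _ <-]; exists (w ++ w') => //; rewrite wmap_cat.
  - move=> _ g' [w _ <-] _ E; exists (rev w) => //.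
    symmetry; apply: (repmap_linv C (rep_wmap w) (@act_onto w) (rep_wmap (rev w)) _ E).
    by move=> u qu; rewrite -{2}(revK w) act_rev.
move=> _ [w _ <-] G [[Gid Gmul _] Gsub].
elim: w => [|b w IH] //=; apply: Gmul => //; apply: Gsub.
by case: b; [right|left].
Qed.

Definition turn u := rho true (rho false u).
Definition rot_word n : seq bool := flatten (nseq n [:: true; false]).
Local Notation G := (generated_group [set phi false; phi true]).

Lemma act_rot n u : act (rot_word n) u = iter n turn u.
Proof. by elim: n => //= n <-. Qed.

Lemma turn_into n u : quadrant u -> quadrant (iter n turn u).
Proof. by rewrite -act_rot; exact: act_into. Qed.

(** If all iterates of the turn were distinct, the corresponding words would be
    infinitely many elements of the group. *)
Lemma finite_turn : finite_set G ->
  exists M, forall u, quadrant u -> iter M.+1 turn u = u.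
Proof.
move=> fin; apply: contrapT => no.
have inj : injective (fun n => wmap (rot_word n)).
  have lt i j : (i < j)%N -> wmap (rot_word i) <> wmap (rot_word j).
    move=> ij /wmap_eq E; apply: no; exists (j - i).-1 => u qu.
    have [v qv <-] := act_onto (rot_word i) qu.
    rewrite prednK ?subn_gt0 // {1}act_rot -iterD subnK ?(ltnW ij) //.
    by rewrite -act_rot -E.
  move=> i j E; have [ij|ji|//] := ltngtP i j; first by case: (lt _ _ ij).
  by case: (lt _ _ ji).
have := @finite_preimage _ _ G (fun n => wmap (rot_word n)).
move=> /(_ (in2W inj) fin).
have -> : (fun n => wmap (rot_word n)) @^-1` G = setT.
  by apply/seteqP; split=> // n _ /=; rewrite generated_words; exists (rot_word n).
exact: infinite_nat.
Qed.

(** A reflection conjugates the rotation to its inverse. *)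
Lemma turn_refl n u : quadrant u ->
  iter n turn (rho false (iter n turn u)) = rho false u.
Proof.
move=> qu; elim: n => // n IH; rewrite iterSr [in LHS]iterS -[RHS]IH.
congr (iter n turn _); rewrite /turn.
have q1 := turn_into n qu.
rewrite rhoK; last by apply: rho_into; apply: rho_into.
by rewrite rhoK //; apply: rho_into.
Qed.

Section Dihedral.
Variable m : nat.
Hypothesis m0 : (0 < m)%N.
Hypothesis turn_m : forall u, quadrant u -> iter m turn u = u.

Lemma turn_mul c u : quadrant u -> iter (c * m) turn u = u.
Proof. by move=> qu; elim: c => // c IH; rewrite mulSn iterD IH turn_m. Qed.

Lemma turn_mod n u : quadrant u -> iter n turn u = iter (n %% m) turn u.
Proof. by move=> qu; rewrite {1}(divn_eq n m) addnC iterD turn_mul. Qed.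

Lemma refl_turn n u : quadrant u ->
  rho false (iter n turn u) = iter (n * m - n) turn (rho false u).
Proof.
move=> qu; rewrite -(turn_refl n qu) -iterD subnK; last by rewrite leq_pmulr.
by rewrite turn_mul //; apply: rho_into; apply: turn_into.
Qed.

(** A reflection moves past a rotation by inverting it ([turn_refl]), which
    sorts the letters of a word. *)
Lemma act_normal w : exists n b, forall u, quadrant u ->
  act w u = iter n turn (if b then rho false u else u).
Proof.
elim: w => [|b w [n [c IH]]]; first by exists 0%N, false.
have q u : quadrant u -> quadrant (if c then rho false u else u).
  by case: c {IH} => // qu; apply: rho_into.
have E u : quadrant u -> rho false (act w u) =
    iter (n * m - n) turn (if ~~ c then rho false u else u).
  move=> qu; rewrite IH // refl_turn; last exact: q.
  by congr (iter _ _ _); case: c {IH q} => //=; rewrite rhoK.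
case: b; last by exists (n * m - n)%N, (~~ c).
exists (n * m - n).+1, (~~ c) => u qu /=; rewrite -E // /turn rhoK //.
exact: act_into.
Qed.

Hypothesis turn_min : forall j, (0 < j < m)%N -> ~ forall u, quadrant u -> iter j turn u = u.
Hypothesis rho_id : forall b, ~ forall u, quadrant u -> rho b u = u.

(** Such a reflection would commute with the rotation, whose order would then be
    at most two; in that case one of the two involutions would be the
    identity. *)
Lemma refl_not_turn j : ~ forall u, quadrant u -> rho false u = iter j turn u.
Proof.
move=> E.
have comm u : quadrant u -> turn (rho false u) = rho false (turn u).
  move=> qu; rewrite (E _ qu) (E (turn u)); last exact: (turn_into 1).
  by rewrite -iterS -iterSr.
have T2 u : quadrant u -> iter 2 turn u = u.
  move=> qu /=; have q1 : quadrant (rho false u) by apply: rho_into.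
  have := comm _ q1; rewrite /turn !rhoK // => E1.
  by rewrite E1 !rhoK //; apply: rho_into.
(* a reflection that is a power of the rotation commutes with it *)
have m2 : (m <= 2)%N.
  by rewrite leqNgt; apply/negP => m2; apply: (turn_min (j := 2)).
have : (j %% m < 2)%N by apply: leq_trans m2; rewrite ltn_mod.
have E' u : quadrant u -> rho false u = iter (j %% m) turn u.
  by move=> qu; rewrite -turn_mod // E.
case: (j %% m)%N E' => [|[|//]] E' _; first exact: (rho_id E').
apply: (@rho_id true) => u qu.
have q1 : quadrant (rho false u) by apply: rho_into.
by have := E' _ q1; rewrite /= /turn rhoK.
Qed.

Definition dihedral_word i : seq bool := rot_word i./2 ++ nseq (odd i) false.

Lemma act_dihedral i u :
  act (dihedral_word i) u = iter i./2 turn (if odd i then rho false u else u).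
Proof. by rewrite act_cat act_rot; case: (odd i). Qed.

Lemma turn_cancel i j : (i < m)%N -> (j < m)%N ->
  (forall u, quadrant u -> iter i turn u = iter j turn u) -> i = j.
Proof.
wlog ij : i j / (i <= j)%N => [H|] im jm E.
  have [ij|ji] := leqP i j; first exact: H.
  by symmetry; apply: H => //; [exact: ltnW | move=> u qu; rewrite E].
apply/eqP; rewrite eqn_leq ij /= leqNgt; apply/negP => lt_ij.
apply: (turn_min (j := j - i)); first by rewrite subn_gt0 lt_ij (leq_ltn_trans (leq_subr _ _)).
move=> u qu; have [v qv <-] := act_onto (rot_word i) qu.
by rewrite act_rot -iterD subnK // E.
Qed.

(** The words listed by [dihedral_word] represent every element, and they are
    pairwise distinct because the rotations below m are distinct and no
    reflection is a rotation. *)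
Lemma card_dihedral : G #= `I_(2 * m).
Proof.
have -> : G = [set wmap (dihedral_word i) | i in `I_(2 * m)].
  rewrite generated_words; apply/seteqP; split=> [_ [w _ <-]|_ [i _ <-]]; last first.
    by exists (dihedral_word i).
  have [n [b E]] := act_normal w.
  have lt : (n %% m < m)%N by rewrite ltn_mod.
  have o : odd (b + (n %% m).*2) = b by rewrite oddD odd_double addbF oddb.
  have h : (b + (n %% m).*2)./2 = (n %% m)%N by rewrite half_bit_double.
  exists (b + (n %% m).*2)%N.
    by rewrite /= mul2n; case: b {E o h}; rewrite ?add1n ?add0n ?ltn_Sdouble ?ltn_double.
  apply/wmap_eq => u qu; rewrite E // act_dihedral o h -turn_mod //.
  by case: b {E o h} => //; apply: rho_into.
apply: inj_card_eq => i j.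
rewrite !inE /= => im jm /wmap_eq E.
have hi : (i./2 < m)%N by rewrite ltn_half_double -mul2n.
have hj : (j./2 < m)%N by rewrite ltn_half_double -mul2n.
have step a b : (a < m)%N -> (b < m)%N -> ~ forall u, quadrant u ->
  iter a turn (rho false u) = iter b turn u.
  move=> am bm H; apply: (@refl_not_turn (m - a + b)) => u qu.
  rewrite iterD -H // -iterD subnK ?turn_m //; [exact: rho_into | exact: ltnW].
rewrite -(odd_double_half i) -(odd_double_half j).
move: E; case oi: (odd i); case oj: (odd j) => E.
- congr (_ + _.*2)%N; apply: turn_cancel => // u qu.
  have q1 : quadrant (rho false u) by apply: rho_into.
  by have := E _ q1; rewrite !act_dihedral oi oj rhoK.
- by case: (step _ _ hi hj) => u qu; have := E _ qu; rewrite !act_dihedral oi oj.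
- by case: (step _ _ hj hi) => u qu; have := E _ qu; rewrite !act_dihedral oi oj => ->.
- congr (_ + _.*2)%N; apply: turn_cancel => // u qu.
  by have := E _ qu; rewrite !act_dihedral oi oj.
Qed.

End Dihedral.
End Words.

(** * Eventual signs of bivariate polynomials *)

Section Bivariate.
Variable R : realFieldType.

Lemma poly_upper (c : {poly R}) : exists2 C, 0 <= C & forall y, 1 <= y ->
  `|c.[y]| <= C * y ^+ size c.
Proof.
exists (\sum_(i < size c) `|c`_i|); first by apply: sumr_ge0 => i _; apply: normr_ge0.
move=> y y1; rewrite horner_coef mulr_suml.
apply: le_trans (ler_norm_sum _ _ _) _; apply: ler_sum => i _.
rewrite normrM ler_wpM2l // ger0_norm ?exprn_ge0 ?(le_trans ler01) //.
by apply: ler_weXn2l => //; apply: ltnW.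
Qed.

(** By induction on the degree: a polynomial that is eventually at least d > 0,
    once multiplied by y, dominates any constant. *)
Lemma poly_lower (c : {poly R}) : 0 < lead_coef c ->
  exists2 d, 0 < d & exists B, forall y, B <= y -> d <= c.[y].
Proof.
elim/poly_ind: c => [|c a IH]; first by rewrite lead_coef0 ltxx.
case: (eqVneq c 0) => [->|c0].
  rewrite mul0r add0r lead_coefC => a0; exists a => //; exists 0 => y _.
  by rewrite hornerC.
have -> : lead_coef (c * 'X + a%:P) = lead_coef c.
  rewrite lead_coefDl ?lead_coefMX // size_mulX // size_polyC.
  by case: (a == 0); rewrite ?ltnS ?size_poly_gt0.
move=> /IH [d d0 [B HB]]; exists d => //; exists (Num.max B (1 + (1 + `|a|) / d)) => y.
rewrite ge_max => /andP [By yd]; rewrite !hornerE.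
have y1 : 1 <= y by apply: le_trans yd; rewrite lerDl divr_ge0 // ?addr_ge0 // ltW.
have h1 : d <= c.[y] := HB y By.
have h2 : d * (1 + (1 + `|a|) / d) <= c.[y] * y.
  by apply: ler_pM => //; [exact: ltW|rewrite addr_ge0 // divr_ge0 // ?addr_ge0 // ltW].
have h3 : d * (1 + (1 + `|a|) / d) = d + (1 + `|a|) by field; exact: lt0r_neq0.
have h4 : - `|a| <= a by rewrite lerNl ler_normr lexx orbT.
by move: h2; rewrite h3; lra.
Qed.

(** By induction on the degree in x: multiplying by x a polynomial that is at
    least d > 0 in the sector dominates any coefficient that depends on y alone.
    A bound by a constant d, rather than a mere sign, is what makes the
    induction work. *)
Lemma bipoly_sign (Q : {poly {poly R}}) : Q = 0 \/
  exists2 d, 0 < d & evt (fun x y => d <= Q.[x%:P].[y]) \/ evt (fun x y => Q.[x%:P].[y] <= - d).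
Proof.
elim/poly_ind: Q => [|Q c IH]; first by left.
have pos (P : {poly {poly R}}) (a : {poly R}) d : 0 < d -> evt (fun x y => d <= P.[x%:P].[y]) ->
    evt (fun x y => d <= (P * 'X + a%:P).[x%:P].[y]).
  move=> d0 H; have [C C0 HC] := poly_upper a.
  have B1 : 1 <= 1 + C / d by rewrite lerDl divr_ge0 // ltW.
  apply: (@evt_mono _ (fun x y => d <= P.[x%:P].[y] /\ (1 + C / d <= y /\ y ^+ (size a).+1 <= x))).
    by apply: evt_and => //; exists (size a).+1, (1 + C / d).
  move=> x y x1 y1 [h1 [h2 h3]].
  rewrite hornerD hornerM hornerX hornerC hornerD hornerM hornerC.
  have h4 := HC y y1.
  have h5 : - `|a.[y]| <= a.[y] by rewrite lerNl ler_normr lexx orbT.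
  have h6 : d * (y ^+ (size a).+1) <= P.[x%:P].[y] * x.
    by apply: ler_pM => //; [exact: ltW|apply: exprn_ge0; apply: le_trans y1].
  have h7 : d * (1 + C / d) * y ^+ size a <= d * y ^+ (size a).+1.
    rewrite exprS mulrA ler_wpM2r ?ler_wpM2l ?(ltW d0) //.
    by apply: exprn_ge0; apply: le_trans y1.
  have h8 : d * (1 + C / d) = d + C by field; exact: lt0r_neq0.
  have h9 : d <= d * y ^+ size a by rewrite -{1}[d]mulr1 ler_wpM2l ?(ltW d0) // exprn_ege1.
  rewrite h8 mulrDl in h7; lra.
case: IH => [->|[d d0 [H|H]]].
- rewrite mul0r add0r.
  have [c0|c0|c0] := ltrgtP (lead_coef c) 0.
  + have [|d d0 [B HB]] := @poly_lower (- c); first by rewrite lead_coefN oppr_gt0.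
    right; exists d => //; right; exists 0%N, (Num.max 1 B); first by rewrite le_max lexx.
    move=> x y; rewrite ge_max => /andP [_ By] _; rewrite hornerC.
    by have := HB y By; rewrite hornerN lerNr.
  + have [d d0 [B HB]] := @poly_lower c c0.
    right; exists d => //; left; exists 0%N, (Num.max 1 B); first by rewrite le_max lexx.
    by move=> x y; rewrite ge_max => /andP [_ By] _; rewrite hornerC; exact: HB.
  + by move/eqP: c0; rewrite lead_coef_eq0 => /eqP ->; left.
- by right; exists d => //; left; apply: pos.
- right; exists d => //; right.
  have H' : evt (fun x y => d <= (- Q).[x%:P].[y]).
    by apply: evt_mono H _ => x y _ _; rewrite !hornerN lerNr.
  apply: evt_mono (pos _ (- c) _ d0 H') _ => x y _ _.
  by rewrite mulNr polyCN -opprD !hornerN lerNr.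
Qed.

End Bivariate.

Section Sign.
Variable R : realType.
Local Notation F := (R : fieldType).

(** The same polynomial viewed in R[y][x]. *)
Definition bipoly (q : {mpoly F[2]}) : {poly {poly R}} :=
  \sum_(m <- msupp q) (q@_m)%:P%:P * ('X ^+ m ord0 * ('X ^+ m ord_max)%:P).

Lemma bipolyE (q : {mpoly F[2]}) (x y : R) : (bipoly q).[x%:P].[y] = ev2 q x y.
Proof.
rewrite /ev2 mevalE /bipoly !horner_sum; apply: eq_bigr => m _.
rewrite big_ord_recl big_ord1 !(hornerM, hornerC, hornerXn, hornerX, horner_exp).
by rewrite (_ : lift ord0 ord0 = ord_max) //; apply: val_inj.
Qed.

Lemma bipoly_eq0 (q : {mpoly F[2]}) : bipoly q = 0 -> q = 0.
Proof.
move=> H; apply/mpolyP => m; rewrite mcoeff0.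
case: (boolP (m \in msupp q)) => [mq|]; last by move=> /memN_msupp_eq0 ->.
have : (bipoly q)`_(m ord0)`_(m ord_max) = 0 by rewrite H !coef0.
rewrite /bipoly !coef_sum (bigD1_seq m) ?msupp_uniq //= big1 ?addr0.
  by rewrite coefCM coefXnM ltnn subnn coefC eqxx /= coefCM coefXn eqxx mulr1.
move=> m' nm; rewrite coefCM coefXnM; case: ltnP => [_|le0]; first by rewrite mulr0 coef0.
rewrite coefC subn_eq0; case: leqP => [le1|_]; last by rewrite mulr0 coef0.
rewrite coefCM coefXn; case: eqP => [e1|_]; last by rewrite mulr0.
case/eqP: nm; apply/mnmP => i.
have [->|->] : i = ord0 \/ i = ord_max.
  by case: i => [[|[|//]] hi]; [left|right]; apply: val_inj.
  by apply/eqP; rewrite eqn_leq le0 le1.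
by [].
Qed.

(** Reading the polynomial in R[y][x] reduces this to [bipoly_sign]. *)
Lemma ev2_sign (q : {mpoly F[2]}) : q = 0 \/ evt (fun x y : R => 0 < ev2 q x y) \/
  evt (fun x y : R => ev2 q x y < 0).
Proof.
case: (bipoly_sign (bipoly q)) => [/bipoly_eq0|[d d0 H]]; first by left.
right; case: H => H; [left|right]; apply: evt_mono H _ => x y _ _; rewrite bipolyE; lra.
Qed.

Lemma ev2_eq0 (q : {mpoly F[2]}) : (forall x y : R, 0 < x -> 0 < y -> ev2 q x y = 0) -> q = 0.
Proof.
move=> H; case: (ev2_sign q) => // [[|]] /evt_ex [x [y [x1 y1]]];
  by rewrite H ?ltxx // (lt_le_trans ltr01).
Qed.

End Sign.

(** * Exponents of quotients of trinomials *)

Section ExpoQuad.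
Variable k : realFieldType.
Definition topdeg (a b : k) : int := if a != 0 then 2 else if b != 0 then 1 else 0.
Definition lowdeg (b c : k) : int := if c != 0 then 0 else if b != 0 then 1 else 2.

(** The exponents of a trinomial at infinity and at 0 are its degree and its
    order of vanishing; positivity of the coefficients excludes cancellation. *)
Lemma expo_quad (a b c : k) : 0 <= a -> 0 <= b -> 0 <= c -> 0 < a + b + c ->
  expo (quad a b c) (topdeg a b) (lowdeg b c).
Proof.
move=> a0 b0 c0 s0.
(* C bounds the inverses of the nonzero coefficients as well as their sum *)
pose m (v : k) := if v == 0 then 0 else v^-1.
have m0 v : 0 <= v -> 0 <= m v by move=> v0; rewrite /m; case: eqP => // _; rewrite invr_ge0.
have [C CE] := named (1 + (a + b + c) + m a + m b + m c).
have C0 : 0 < C by have := m0 _ a0; have := m0 _ b0; have := m0 _ c0; rewrite CE; lra.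
(* a monomial of the trinomial dominates the others *)
have dom (v w q : k) : 0 <= v -> v != 0 -> m v <= C -> 0 < w -> v * w <= q ->
    q <= (a + b + c) * w -> [/\ 0 < q, q <= C * w & w <= C * q].
  move=> v0 vn mC w0 vq qw.
  have vp : 0 < v by rewrite lt_neqAle eq_sym vn.
  have q0 : 0 < q by apply: lt_le_trans vq; apply: mulr_gt0.
  split=> //.
    apply: le_trans qw _; rewrite ler_pM2r // CE.
    by have := m0 _ a0; have := m0 _ b0; have := m0 _ c0; lra.
  apply: (@le_trans _ _ (v^-1 * q)); first by rewrite mulrC ler_pdivlMr // mulrC.
  by rewrite ler_pM2r //; move: mC; rewrite /m (negbTE vn).
have mC v : (v == a) || (v == b) || (v == c) -> m v <= C.
  have := m0 _ a0; have := m0 _ b0; have := m0 _ c0; rewrite CE => h1 h2 h3.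
  by case/orP => [/orP [|]|] /eqP ->; lra.
exists C => //; split=> [u u1|u u0 u1].
  have u0 : 0 < u by apply: lt_le_trans u1.
  have uu : u <= u * u by rewrite -{1}[u]mulr1 ler_pM2l.
  have h2 : 0 <= a * (u * u - u) by rewrite mulr_ge0 // subr_ge0.
  have h3 : 0 <= b * (u * u - u) by rewrite mulr_ge0 // subr_ge0.
  have h4 : 0 <= c * (u - 1) by rewrite mulr_ge0 // subr_ge0.
  have h5 : 0 <= c * (u * u - u) by rewrite mulr_ge0 // subr_ge0.
  have h6 : 0 <= b * u by rewrite mulr_ge0 // ltW.
  have h7 : 0 <= b * (u - 1) by rewrite mulr_ge0 // subr_ge0.
  have h8 : 0 <= a * u by rewrite mulr_ge0 // ltW.
  rewrite /topdeg; case: (eqVneq a 0) => [az|an] /=; last first.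
    apply: (dom a) => //; first by apply: mC; rewrite eqxx.
    - by rewrite exprn_gt0.
    - by rewrite /quad; lra.
    - by rewrite /quad -[_ ^ 2]/(u ^+ 2); lra.
  rewrite az in h2 h8 s0 dom; case: (eqVneq b 0) => [bz|bn] /=; last first.
    apply: (dom b) => //; first by apply: mC; rewrite eqxx orbT.
    - by rewrite /quad az expr1z; lra.
    - by rewrite /quad az expr1z; lra.
  rewrite bz in h3 h6 h7 s0 dom.
  have cn : c != 0 by apply: lt0r_neq0; lra.
  apply: (dom c) => //; first by apply: mC; rewrite eqxx !orbT.
  - by rewrite /quad az bz expr0z; lra.
  - by rewrite /quad az bz expr0z; lra.
have uu : u * u <= u by rewrite -{3}[u]mulr1 ler_pM2l.
have h2 : 0 <= a * (u - u * u) by rewrite mulr_ge0 // subr_ge0.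
have h3 : 0 <= b * (1 - u) by rewrite mulr_ge0 // subr_ge0.
have h4 : 0 <= a * (u * u) by rewrite !mulr_ge0 // ltW.
have h5 : 0 <= b * u by rewrite mulr_ge0 // ltW.
have h6 : 0 <= a * (1 - u) by rewrite mulr_ge0 // subr_ge0.
rewrite /lowdeg; case: (eqVneq c 0) => [cz|cn] /=; last first.
  apply: (dom c) => //; first by apply: mC; rewrite eqxx !orbT.
  - by rewrite /quad expr0z; lra.
  - by rewrite /quad expr0z; lra.
rewrite cz in s0 dom; case: (eqVneq b 0) => [bz|bn] /=; last first.
  apply: (dom b) => //; first by apply: mC; rewrite eqxx orbT.
  - by rewrite /quad cz expr1z; lra.
  - by rewrite /quad cz expr1z; lra.
rewrite bz in h3 h5 s0 dom.
have an : a != 0 by apply: lt0r_neq0; lra.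
apply: (dom a) => //; first by apply: mC; rewrite eqxx.
- by rewrite exprn_gt0.
- by rewrite /quad bz cz -[_ ^ 2]/(u ^+ 2); lra.
- by rewrite /quad bz cz -[_ ^ 2]/(u ^+ 2); lra.
Qed.

Lemma expo_div (F G : k -> k) s t s' t' : expo F s t -> expo G s' t' ->
  expo (fun u => F u / G u) (s - s') (t - t').
Proof.
move=> [C C0 [H1 H2]] [D D0 [K1 K2]]; exists (C * D); first exact: mulr_gt0.
have key u (i j : int) : 0 < u -> [/\ 0 < F u, F u <= C * u ^ i & u ^ i <= C * F u] ->
    [/\ 0 < G u, G u <= D * u ^ j & u ^ j <= D * G u] ->
    [/\ 0 < F u / G u, F u / G u <= C * D * u ^ (i - j) & u ^ (i - j) <= C * D * (F u / G u)].
  move=> u0 [F0 F1 F2] [G0 G1 G2].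
  have ui : 0 < u ^ i by apply: exprz_gt0.
  have uj : 0 < u ^ j by apply: exprz_gt0.
  rewrite expfzDr ?gt_eqF // -invr_expz.
  move: (u ^ i) (u ^ j) ui uj F1 F2 G1 G2 => a b ui uj F1 F2 G1 G2.
  split; first exact: divr_gt0.
    rewrite ler_pdivrMr // (_ : C * D * (a / b) * G u = (C * a) * ((D * G u) / b)); last by ring.
    apply: le_trans F1 _; rewrite -{1}[C * a]mulr1; apply: ler_wpM2l.
      by apply: mulr_ge0; apply: ltW.
    by rewrite ler_pdivlMr // mul1r.
  rewrite ler_pdivrMr // (_ : C * D * (F u / G u) * b = (C * F u) * ((D * b) / G u)); last by ring.
  apply: le_trans F2 _; rewrite -{1}[C * F u]mulr1; apply: ler_wpM2l.
    by apply: mulr_ge0; apply: ltW.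
  by rewrite ler_pdivlMr // mul1r.
split=> [u u1|u u0 u1]; first by apply: key; [exact: lt_le_trans u1|exact: H1|exact: K1].
by apply: key; [|exact: H2|exact: K2].
Qed.
End ExpoQuad.

(** * The two involutions of a walk *)

Section Weights.
Variable R : realType.
Implicit Types p : weights R.

(** The hypotheses on the walk in real terms: the coefficients A1, C1, A2, C2
    are nonzero iff the extreme rows and columns have positive sums. *)
Record admissible p : Prop := Admissible {
  adm_ge0 : forall i j, i \in steps -> j \in steps -> 0 <= p i j;
  adm_top : 0 < p 1 1 + p 1 0 + p 1 (-1);
  adm_bot : 0 < p (-1) 1 + p (-1) 0 + p (-1) (-1);
  adm_left : 0 < p 1 1 + p 0 1 + p (-1) 1;
  adm_right : 0 < p 1 (-1) + p 0 (-1) + p (-1) (-1) }.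

(** The involutions are x' = rowF y / x and y' = colG x / y. *)
Definition rowF p (y : R) : R :=
  quad (p (-1) 1) (p (-1) 0) (p (-1) (-1)) y / quad (p 1 1) (p 1 0) (p 1 (-1)) y.
Definition colG p (x : R) : R :=
  quad (p 1 (-1)) (p 0 (-1)) (p (-1) (-1)) x / quad (p 1 1) (p 0 1) (p (-1) 1) x.
Definition refl p (b : bool) (u : R * R) : R * R :=
  if b then (u.1, colG p u.1 / u.2) else (rowF p u.2 / u.1, u.2).
Local Notation pos := (fun x : R => 0 < x).

Lemma pos_dense : @dense_cone (R : fieldType) pos.
Proof.
split=> [|x y|x|q]; [exact: ltr01|exact: mulr_gt0|exact: lt0r_neq0|exact: ev2_eq0].
Qed.

Lemma quad_gt0 (k : realFieldType) (a b c u : k) : 0 <= a -> 0 <= b -> 0 <= c ->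
  0 < a + b + c -> 0 < u ->
  0 < quad a b c u.
Proof.
move=> a0 b0 c0 s0 u0; rewrite lt_neqAle eq_sym.
have h1 : 0 <= a * u ^+ 2 by rewrite mulr_ge0 // exprn_ge0 // ltW.
have h2 : 0 <= b * u by rewrite mulr_ge0 // ltW.
have q0 : 0 <= quad a b c u by rewrite /quad !addr_ge0.
rewrite q0 andbT; apply/eqP => E.
have E1 : a * u ^+ 2 = 0 by move: E; rewrite /quad; lra.
have E2 : b * u = 0 by move: E; rewrite /quad; lra.
have E3 : c = 0 by move: E; rewrite /quad; lra.
move/eqP: E1; rewrite mulf_eq0 expf_eq0 /= (gt_eqF u0) orbF => /eqP az.
move/eqP: E2; rewrite mulf_eq0 (gt_eqF u0) orbF => /eqP bz.
by move: s0; rewrite az bz E3; lra.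
Qed.

Section Admissible.
Variable p : weights R.
Hypothesis A : admissible p.
Let p0 i j : i \in steps -> j \in steps -> 0 <= p i j := @adm_ge0 p A i j.

Lemma topq_gt0 y : 0 < y -> 0 < quad (p 1 1) (p 1 0) (p 1 (-1)) y.
Proof. by apply: quad_gt0; rewrite ?p0 //; exact: adm_top. Qed.
Lemma botq_gt0 y : 0 < y -> 0 < quad (p (-1) 1) (p (-1) 0) (p (-1) (-1)) y.
Proof. by apply: quad_gt0; rewrite ?p0 //; exact: adm_bot. Qed.
Lemma leftq_gt0 x : 0 < x -> 0 < quad (p 1 1) (p 0 1) (p (-1) 1) x.
Proof. by apply: quad_gt0; rewrite ?p0 //; exact: adm_left. Qed.
Lemma rightq_gt0 x : 0 < x -> 0 < quad (p 1 (-1)) (p 0 (-1)) (p (-1) (-1)) x.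
Proof. by apply: quad_gt0; rewrite ?p0 //; exact: adm_right. Qed.

Lemma rowF_gt0 y : 0 < y -> 0 < rowF p y.
Proof. by move=> y0; rewrite divr_gt0 ?topq_gt0 ?botq_gt0. Qed.
Lemma colG_gt0 x : 0 < x -> 0 < colG p x.
Proof. by move=> x0; rewrite divr_gt0 ?leftq_gt0 ?rightq_gt0. Qed.

Lemma refl_into b u : quadrant pos u -> quadrant pos (refl p b u).
Proof.
by move=> [u1 u2]; case: b; split=> //=; rewrite divr_gt0 ?colG_gt0 ?rowF_gt0.
Qed.

Lemma reflK b u : quadrant pos u -> refl p b (refl p b u) = u.
Proof.
case: u => x y [/= x0 y0]; case: b => /=.
  have := colG_gt0 x0; rewrite /refl /=; move: (colG p x) => g g0.
  by congr pair; field; rewrite !lt0r_neq0.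
have := rowF_gt0 y0; rewrite /refl /=; move: (rowF p y) => g g0.
by congr pair; field; rewrite !lt0r_neq0.
Qed.

(** x = F(y) / x cannot hold for all x. *)
Lemma refl_id b : ~ forall u, quadrant pos u -> refl p b u = u.
Proof.
move=> H; case: b H => H.
  have g0 := @colG_gt0 1 ltr01.
  have := H (1, 1) (conj ltr01 ltr01); have := H (1, 2) (conj ltr01 (ltr0n _ 2)).
  by move=> [] /= + [] /=; move: (colG p 1) g0 => g g0; lra.
have g0 := @rowF_gt0 1 ltr01.
have := H (1, 1) (conj ltr01 ltr01); have := H (2, 1) (conj (ltr0n _ 2) ltr01).
by move=> [] /= + [] /=; move: (rowF p 1) g0 => g g0; lra.
Qed.

End Admissible.

Local Notation K := (ratfun (R : fieldType)).
Definition rowFK p (v : K) : K :=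
  quad (cst (p (-1) 1)) (cst (p (-1) 0)) (cst (p (-1) (-1))) v
  / quad (cst (p 1 1)) (cst (p 1 0)) (cst (p 1 (-1))) v.
Definition colGK p (u : K) : K :=
  quad (cst (p 1 (-1))) (cst (p 0 (-1))) (cst (p (-1) (-1))) u
  / quad (cst (p 1 1)) (cst (p 0 1)) (cst (p (-1) 1)) u.

Lemma rep_rowF p (A : admissible p) h fn : rep pos h fn ->
  (forall x y, 0 < x -> 0 < y -> 0 < fn x y) ->
  rep pos (rowFK p h) (fun x y => rowF p (fn x y)).
Proof.
move=> H f0; apply: (rep_div pos_dense); try exact: (rep_quad pos_dense).
by move=> x y x0 y0; apply: topq_gt0 => //; apply: f0.
Qed.

Lemma rep_colG p (A : admissible p) h fn : rep pos h fn ->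
  (forall x y, 0 < x -> 0 < y -> 0 < fn x y) ->
  rep pos (colGK p h) (fun x y => colG p (fn x y)).
Proof.
move=> H f0; apply: (rep_div pos_dense); try exact: (rep_quad pos_dense).
by move=> x y x0 y0; apply: leftq_gt0 => //; apply: f0.
Qed.

Lemma laurent_quad (L : fieldType) (a b c y : L) : y != 0 ->
  c * y ^ (-1) + (b * y ^ 0 + (a * y ^ 1 + 0)) = quad a b c y / y.
Proof. by move=> y0; rewrite exprN1 expr0z expr1z /quad; field. Qed.

Lemma xcoefE p i : (yvar : K) != 0 ->
  xcoef p i = quad (cst (p i 1)) (cst (p i 0)) (cst (p i (-1))) (yvar : K) / yvar.
Proof.
move=> y0; rewrite /xcoef /steps !big_cons big_nil.
exact: (@laurent_quad K (rcst (p i 1)) (rcst (p i 0)) (rcst (p i (-1))) yvar y0).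
Qed.

Lemma ycoefE p j : (xvar : K) != 0 ->
  ycoef p j = quad (cst (p 1 j)) (cst (p 0 j)) (cst (p (-1) j)) (xvar : K) / xvar.
Proof.
move=> y0; rewrite /ycoef /steps !big_cons big_nil.
exact: (@laurent_quad K (rcst (p 1 j)) (rcst (p 0 j)) (rcst (p (-1) j)) xvar y0).
Qed.

Lemma xvar_neq0 : (xvar : K) != 0.
Proof. by apply: (rep_neq0 pos_dense (rep_x pos_dense)) => x y. Qed.
Lemma yvar_neq0 : (yvar : K) != 0.
Proof. by apply: (rep_neq0 pos_dense (rep_y pos_dense)) => x y. Qed.

Lemma ratio_laurent (L : fieldType) (n d x y : L) : x != 0 -> y != 0 -> d != 0 ->
  (n / y) / (x * (d / y)) = n / d / x.
Proof. by move=> x0 y0 d0; field; conjs. Qed.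

Definition phi p (b : bool) : K * K := if b then phi2 p else phi1 p.

Lemma phi1E p : admissible p -> phi1 p = (rowFK p yvar / xvar, yvar).
Proof.
move=> A; rewrite /phi1 /C1 /A1 !(xcoefE _ _ yvar_neq0).
have d0 : quad (cst (p 1 1)) (cst (p 1 0)) (cst (p 1 (-1))) (yvar : K) != 0.
  apply: (rep_neq0 pos_dense (rep_quad pos_dense _ _ _ (rep_y pos_dense))) => x y x0 y0.
  exact: topq_gt0.
congr pair.
exact: (@ratio_laurent K (quad (cst (p (-1) 1)) (cst (p (-1) 0)) (cst (p (-1) (-1))) yvar) _ _ _
  xvar_neq0 yvar_neq0 d0).
Qed.

Lemma phi2E p : admissible p -> phi2 p = (xvar, colGK p xvar / yvar).
Proof.
move=> A; rewrite /phi2 /C2 /A2 !(ycoefE _ _ xvar_neq0).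
have d0 : quad (cst (p 1 1)) (cst (p 0 1)) (cst (p (-1) 1)) (xvar : K) != 0.
  apply: (rep_neq0 pos_dense (rep_quad pos_dense _ _ _ (rep_x pos_dense))) => x y x0 y0.
  exact: leftq_gt0.
congr pair.
exact: (@ratio_laurent K (quad (cst (p 1 (-1))) (cst (p 0 (-1))) (cst (p (-1) (-1))) xvar) _ _ _
  yvar_neq0 xvar_neq0 d0).
Qed.

Lemma rep_phi p b : admissible p -> repmap pos (phi p b) (refl p b).
Proof.
move=> A; rewrite /phi; case: b.
  rewrite phi2E //; split; first exact: rep_x pos_dense.
  apply: (rep_div pos_dense) => [||x y //]; last exact: rep_y pos_dense.
  by apply: rep_colG => //; exact: rep_x pos_dense.
rewrite phi1E //; split; last exact: rep_y pos_dense.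
apply: (rep_div pos_dense) => [||x y //]; last exact: rep_x pos_dense.
by apply: rep_rowF => //; exact: rep_y pos_dense.
Qed.

(** A Laurent polynomial that is not zero has a nonzero coefficient, and the
    weights are nonnegative. *)
Lemma coef_adm p : (forall i j, i \in steps -> j \in steps -> 0 <= p i j) ->
  A1 p != 0 -> C1 p != 0 -> A2 p != 0 -> C2 p != 0 -> admissible p.
Proof.
move=> H hA1 hC1 hA2 hC2.
have key (a b c : R) (u : K) : 0 <= a -> 0 <= b -> 0 <= c ->
    quad (cst a) (cst b) (cst c) u / u != 0 -> 0 < a + b + c.
  move=> a0 b0 c0 q0; rewrite ltNge; apply: contraNN q0 => s0; apply/eqP.
  have az : a = 0 by lra.
  have bz : b = 0 by lra.
  have cz : c = 0 by lra.
  by rewrite az bz cz rmorph0 /quad !mul0r !addr0 mul0r.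
have yn := yvar_neq0; have xn := xvar_neq0.
move: hA1 hC1 hA2 hC2; rewrite /A1 /C1 /A2 /C2 !xcoefE // !ycoefE //.
move=> /key k1 /key k2 /key k3 /key k4.
by split=> //; [apply: k1|apply: k2|apply: k3|apply: k4]; apply: H.
Qed.

End Weights.

Section Orbits.
Variable R : realType.
Implicit Types p : weights R.
Local Notation pos := (fun x : R => 0 < x).
Local Notation K := (ratfun (R : fieldType)).

(** The order of the product of the involutions divides m. *)
Definition period p m := forall u, quadrant pos u -> iter m (turn (refl p)) u = u.

Lemma finite_period p : admissible p -> finite_set (walk_group p) -> exists M, period p M.+1.
Proof.
move=> A fin.
exact: (finite_turn (pos_dense R) (fun b => rep_phi b A) (fun b u => @refl_into R p A b u)
  (fun b u => @reflK R p A b u) fin).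
Qed.

Lemma card_walk_group p m : admissible p -> (0 < m)%N -> period p m ->
  (forall j, (0 < j < m)%N -> ~ period p j) -> walk_group p #= `I_(2 * m).
Proof.
move=> A m0 per min.
exact: (card_dihedral (pos_dense R) (fun b => rep_phi b A) (fun b u => @refl_into R p A b u)
  (fun b u => @reflK R p A b u) m0 per min (@refl_id R p A)).
Qed.

Definition turnK p (g : K * K) : K * K :=
  let x := rowFK p g.2 / g.1 in (x, colGK p x / g.2).

Definition orbitK p (n : nat) : K :=
  if odd n then (iter n./2 (turnK p) (xvar, yvar)).2 else (iter n./2 (turnK p) (xvar, yvar)).1.

Definition orbitR p (n : nat) (x y : R) : R :=
  if odd n then (iter n./2 (turn (refl p)) (x, y)).2 else (iter n./2 (turn (refl p)) (x, y)).1.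

Section Admissible.
Variable p : weights R.
Hypothesis A : admissible p.

Lemma iter_turn_gt0 n x y : 0 < x -> 0 < y ->
  quadrant pos (iter n (turn (refl p)) (x, y)).
Proof.
by move=> x0 y0; apply: (turn_into (fun b u => @refl_into R p A b u)); split.
Qed.

Lemma rep_turnK n : repmap pos (iter n (turnK p) (xvar, yvar)) (iter n (turn (refl p))).
Proof.
elim: n => [|n [IH1 IH2]]; first exact: repmap_id (pos_dense R).
have pn x y : 0 < x -> 0 < y -> quadrant pos (iter n (turn (refl p)) (x, y)).
  exact: iter_turn_gt0.
have r1 : rep pos (rowFK p (iter n (turnK p) (xvar, yvar)).2 / (iter n (turnK p) (xvar, yvar)).1)
    (fun x y => (iter n.+1 (turn (refl p)) (x, y)).1).
  apply: (rep_div (pos_dense R)) => [||x y x0 y0]; last by have [] := pn x y x0 y0.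
    by apply: rep_rowF => // x y x0 y0; have [] := pn x y x0 y0.
  exact: IH1.
split; first exact: r1.
apply: (rep_div (pos_dense R)) => [||x y x0 y0]; last by have [] := pn x y x0 y0.
  apply: rep_colG => // x y x0 y0.
  by have [] := iter_turn_gt0 n.+1 x0 y0.
exact: IH2.
Qed.

Lemma rep_orbit n : rep pos (orbitK p n) (orbitR p n).
Proof.
have [h1 h2] := rep_turnK n./2; rewrite /orbitK /orbitR.
by case: (odd n).
Qed.

Lemma orbitR_gt0 n x y : 0 < x -> 0 < y -> 0 < orbitR p n x y.
Proof. by move=> x0 y0; have [h1 h2] := iter_turn_gt0 n./2 x0 y0; rewrite /orbitR; case:
  (odd n). Qed.

(** Unlike in [rep], the denominator only has to be nonzero at the point itself,
    which may lie outside the quadrant. *)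
Definition at_point (x0 y0 : R) (h : K) (c : R) := exists n d : {mpoly (R : fieldType)[2]},
  [/\ ev2 d x0 y0 != 0, h = tofrac n / tofrac d & c = ev2 n x0 y0 / ev2 d x0 y0].

Lemma ev2_den (d : {mpoly (R : fieldType)[2]}) (x0 y0 : R) : ev2 d x0 y0 != 0 -> tofrac d != 0.
Proof. by move=> h; rewrite tofrac_eq0; apply: contraNneq h => ->; rewrite /ev2 meval0. Qed.

Lemma at_point_poly x0 y0 (q : {mpoly (R : fieldType)[2]}) :
  at_point x0 y0 (tofrac q) (ev2 q x0 y0).
Proof.
exists q, 1; rewrite /ev2 meval1 oner_eq0 tofrac1; split=> //; last by rewrite divr1.
by rewrite divr1.
Qed.

(** Only fractions with a nonvanishing denominator at the point occur, so the
    values do not depend on the chosen fraction. *)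
Lemma at_point_place x0 y0 : is_place (cst : {rmorphism R -> K}) (at_point x0 y0).
Proof.
split.
- move=> a; have := at_point_poly x0 y0 a%:MP; by rewrite /ev2 mevalC.
- move=> u v a b [n [d [d0 -> ->]]] [n' [d' [d0' -> ->]]].
  exists (n * d' + n' * d), (d * d'); split.
  + by rewrite /ev2 mevalM mulf_neq0.
  + by rewrite tofracD 3!tofracM; exact:
    (add_fracs (tofrac n) (tofrac n') (ev2_den d0) (ev2_den d0')).
  + by rewrite /ev2 mevalD 3!mevalM; exact: add_fracs.
- move=> u v a b [n [d [d0 -> ->]]] [n' [d' [d0' -> ->]]].
  exists (n * n'), (d * d'); split.
  + by rewrite /ev2 mevalM mulf_neq0.
  + by rewrite 2!tofracM; exact: (mul_fracs (tofrac n) (tofrac d) (tofrac n') (tofrac d')).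
  + by rewrite /ev2 2!mevalM; exact: mul_fracs.
- move=> u a [n [d [d0 -> ->]]]; rewrite mulf_eq0 invr_eq0 (negbTE d0) orbF => n0.
  by exists d, n; rewrite !invf_div.
- move=> u a b [n [d [d0 -> ->]]] [n' [d' [d0' E ->]]].
  have E' := (frac_cross (tofrac n) (tofrac n') (ev2_den d0) (ev2_den d0')).1 E.
  have : n * d' = n' * d by apply/eqP; rewrite -tofrac_eq 2!tofracM; apply/eqP.
  move/(congr1 (fun q => ev2 q x0 y0)); rewrite /ev2 2!mevalM => H.
  exact: (frac_cross (ev2 n x0 y0) (ev2 n' x0 y0) d0 d0').2 H.
Qed.

(** The generic point has coordinates the two variables, and evaluation at a
    point of the plane is a place. *)
Lemma orbitK_orbit m : period p m ->
  orbit (cst : {rmorphism R -> K}) (rowFK p) (colGK p) m (orbitK p).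
Proof.
move=> per; split.
- move=> n; rewrite /orbitK /= odd_double doubleK /= uphalf_double //.
- move=> n; rewrite /orbitK /= odd_double doubleK /= uphalf_double //.
- move=> n a b c a0 b0 c0 s0.
  apply: (rep_neq0 (pos_dense R) (rep_quad (pos_dense R) a b c (rep_orbit n))) => x y x0 y0.
  by apply: quad_gt0 => //; apply: orbitR_gt0.
- move=> n; apply/(rep_inj (pos_dense R) (rep_orbit _) (rep_orbit _)) => x y x0 y0.
  rewrite /orbitR oddD odd_double addbF halfD odd_double andbF doubleK add0n iterD.
  by rewrite per.
- move=> x y; exists (at_point x y); split; first exact: at_point_place.
    by have := at_point_poly x y 'X_(ord0 : 'I_2); rewrite /ev2 mevalXU.
  by have := at_point_poly x y 'X_(ord_max : 'I_2); rewrite /ev2 mevalXU.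
Qed.

Lemma rep_sub_sign h fn g (q : {mpoly (R : fieldType)[2]}) : rep pos h fn ->
  (forall x y, ev2 q x y = g x y) -> signed (fun x y => fn x y - g x y).
Proof.
move=> [n [d [d0 _ fnE]]] qE.
have E x y : 0 < x -> 0 < y -> fn x y - g x y = ev2 (n - q * d) x y / ev2 d x y.
  move=> x0 y0; rewrite -qE fnE // /ev2 mevalB mevalM -!/(ev2 _ _ _) mulrBl mulfK //.
  by apply: lt0r_neq0; exact: d0.
case: (ev2_sign (n - q * d)) => [E0|[H|H]].
- by constructor 1 => x y x0 y0; rewrite E // E0 /ev2 meval0 mul0r.
- constructor 2; apply: evt_mono H _ => x y x1 y1 H.
  have x0 : 0 < x := lt_le_trans ltr01 x1; have y0 : 0 < y := lt_le_trans ltr01 y1.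
  by rewrite E // divr_gt0 //; exact: d0.
- constructor 3; apply: evt_mono H _ => x y x1 y1 H.
  have x0 : 0 < x := lt_le_trans ltr01 x1; have y0 : 0 < y := lt_le_trans ltr01 y1.
  by rewrite E // pmulr_llt0 // invr_gt0; exact: d0.
Qed.

(* exponents of F and G at infinity and at 0 *)
Definition Ftop := topdeg (p (-1) 1) (p (-1) 0) - topdeg (p 1 1) (p 1 0).
Definition Flow := lowdeg (p (-1) 0) (p (-1) (-1)) - lowdeg (p 1 0) (p 1 (-1)).
Definition Gtop := topdeg (p 1 (-1)) (p 0 (-1)) - topdeg (p 1 1) (p 0 1).
Definition Glow := lowdeg (p 0 (-1)) (p (-1) (-1)) - lowdeg (p 0 1) (p (-1) 1).

Lemma walk_period_of_exponents m M : exponents_return Ftop Flow Gtop Glow m (1, 0) (0, 1) ->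
  period p M.+1 -> period p m.
Proof.
move=> T per.
have p0 := @adm_ge0 R p A.
have eF : expo (rowF p) Ftop Flow.
  by apply: expo_div; apply: expo_quad; rewrite ?p0 //; [exact: adm_bot|exact: adm_top].
have eG : expo (colG p) Gtop Glow.
  by apply: expo_div; apply: expo_quad; rewrite ?p0 //; [exact: adm_right|exact: adm_left].
apply: (period_of_exponents eF eG T per) => n.
  apply: (rep_sub_sign (q := 'X_(ord0 : 'I_2)) (rep_turnK n).1) => x y.
  by rewrite /ev2 mevalXU.
apply: (rep_sub_sign (q := 'X_(ord_max : 'I_2)) (rep_turnK n).2) => x y.
by rewrite /ev2 mevalXU.
Qed.

End Admissible.
End Orbits.

(** * Symmetries of the square *)

Section Symmetry.
Variable R : realType.
Implicit Types p q : weights R.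
Local Notation pos := (fun x : R => 0 < x).

Definition flip_rows p : weights R := fun i j => p (- i) j.
Definition flip_cols p : weights R := fun i j => p i (- j).
Definition transpose p : weights R := fun i j => p j i.

(** The symmetries of the square conjugate the turn by a map of the quadrant. *)
Lemma period_conj p q (s s' : R * R -> R * R) m :
  admissible p ->
  (forall u, quadrant pos u -> quadrant pos (s u)) ->
  (forall u, quadrant pos u -> quadrant pos (s' u)) ->
  (forall u, quadrant pos u -> s (s' u) = u) ->
  (forall u, quadrant pos u -> s' (s u) = u) ->
  (forall u, quadrant pos u -> turn (refl q) u = s (turn (refl p) (s' u))) ->
  period p m -> period q m.
Proof.
move=> A s_in s'_in ss' s's E per u qu; rewrite -[RHS]ss' // -(per (s' u)); last exact: s'_in.
elim: m {per} => [|m IH]; first by rewrite /= ss'.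
have qm : quadrant pos (iter m (turn (refl p)) (s' u)).
  have := s'_in u qu; case: (s' u) => x y [x0 y0]; exact: iter_turn_gt0.
by rewrite !iterS IH E ?s's //; apply: s_in.
Qed.

Lemma admissible_rows p : admissible p -> admissible (flip_rows p).
Proof.
move=> [p0 h1 h2 h3 h4]; split; rewrite /flip_rows ?opprK ?oppr0 //; try lra.
by move=> i j iS jS; apply: p0 => //; move: iS; rewrite !inE => /or3P [] /eqP ->;
  rewrite ?opprK ?oppr0 ?eqxx ?orbT.
Qed.

Lemma admissible_cols p : admissible p -> admissible (flip_cols p).
Proof.
move=> [p0 h1 h2 h3 h4]; split; rewrite /flip_cols ?opprK ?oppr0 //; try lra.
by move=> i j iS jS; apply: p0 => //; move: jS; rewrite !inE => /or3P [] /eqP ->;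
  rewrite ?opprK ?oppr0 ?eqxx ?orbT.
Qed.

Lemma admissible_tr p : admissible p -> admissible (transpose p).
Proof.
move=> [p0 h1 h2 h3 h4]; split; rewrite /transpose //.
by move=> i j iS jS; apply: p0.
Qed.

Lemma quad_rev (a b c v : R) : v != 0 -> quad c b a v^-1 = quad a b c v / v ^+ 2.
Proof. by move=> v0; rewrite /quad; field. Qed.

(** Reversing the rows amounts to replacing x by its inverse. *)
Lemma period_rows p m : admissible p -> period p m -> period (flip_rows p) m.
Proof.
move=> A; pose s (u : R * R) := (u.1^-1, u.2).
have s_in u : quadrant pos u -> quadrant pos (s u).
  by move=> [u1 u2]; split=> //=; rewrite invr_gt0.
have ss u : s (s u) = u by case: u => x y; rewrite /s /= invrK.
apply: (period_conj (s := s) (s' := s)) => // -[x y] [/= x0 y0].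
have eF v : rowF (flip_rows p) v = (rowF p v)^-1.
  by rewrite /rowF /flip_rows opprK invf_div.
have eG v : 0 < v -> colG (flip_rows p) v = colG p v^-1.
  move=> v0; rewrite /colG /flip_rows opprK oppr0 !(quad_rev _ _ _ (lt0r_neq0 v0)).
  by rewrite invf_div mulrA divfK // expf_neq0 // lt0r_neq0.
have F0 := rowF_gt0 A y0; have xn := lt0r_neq0 x0.
rewrite /turn /s /refl /= eF eG; last by rewrite divr_gt0 ?invr_gt0.
have -> : ((rowF p y)^-1 / x)^-1 = rowF p y / x^-1 by rewrite invfM !invrK.
by congr (_, _); rewrite ?invfM ?invrK.
Qed.

(** Transposition exchanges the two involutions, and the two orders of
    composition are conjugate by an involution. *)
Lemma period_tr p m : admissible p -> period p m -> period (transpose p) m.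
Proof.
move=> A; pose sw (u : R * R) := (u.2, u.1).
pose s u := sw (refl p false u); pose s' u := refl p false (sw u).
have sw_in u : quadrant pos u -> quadrant pos (sw u) by move=> [].
have r_in b u := @refl_into R p A b u.
have rK b u := @reflK R p A b u.
have swK u : sw (sw u) = u by case: u.
apply: (period_conj (s := s) (s' := s')) => // u qu.
- by apply: sw_in; apply: r_in.
- by apply: r_in; apply: sw_in.
- by rewrite /s /s' rK ?swK //; apply: sw_in.
- by rewrite /s /s' swK rK.
- rewrite /s /s' /turn rK; last exact: sw_in.
  by case: u qu.
Qed.

(** Reversing the columns is reversing the rows between two transpositions. *)
Lemma period_cols p m : admissible p -> period p m -> period (flip_cols p) m.
Proof.
move=> A /(period_tr A) /(period_rows (admissible_tr A)).
by move/(period_tr (admissible_rows (admissible_tr A))).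
Qed.

Lemma flip_rowsK p : flip_rows (flip_rows p) = p.
Proof. by apply/funext => i; apply/funext => j; rewrite /flip_rows opprK. Qed.
Lemma flip_colsK p : flip_cols (flip_cols p) = p.
Proof. by apply/funext => i; apply/funext => j; rewrite /flip_cols opprK. Qed.
Lemma symmetric_period p q m : symmetric_weights p q ->
  (admissible p <-> admissible q) /\ (admissible p -> period p m <-> period q m).
Proof.
elim=> [//|{}q _ [IH1 IH2]|{}q _ [IH1 IH2]|{}q _ [IH1 IH2]].
- rewrite -/(flip_rows q); split.
    split=> [/IH1|]; first exact: admissible_rows.
    by move/admissible_rows; rewrite flip_rowsK => /IH1.
  move=> A; have B := IH1.1 A; rewrite (IH2 A); split; first exact: period_rows.
  by move/(period_rows (admissible_rows B)); rewrite flip_rowsK.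
- rewrite -/(flip_cols q); split.
    split=> [/IH1|]; first exact: admissible_cols.
    by move/admissible_cols; rewrite flip_colsK => /IH1.
  move=> A; have B := IH1.1 A; rewrite (IH2 A); split; first exact: period_cols.
  by move/(period_cols (admissible_cols B)); rewrite flip_colsK.
- rewrite -/(transpose q); split.
    split=> [/IH1|]; first exact: admissible_tr.
    by move/admissible_tr => /IH1.
  move=> A; have B := IH1.1 A; rewrite (IH2 A); split; first exact: period_tr.
  exact: (period_tr (admissible_tr B)).
Qed.

Lemma symmetric_trans p p' q : symmetric_weights p p' -> symmetric_weights p' q ->
  symmetric_weights p q.
Proof.
move=> H; elim=> // {}q _ IH; [exact: sym_rows|exact: sym_cols|exact: sym_tr].
Qed.

Lemma up_to_rows (P : weights R -> Prop) p : up_to_symmetries P (flip_rows p) ->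
  up_to_symmetries P p.
Proof. by move=> [q H Hq]; exists q => //; apply: symmetric_trans H; apply/sym_rows/sym_refl. Qed.
Lemma up_to_cols (P : weights R -> Prop) p : up_to_symmetries P (flip_cols p) ->
  up_to_symmetries P p.
Proof. by move=> [q H Hq]; exists q => //; apply: symmetric_trans H; apply/sym_cols/sym_refl. Qed.
Lemma up_to_tr (P : weights R -> Prop) p : up_to_symmetries P (transpose p) -> up_to_symmetries P p.
Proof. by move=> [q H Hq]; exists q => //; apply: symmetric_trans H; apply/sym_tr/sym_refl. Qed.

End Symmetry.

(** * Walks of order four and walks in a half plane *)

Section Real.
Variable R : realType.
Implicit Types p q : weights R.
Local Notation pos := (fun x : R => 0 < x).

Definition rows_proportional p := [/\ p 1 1 * p (-1) 0 = p 1 0 * p (-1) 1,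
  p 1 1 * p (-1) (-1) = p 1 (-1) * p (-1) 1 & p 1 0 * p (-1) (-1) = p 1 (-1) * p (-1) 0].
Definition cols_proportional p := rows_proportional (transpose p).

Lemma trinomial_eq0 (a b c : R) : (forall w, 0 < w -> quad a b c w = 0) ->
  [/\ a = 0, b = 0 & c = 0].
Proof.
move=> H; have h1 := H 1 ltr01; have h2 := H 2 (ltr0n _ 2); have h3 := H 3 (ltr0n _ 3).
by move: h1 h2 h3; rewrite /quad => h1 h2 h3; split; lra.
Qed.

(** Period 2 means F(G(u) / y) = F(y) for all u and y. Either G is constant, or
    F is invariant under a scaling by some r different from 1 and is then
    constant. A quotient of trinomials is constant iff their coefficients are
    proportional. *)
Lemma period2_proportional p : admissible p -> period p 2 ->
  rows_proportional p \/ cols_proportional p.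
Proof.
move=> A per.
have FG u y : 0 < u -> 0 < y -> rowF p (colG p u / y) = rowF p y.
  move=> u0 y0; have F0 := rowF_gt0 A y0; have G0 := colG_gt0 A u0.
  have x0 : 0 < rowF p y / u by apply: divr_gt0.
  have := per (rowF p y / u, y) (conj x0 y0).
  rewrite /= /turn /refl /= => -[].
  have -> : rowF p y / (rowF p y / u) = u by field; rewrite !lt0r_neq0.
  move=> + _; have F1 := rowF_gt0 A (divr_gt0 G0 y0) => E.
  have -> : rowF p (colG p u / y) = (rowF p (colG p u / y) / u) * u by field; exact: lt0r_neq0.
  by rewrite E divfK // lt0r_neq0.
case: (pselect (forall u, 0 < u -> colG p u = colG p 1)) => [Gc|].
  right; rewrite /cols_proportional /rows_proportional /transpose.
  have n0 := rightq_gt0 A ltr01; have d0 := leftq_gt0 A ltr01.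
  have [n nE] := named (quad (p 1 (-1)) (p 0 (-1)) (p (-1) (-1)) 1).
  have [d dE] := named (quad (p 1 1) (p 0 1) (p (-1) 1) 1).
  rewrite -nE -dE in n0 d0.
  have [h1 h2 h3] : [/\ p 1 (-1) * d - n * p 1 1 = 0,
    p 0 (-1) * d - n * p 0 1 = 0 & p (-1) (-1) * d - n * p (-1) 1 = 0].
    apply: trinomial_eq0 => w w0; have := Gc w w0; rewrite /colG -nE -dE.
    have l0 := leftq_gt0 A w0.
    move/eqP; rewrite eqr_div ?lt0r_neq0 // /quad => /eqP; lra.
  have dn := lt0r_neq0 d0.
  have {}h1 := subr0_eq h1; have {}h2 := subr0_eq h2; have {}h3 := subr0_eq h3.
  have key (a b c e : R) : c * d = n * a -> e * d = n * b -> a * e = b * c.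
    move=> E1 E2; apply: (mulIf dn); rewrite -!mulrA E1 E2; ring.
  by split; apply: key.
move=> /existsNP [u /not_implyP [u0 /eqP Gu]]; left.
have G0 := colG_gt0 A u0; have G1 := colG_gt0 A ltr01.
have [r rE] := named (colG p u / colG p 1).
have r0 : 0 < r by rewrite rE divr_gt0.
have r1 : r - 1 != 0.
  rewrite subr_eq0; apply: contra Gu => /eqP r1.
  by rewrite -[colG p u](divfK (lt0r_neq0 G1)) -rE r1 mul1r.
have Fr w : 0 < w -> rowF p (r * w) = rowF p w.
  move=> w0; have y0 : 0 < colG p 1 / w by apply: divr_gt0.
  have E1 := FG u _ u0 y0; have E2 := FG 1 _ ltr01 y0.
  have -> : r * w = colG p u / (colG p 1 / w) by rewrite rE; field; rewrite !lt0r_neq0.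
  rewrite E1 -E2; congr (rowF p _); by field; rewrite !lt0r_neq0.
have [h1 h2 h3] : [/\ (r - 1) * (r * (p (-1) 1 * p 1 0 - p 1 1 * p (-1) 0)) = 0,
   (r - 1) * ((r + 1) * (p (-1) 1 * p 1 (-1) - p 1 1 * p (-1) (-1))) = 0
   & (r - 1) * (p (-1) 0 * p 1 (-1) - p 1 0 * p (-1) (-1)) = 0].
  apply: trinomial_eq0 => w w0; have := Fr w w0; rewrite /rowF.
  have t0 := topq_gt0 A w0; have t1 := topq_gt0 A (mulr_gt0 r0 w0).
  move/eqP; rewrite eqr_div ?lt0r_neq0 // => /eqP E.
  apply: (mulIf (lt0r_neq0 w0)); rewrite mul0r.
  move/eqP: E; rewrite -subr_eq0 => /eqP <-.
  by rewrite /quad; ring.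
move/eqP: h1; rewrite !mulf_eq0 (negbTE r1) (gt_eqF r0) /= subr_eq0 => /eqP h1.
have r2 : 0 < r + 1 by rewrite addr_gt0.
move/eqP: h2; rewrite !mulf_eq0 (negbTE r1) (gt_eqF r2) /= subr_eq0 => /eqP h2.
move/eqP: h3; rewrite !mulf_eq0 (negbTE r1) /= subr_eq0 => /eqP h3.
by split; [rewrite -h1 mulrC|rewrite -h2 mulrC|rewrite -h3 mulrC].
Qed.

(** F is then a constant k, and G(k / x) = G(x) by the proportionality of the
    outer coefficients. *)
Lemma rows_period2 p : admissible p -> rows_proportional p -> period p 2.
Proof.
move=> A [h1 h2 h3] [x y] [/= x0 y0].
have t0 := adm_top A; have b0 := adm_bot A.
have [k kE] := named ((p (-1) 1 + p (-1) 0 + p (-1) (-1)) / (p 1 1 + p 1 0 + p 1 (-1))).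
have k0 : 0 < k by rewrite kE divr_gt0.
have tn := lt0r_neq0 t0.
have fE : p (-1) 1 = k * p 1 1.
  rewrite kE mulrAC; apply: (canRL (mulfK tn)); lra.
have gE : p (-1) 0 = k * p 1 0.
  rewrite kE mulrAC; apply: (canRL (mulfK tn)); lra.
have hE : p (-1) (-1) = k * p 1 (-1).
  rewrite kE mulrAC; apply: (canRL (mulfK tn)); lra.
have Fk v : 0 < v -> rowF p v = k.
  move=> v0; rewrite /rowF; apply: (canLR (mulfK (lt0r_neq0 (topq_gt0 A v0)))).
  by rewrite fE gE hE /quad; ring.
have Gk u : 0 < u -> colG p (k / u) = colG p u.
  move=> u0; rewrite /colG.
  have n := lt0r_neq0 u0; have m := lt0r_neq0 k0.
  have l0 := lt0r_neq0 (leftq_gt0 A u0).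
  have l1 := lt0r_neq0 (leftq_gt0 A (divr_gt0 k0 u0)).
  apply/eqP; rewrite eqr_div //; apply/eqP; rewrite fE hE /quad; field; exact: n.
have x1 : 0 < k / x by apply: divr_gt0.
have G1 := colG_gt0 A x1.
rewrite /= /turn /refl /= (Fk y y0) (Fk _ (divr_gt0 G1 y0)).
have -> : k / (k / x) = x by field; rewrite !lt0r_neq0.
have Gn := lt0r_neq0 (colG_gt0 A x0); have yn := lt0r_neq0 y0.
by rewrite Gk //; congr (_, _); field; conjs.
Qed.

Lemma proportional_period2 p : admissible p ->
  rows_proportional p \/ cols_proportional p -> period p 2.
Proof.
move=> A [|H]; first exact: rows_period2.
exact: (period_tr (admissible_tr A) (rows_period2 (admissible_tr A) H)).
Qed.

(** All steps lie in the half plane i + j <= 0. The cone y >= L x is then stable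
    under the turn, and the first coordinate increases strictly on it. *)
Lemma half_plane_aperiodic p M : admissible p -> p 1 1 = 0 -> p 1 0 = 0 -> p 0 1 = 0 ->
  0 < p 1 (-1) -> 0 < p (-1) 1 -> ~ period p M.+1.
Proof.
move=> A a0 b0 d0 c0 f0 per.
have p0 := @adm_ge0 R p A.
have [L LE] := named (2 + p 1 (-1) / p (-1) 1).
have cf0 : 0 < p 1 (-1) / p (-1) 1 by apply: divr_gt0.
have L2 : 2 <= L by rewrite LE lerDl ltW.
have fL : p 1 (-1) <= p (-1) 1 * L.
  rewrite LE mulrDr (_ : p (-1) 1 * (p 1 (-1) / p (-1) 1) = p 1 (-1)); first by lra.
  by field; exact: lt0r_neq0.
have cn := lt0r_neq0 c0; have fn := lt0r_neq0 f0.
pose good (u : R * R) := quadrant pos u /\ L * u.1 <= u.2.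
have step u : good u -> good (turn (refl p) u) /\ u.1 < (turn (refl p) u).1.
  case: u => x y [[/= x0 y0] yx].
  have q : quadrant pos (turn (refl p) (x, y)) by exact: (iter_turn_gt0 A 1 x0 y0).
  have [X XE] := named (rowF p y / x).
  have X0 : 0 < X by rewrite XE divr_gt0 // rowF_gt0.
  have tE : turn (refl p) (x, y) = (X, colG p X / y) by rewrite /turn /refl /= -XE.
  have XL : p (-1) 1 * L * y <= p 1 (-1) * X.
    have -> : p 1 (-1) * X = quad (p (-1) 1) (p (-1) 0) (p (-1) (-1)) y / x.
      have xn := lt0r_neq0 x0.
      by rewrite XE /rowF a0 b0 /quad; field; conjs.
    rewrite ler_pdivlMr // /quad.
    have h1 : 0 <= p (-1) 0 * y by rewrite mulr_ge0 ?p0 ?(ltW y0).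
    have h2 : 0 <= p (-1) (-1) by rewrite p0.
    have h3 : 0 <= p (-1) 1 * y * (y - L * x) by rewrite mulr_ge0 ?subr_ge0 // mulr_ge0 ?ltW.
    by lra.
  have yX : y <= X.
    rewrite -(ler_pM2l c0); apply: le_trans XL.
    by rewrite ler_pM2r.
  have xX : x < X.
    apply: lt_le_trans yX; apply: lt_le_trans yx.
    have h : 2 * x <= L * x by rewrite ler_pM2r.
    by lra.
  rewrite -XE tE; rewrite tE in q; split=> //; split=> //=.
  have -> : colG p X / y = quad (p 1 (-1)) (p 0 (-1)) (p (-1) (-1)) X / (p (-1) 1 * y).
    have yn := lt0r_neq0 y0.
    by rewrite /colG a0 d0 /quad; field; conjs.
  rewrite ler_pdivlMr ?mulr_gt0 // /quad.
  have h1 : 0 <= p 0 (-1) * X by rewrite mulr_ge0 ?p0 ?(ltW X0).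
  have h2 : 0 <= p (-1) (-1) by rewrite p0.
  have h3 : 0 <= X * (p 1 (-1) * X - p (-1) 1 * L * y).
    by rewrite mulr_ge0 ?(ltW X0) // subr_ge0.
  by lra.
have g1 : good (1, L) by split; rewrite /= ?mulr1 //; split=> //=; lra.
have all n : good (iter n (turn (refl p)) (1, L)).
  by elim: n => // n IH; exact: (step _ IH).1.
have mon n : (1 : R) < (iter n.+1 (turn (refl p)) (1, L)).1.
  elim: n => [|n IH]; first exact: (step _ g1).2.
  by apply: lt_trans IH _; exact: (step _ (all n.+1)).2.
by have := mon M; rewrite per ?ltxx //; case: g1.
Qed.

End Real.

(** * The listed forms have the stated periods *)

Section Forms.
Variable R : realType.
Implicit Types p q : weights R.
Local Notation pos := (fun x : R => 0 < x).

Lemma mx33P (a1 a2 a3 b1 b2 b3 c1 c2 c3 a1' a2' a3' b1' b2' b3' c1' c2' c3' : R) :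
  mx_of_rows 3 3 [:: [:: a1; a2; a3]; [:: b1; b2; b3]; [:: c1; c2; c3]] =
  mx_of_rows 3 3 [:: [:: a1'; a2'; a3']; [:: b1'; b2'; b3']; [:: c1'; c2'; c3']] <->
  [/\ [/\ a1 = a1', a2 = a2' & a3 = a3'], [/\ b1 = b1', b2 = b2' & b3 = b3']
    & [/\ c1 = c1', c2 = c2' & c3 = c3']].
Proof.
split=> [/matrixP E|[[-> -> ->] [-> -> ->] [-> -> ->]] //].
by do 2!split; [have := E ord0 ord0|have := E ord0 1|have := E ord0 ord_max|
  have := E 1 ord0|have := E 1 1|have := E 1 ord_max|
  have := E ord_max ord0|have := E ord_max 1|have := E ord_max ord_max]; rewrite !mxE.
Qed.

Lemma mx33Z (k a1 a2 a3 b1 b2 b3 c1 c2 c3 : R) :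
  k *: mx_of_rows 3 3 [:: [:: a1; a2; a3]; [:: b1; b2; b3]; [:: c1; c2; c3]] =
  mx_of_rows 3 3 [:: [:: k * a1; k * a2; k * a3]; [:: k * b1; k * b2; k * b3];
                     [:: k * c1; k * c2; k * c3]].
Proof.
by apply/matrixP => [[[|[|[|i]]] Hi]] // [[|[|[|j]]] Hj] //; rewrite !mxE.
Qed.

Lemma det_mx22 (a b c d : R) : \det (mx_of_rows 2 2 [:: [:: a; b]; [:: c; d]]) = a * d - b * c.
Proof.
rewrite (expand_det_row _ ord0) !big_ord_recl big_ord0 /cofactor !det_mx11 !mxE /=.
by rewrite expr0 expr1; ring.
Qed.

Lemma det_mx33 (a1 a2 a3 b1 b2 b3 c1 c2 c3 : R) :
  \det (mx_of_rows 3 3 [:: [:: a1; a2; a3]; [:: b1; b2; b3]; [:: c1; c2; c3]]) =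
  a1 * (b2 * c3 - b3 * c2) - a2 * (b1 * c3 - b3 * c1) + a3 * (b1 * c2 - b2 * c1).
Proof.
rewrite (expand_det_row _ ord0) !big_ord_recl big_ord0 /cofactor.
rewrite !(expand_det_row _ ord0) !big_ord_recl !big_ord0 /cofactor !det_mx11 !mxE /=.
by rewrite /bump /= !(expr0, expr1) /= ?expr2; ring.
Qed.

(** With u = p_10 p_-11 - p_11 p_-10 and v = p_1-1 p_-10 - p_10 p_-1-1, the
    vanishing of the two determinants says that each row is orthogonal to (v, 0,
    u) in its outer entries: either u = v = 0 and the extreme rows are
    proportional, or the outer columns are. *)
Lemma case_a_proportional p : admissible p ->
  case_a p <-> rows_proportional p \/ cols_proportional p.
Proof.
move=> A; rewrite /case_a /Pinf det_mx22 det_mx33 /cols_proportional /rows_proportional /transpose.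
move: (p 1 1) (p 1 0) (p 1 (-1)) (p 0 1) (p 0 0) (p 0 (-1)) (p (-1) 1) (p (-1) 0) (p (-1) (-1))
  => a b c d o e f g h.
split=> [[E1 E2]|[[h1 h2 h3]|[h1 h2 h3]]]; last 2 first.
- split; first by lra.
  have -> : a * (o * h - e * g) - b * (d * h - e * f) + c * (d * g - o * f) =
    o * (a * h - c * f) + e * (b * f - a * g) + d * (c * g - b * h) by ring.
  by rewrite h1 h2 h3 !subrr !mulr0 !addr0.
- split; first by lra.
  have -> : a * (o * h - e * g) - b * (d * h - e * f) + c * (d * g - o * f) =
    o * (a * h - f * c) + g * (d * c - a * e) + b * (f * e - d * h) by ring.
  by rewrite h1 h2 h3 !subrr !mulr0 !addr0.
have ah : a * h = c * f by lra.
pose u := b * f - a * g; pose v := c * g - b * h.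
have k1 : c * u + a * v = 0.
  have -> : c * u + a * v = b * (c * f - a * h) by rewrite /u /v; ring.
  by rewrite ah subrr mulr0.
have k2 : h * u + f * v = 0.
  have -> : h * u + f * v = g * (c * f - a * h) by rewrite /u /v; ring.
  by rewrite ah subrr mulr0.
have k3 : e * u + d * v = 0.
  move: E2; have -> : a * (o * h - e * g) - b * (d * h - e * f) + c * (d * g - o * f) =
    o * (a * h - c * f) + (e * u + d * v) by rewrite /u /v; ring.
  by rewrite ah subrr mulr0 add0r.
case: (eqVneq u 0) => [u0|u0].
  case: (eqVneq v 0) => [v0|v0].
    by left; split=> //; move: u0 v0; rewrite /u /v => u0 v0; lra.
  move: k1 k2 k3; rewrite u0 !mulr0 !add0r => /eqP; rewrite mulf_eq0 (negbTE v0) orbF => /eqP az.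
  move=> /eqP; rewrite mulf_eq0 (negbTE v0) orbF => /eqP fz /eqP.
  rewrite mulf_eq0 (negbTE v0) orbF => /eqP dz.
  by right; rewrite az fz dz !mul0r.
right.
have hk (r s : R) : r * u + s * v = 0 -> r = s * (- v / u).
  move=> rs; apply: (mulIf u0); rewrite -mulrA divfK //; lra.
by rewrite (hk _ _ k1) (hk _ _ k2) (hk _ _ k3); split; ring.
Qed.

Lemma case_a_paramP p : admissible p -> case_a p <-> case_a_param p.
Proof.
move=> A; rewrite case_a_proportional //; split.
  move=> [[h1 h2 h3]|[h1 h2 h3]].
    have t0 := adm_top A; have tn := lt0r_neq0 t0.
    have [s sE] := named ((p (-1) 1 + p (-1) 0 + p (-1) (-1)) / (p 1 1 + p 1 0 + p 1 (-1))).
    exists (p 1 0), (p 1 1), (p 1 (-1)), 1, s; left; apply/mx33P; rewrite !mulr1 sE; split=> //.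
    by split; rewrite mulrA; apply: (canRL (mulfK tn)); lra.
  rewrite /transpose in h1 h2 h3.
  have t0 := adm_left A; have tn := lt0r_neq0 t0.
  have [s sE] := named ((p 1 (-1) + p 0 (-1) + p (-1) (-1)) / (p 1 1 + p 0 1 + p (-1) 1)).
  exists (p 0 1), 1, s, (p 1 1), (p (-1) 1); right; apply/mx33P; rewrite !mul1r sE.
  by split; split=> //; rewrite mulrAC; apply: (canRL (mulfK tn)); lra.
move=> [al [mu [nu [rh [si [|]]]]]] /mx33P [[e1 e2 e3] [e4 e5 e6] [e7 e8 e9]].
  by left; split; rewrite ?e1 ?e2 ?e3 ?e7 ?e8 ?e9; ring.
by right; split; rewrite /transpose ?e1 ?e3 ?e4 ?e6 ?e7 ?e9; ring.
Qed.

Lemma form_b1_eq p : form_b1 p -> [/\ p 1 0 != 0, p 0 (-1) != 0 & p (-1) 1 != 0] /\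
  [/\ [/\ p 1 1 = 0, p 1 (-1) = 0 & p 0 1 = 0] & p (-1) 0 = 0 /\ p (-1) (-1) = 0].
Proof.
move=> [/mx33P [[e1 _ e3] [e4 _ _] [_ e8 e9]]].
by rewrite !mulf_eq0 !negb_or -andbA => /and3P.
Qed.

(** The orbit consists of monomials in x and y. *)
Lemma period3_monomial p al ga : admissible p -> 0 < al -> 0 < ga ->
  (forall y, 0 < y -> rowF p y = al * y) -> (forall x, 0 < x -> colG p x = ga * x) -> period p 3.
Proof.
move=> A a0 g0 FE GE [x y] [/= x0 y0]; rewrite /turn /refl /=.
have [x1 x1E] := named (al * y / x).
have [y1 y1E] := named (ga * al / x).
have [x2 x2E] := named (al * ga / y).
have [y2 y2E] := named (ga * x / y).
have an := lt0r_neq0 a0; have gn := lt0r_neq0 g0; have xn := lt0r_neq0 x0; have yn := lt0r_neq0 y0.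
have p1 : 0 < x1 by rewrite x1E divr_gt0 // mulr_gt0.
have p2 : 0 < y1 by rewrite y1E divr_gt0 // mulr_gt0.
have p3 : 0 < x2 by rewrite x2E divr_gt0 // mulr_gt0.
have p4 : 0 < y2 by rewrite y2E divr_gt0 // mulr_gt0.
rewrite (FE y) // -x1E (GE x1) //.
have -> : ga * x1 / y = y1 by rewrite x1E y1E; field; conjs.
rewrite (FE y1) //; have -> : al * y1 / x1 = x2 by rewrite x1E y1E x2E; field; conjs.
rewrite (GE x2) //; have -> : ga * x2 / y1 = y2 by rewrite y2E y1E x2E; field; conjs.
rewrite (FE y2) //; have -> : al * y2 / x2 = x by rewrite y2E x2E; field; conjs.
by rewrite (GE x) //; congr (_, _); rewrite y2E; field; conjs.
Qed.

Lemma form_b1_period p : admissible p -> form_b1 p -> period p 3.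
Proof.
move=> A /form_b1_eq [[bn en fn] [[a0 c0 d0] [g0 h0]]].
have P0 := @adm_ge0 R p A.
have b0 : 0 < p 1 0 by rewrite lt_neqAle eq_sym bn P0.
have e0 : 0 < p 0 (-1) by rewrite lt_neqAle eq_sym en P0.
have f0 : 0 < p (-1) 1 by rewrite lt_neqAle eq_sym fn P0.
apply: (period3_monomial (al := p (-1) 1 / p 1 0) (ga := p 0 (-1) / p (-1) 1)) => //;
  try exact: divr_gt0.
- by move=> y /lt0r_neq0 y0; rewrite /rowF a0 c0 g0 h0 /quad; field; conjs.
- by move=> x /lt0r_neq0 x0; rewrite /colG a0 c0 d0 h0 /quad; field; conjs.
Qed.

Lemma form_b3_period p : admissible p -> form_b3 p -> period p 3.
Proof.
move=> A [/mx33P [[a0 bE _] [dE _ _] [_ _ h0]]].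
rewrite !mulf_eq0 !negb_or -!andbA => /and4P [cn fn en gn].
have P0 := @adm_ge0 R p A.
have c0 : 0 < p 1 (-1) by rewrite lt_neqAle eq_sym cn P0.
have e0 : 0 < p 0 (-1) by rewrite lt_neqAle eq_sym en P0.
have f0 : 0 < p (-1) 1 by rewrite lt_neqAle eq_sym fn P0.
have g0 : 0 < p (-1) 0 by rewrite lt_neqAle eq_sym gn P0.
apply: (period3_monomial (al := p (-1) 0 / p 1 (-1)) (ga := p 0 (-1) / p (-1) 1)) => //;
  try exact: divr_gt0.
- move=> y y0; apply: (canLR (mulfK (lt0r_neq0 (topq_gt0 A y0)))).
  by rewrite a0 bE h0 /quad; field; conjs.
- move=> x x0; apply: (canLR (mulfK (lt0r_neq0 (leftq_gt0 A x0)))).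
  by rewrite a0 dE h0 /quad; field; conjs.
Qed.

(** F(y) = al (y + be) and G(x) = (be / al) x^2 + t x + be^2. The term z_4 = (be
    (x + z_2) + al t) / y is symmetric in x and z_2, so that from there on the
    orbit runs backward from (x, y). *)
Lemma form_b2_period p : admissible p -> form_b2 p -> period p 3.
Proof.
move=> A [/mx33P [[a0 _ _] [d0 _ _] [_ gE hE]]].
rewrite !mulf_eq0 !negb_or -!andbA => /and3P [bn cn fn].
have P0 := @adm_ge0 R p A.
have b0 : 0 < p 1 0 by rewrite lt_neqAle eq_sym bn P0.
have c0 : 0 < p 1 (-1) by rewrite lt_neqAle eq_sym cn P0.
have f0 : 0 < p (-1) 1 by rewrite lt_neqAle eq_sym fn P0.
have [al alE] := named (p (-1) 1 / p 1 0).
have [be beE] := named (p 1 (-1) / p 1 0).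
have al0 : 0 < al by rewrite alE divr_gt0.
have be0 : 0 < be by rewrite beE divr_gt0.
have an := lt0r_neq0 al0; have ben := lt0r_neq0 be0.
have [t tE] := named (p 0 (-1) / p (-1) 1).
have FE y : 0 < y -> rowF p y = al * (y + be).
  move=> y0; apply: (canLR (mulfK (lt0r_neq0 (topq_gt0 A y0)))).
  by rewrite a0 gE hE alE beE /quad; field; conjs.
have GE x : 0 < x -> colG p x = be / al * x ^+ 2 + t * x + be ^+ 2.
  move=> x0; apply: (canLR (mulfK (lt0r_neq0 (leftq_gt0 A x0)))).
  by rewrite a0 d0 hE alE beE tE /quad; field; conjs.
move=> [x y] [/= x0 y0]; rewrite /turn /refl /=.
have xn := lt0r_neq0 x0; have yn := lt0r_neq0 y0.
have w0 : 0 < y + be by rewrite addr_gt0.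
have wn := lt0r_neq0 w0.
have [x1 x1E] := named (al * (y + be) / x).
have p1 : 0 < x1 by rewrite x1E divr_gt0 // mulr_gt0.
have [y1 y1E] := named ((be / al * x1 ^+ 2 + t * x1 + be ^+ 2) / y).
have t0 : 0 <= t by rewrite tE divr_ge0 // ?P0 // ltW.
have p2 : 0 < y1.
  rewrite y1E divr_gt0 // addr_gt0 ?exprn_gt0 // ltr_wpDr //.
    by rewrite mulr_ge0 // ltW.
  by rewrite mulr_gt0 ?divr_gt0 ?exprn_gt0.
have [x2 x2E] := named (al * (y1 + be) / x1).
have p3 : 0 < x2 by rewrite x2E divr_gt0 // mulr_gt0 // addr_gt0.
have [y2 y2E] := named ((be / al * x2 ^+ 2 + t * x2 + be ^+ 2) / y1).
have x1n := lt0r_neq0 p1; have y1n := lt0r_neq0 p2.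
(* z_4 and z_5 run backwards from (x, y) *)
have y2E' : y2 = (be / al * x ^+ 2 + t * x + be ^+ 2) / y.
  have x2E' : x2 = (be * x1 + t * al + al * be * (be + y) / x1) / y.
    by rewrite x2E y1E; field; conjs.
  have x2E'' : x2 = (be * x1 + t * al + be * x) / y by rewrite x2E' x1E; field; conjs.
  rewrite y2E; apply: (canLR (mulfK y1n)); rewrite x2E'' y1E x1E.
  by field; conjs.
rewrite (FE y) // -x1E (GE x1) // -y1E (FE y1) // -x2E (GE x2) // -y2E.
have p4 : 0 < y2 by rewrite y2E' divr_gt0 // -(GE x) //; exact: colG_gt0.
rewrite (FE y2) //.
have -> : al * (y2 + be) / x2 = x.
  apply: (canLR (mulfK (lt0r_neq0 p3))).
  rewrite y2E' x2E y1E x1E; field; conjs.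
rewrite (GE x) // y2E' -(GE x) //.
by have := colG_gt0 A x0; move: (colG p x) => G0 G0p; have Gn := lt0r_neq0 G0p; congr (_, _);
  field; conjs.
Qed.

(** F(y) = al y and G(x) = be x^2, so the orbit consists of monomials. *)
Lemma form_c_period p : admissible p -> form_c p -> period p 4.
Proof.
move=> A [/mx33P [[a0 _ _] [d0 _ e0] [_ gE h0]]].
rewrite !mulf_eq0 !negb_or -!andbA => /and3P [bn cn fn].
have P0 := @adm_ge0 R p A.
have b0 : 0 < p 1 0 by rewrite lt_neqAle eq_sym bn P0.
have c0 : 0 < p 1 (-1) by rewrite lt_neqAle eq_sym cn P0.
have f0 : 0 < p (-1) 1 by rewrite lt_neqAle eq_sym fn P0.
have [al alE] := named (p (-1) 1 / p 1 0).
have [be beE] := named (p 1 (-1) / p (-1) 1).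
have al0 : 0 < al by rewrite alE divr_gt0.
have be0 : 0 < be by rewrite beE divr_gt0.
have FE y : 0 < y -> rowF p y = al * y.
  move=> y0; apply: (canLR (mulfK (lt0r_neq0 (topq_gt0 A y0)))).
  by rewrite a0 gE h0 alE /quad; field; conjs.
have GE x : 0 < x -> colG p x = be * x ^+ 2.
  move=> x0; apply: (canLR (mulfK (lt0r_neq0 (leftq_gt0 A x0)))).
  by rewrite a0 d0 e0 h0 beE /quad; field; conjs.
move=> [x y] [/= x0 y0]; rewrite /turn /refl /=.
have an := lt0r_neq0 al0; have ben := lt0r_neq0 be0; have xn := lt0r_neq0 x0;
  have yn := lt0r_neq0 y0.
have [x1 x1E] := named (al * y / x).
have p1 : 0 < x1 by rewrite x1E divr_gt0 // mulr_gt0.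
have [y1 y1E] := named (be * al ^+ 2 * y / x ^+ 2).
have p2 : 0 < y1 by rewrite y1E divr_gt0 ?exprn_gt0 // !mulr_gt0 ?exprn_gt0.
have [x2 x2E] := named (be * al ^+ 2 / x).
have p3 : 0 < x2 by rewrite x2E divr_gt0 // mulr_gt0 // exprn_gt0.
have [y2 y2E] := named (be ^+ 2 * al ^+ 2 / y).
have p4 : 0 < y2 by rewrite y2E divr_gt0 // mulr_gt0 // exprn_gt0.
have [x3 x3E] := named (be * al * x / y).
have p5 : 0 < x3 by rewrite x3E divr_gt0 // !mulr_gt0.
have [y3 y3E] := named (be * x ^+ 2 / y).
have p6 : 0 < y3 by rewrite y3E divr_gt0 // mulr_gt0 // exprn_gt0.
rewrite (FE y) // -x1E (GE x1) //.
have -> : be * x1 ^+ 2 / y = y1 by rewrite x1E y1E; field; conjs.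
rewrite (FE y1) //; have -> : al * y1 / x1 = x2 by rewrite x1E y1E x2E; field; conjs.
rewrite (GE x2) //; have -> : be * x2 ^+ 2 / y1 = y2 by rewrite y2E y1E x2E; field; conjs.
rewrite (FE y2) //; have -> : al * y2 / x2 = x3 by rewrite y2E x2E x3E; field; conjs.
rewrite (GE x3) //; have -> : be * x3 ^+ 2 / y2 = y3 by rewrite y2E y3E x3E; field; conjs.
rewrite (FE y3) //; have -> : al * y3 / x3 = x by rewrite y3E x3E; field; conjs.
by rewrite (GE x) //; congr (_, _); rewrite y3E; field; conjs.
Qed.

(** In the coordinates X = (s / r) x and Y = s r y the sequence satisfies z'' z
    = z' + 1, which has period 5. *)
Lemma form_d_period p : admissible p -> form_d p -> period p 5.
Proof.
move=> A [s [r [t [s0 r0 _]]]] /=; rewrite mx33Z mulr0.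
have sn := lt0r_neq0 s0; have rn := lt0r_neq0 r0.
move: (_^-1) => k /mx33P [[aE bE cE] [dE _ eE] [fE gE hE]].
have kn : k != 0.
  by apply: contraTneq (adm_top A) => k0; rewrite aE bE cE k0 !mul0r !addr0 ltxx.
have FE Y : 0 < Y -> rowF p (Y / (s * r)) = r ^+ 2 / s ^+ 2 * (Y + 1).
  move=> Y0; apply: (canLR (mulfK (lt0r_neq0 (topq_gt0 A _))));
    first by rewrite divr_gt0 // mulr_gt0.
  by rewrite aE bE cE fE gE hE /quad; field; conjs.
have GE X : 0 < X -> colG p (r / s * X) = (X + 1) / (s ^+ 2 * r ^+ 2).
  move=> X0; apply: (canLR (mulfK (lt0r_neq0 (leftq_gt0 A _))));
    first by rewrite mulr_gt0 // divr_gt0.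
  by rewrite aE cE dE eE fE hE /quad; field; conjs.
(* in the coordinates X, Y the turn is two steps of the recurrence z'' z = z' + 1 *)
have step X Y Z T : 0 < X -> 0 < Y -> Z * X = Y + 1 -> T * Y = Z + 1 ->
    turn (refl p) (r / s * X, Y / (s * r)) = (r / s * Z, T / (s * r)).
  move=> X0 Y0 ZX TY.
  have Xn := lt0r_neq0 X0; have Yn := lt0r_neq0 Y0.
  have Y1 : 0 < Y + 1 by rewrite addr_gt0.
  have ZE : Z = (Y + 1) / X by rewrite -ZX mulfK.
  have Z0 : 0 < Z by rewrite ZE divr_gt0.
  have TE : T = (Z + 1) / Y by rewrite -TY mulfK.
  rewrite /turn /refl /= FE // (_ : _ / _ = r / s * Z); last by rewrite ZE; field; conjs.
  by rewrite GE // TE; congr (_, _); field; conjs.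
move=> [x y] [/= x0 y0].
have [X XE] := named (s * x / r).
have [Y YE] := named (s * r * y).
have X0 : 0 < X by rewrite XE divr_gt0 // mulr_gt0.
have Y0 : 0 < Y by rewrite YE !mulr_gt0.
have -> : x = r / s * X by rewrite XE; field; conjs.
have -> : y = Y / (s * r) by rewrite YE; field; conjs.
have Xn := lt0r_neq0 X0; have Yn := lt0r_neq0 Y0.
have X1 : 0 < X + 1 by rewrite addr_gt0.
have Y1 : 0 < Y + 1 by rewrite addr_gt0.
have XY : 0 < X + Y + 1 by rewrite addr_gt0 // addr_gt0.
rewrite (step X Y ((Y + 1) / X) ((X + Y + 1) / (X * Y))) //; try by field; conjs.
rewrite (step _ _ ((X + 1) / Y) X) //; try by field; conjs.
- rewrite (step _ _ Y ((Y + 1) / X)) //; try by field; conjs.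
    rewrite (step _ _ ((X + Y + 1) / (X * Y)) ((X + 1) / Y)) //; try by field; conjs.
      rewrite (step _ _ X Y) //; try by field; conjs.
        by rewrite divr_gt0 // mulr_gt0.
      by rewrite divr_gt0.
    by rewrite divr_gt0.
  by rewrite divr_gt0.
- by rewrite divr_gt0.
- by rewrite divr_gt0 // mulr_gt0.
Qed.

End Forms.

(** * Walks with a periodic orbit *)

(** Reads the exponents of F and G off the hypotheses on the weights and runs
    the recurrence. *)
Ltac degrees := rewrite /Ftop /Flow /Gtop /Glow /topdeg /lowdeg;
  repeat match goal with
  | H : ?x = 0 |- context [?x != 0] => rewrite H eqxx
  | H : is_true (0 < ?x) |- context [?x != 0] => rewrite (lt0r_neq0 H)
  end; by [].

Section Classification.
Variable R : realType.
Implicit Types p q : weights R.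

(** The parameter Z of the form of order 10 normalizes the weights, so their sum
    has to be carried along. *)
Definition total p := p 1 1 + p 1 0 + p 1 (-1) + p 0 1 + p 0 0 + p 0 (-1)
  + p (-1) 1 + p (-1) 0 + p (-1) (-1).

Record tame p : Prop := Tame {
  tame_adm : admissible p;
  tame_total : total p = 1;
  tame_per : exists M, period p M.+1 }.

(** Order 4 is kept as a property of the turn; it is closed under the symmetries
    without any computation. *)
Definition listed p := [\/ period p 2, case_b p, case_c p | case_d p].

Lemma tame_rows p : tame p -> tame (flip_rows p).
Proof.
move=> [A S [M per]]; split; [exact: admissible_rows| |exists M; exact: period_rows].
by rewrite -S /total /flip_rows !opprK !oppr0; ring.
Qed.

Lemma tame_cols p : tame p -> tame (flip_cols p).
Proof.
move=> [A S [M per]]; split; [exact: admissible_cols| |exists M; exact: period_cols].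
by rewrite -S /total /flip_cols !opprK !oppr0; ring.
Qed.

Lemma tame_tr p : tame p -> tame (transpose p).
Proof.
move=> [A S [M per]]; split; [exact: admissible_tr| |exists M; exact: period_tr].
by rewrite -S /total /transpose; ring.
Qed.

Lemma listed_rows p : admissible p -> listed (flip_rows p) -> listed p.
Proof.
move=> A [H|H|H|H]; [constructor 1|constructor 2|constructor 3|constructor 4]; try exact:
  up_to_rows.
by rewrite -[p]flip_rowsK; apply: period_rows => //; apply: admissible_rows.
Qed.

Lemma listed_cols p : admissible p -> listed (flip_cols p) -> listed p.
Proof.
move=> A [H|H|H|H]; [constructor 1|constructor 2|constructor 3|constructor 4]; try exact:
  up_to_cols.
by rewrite -[p]flip_colsK; apply: period_cols => //; apply: admissible_cols.
Qed.

Lemma listed_tr p : admissible p -> listed (transpose p) -> listed p.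
Proof.
move=> A [H|H|H|H]; [constructor 1|constructor 2|constructor 3|constructor 4]; try exact: up_to_tr.
by apply: (period_tr (p := transpose p)) => //; apply: admissible_tr.
Qed.

Lemma tame_period p m : tame p ->
  exponents_return (Ftop p) (Flow p) (Gtop p) (Glow p) m (1, 0) (0, 1) -> period p m.
Proof. by move=> [A _ [M per]] T; apply: walk_period_of_exponents T per. Qed.

(** The field, the embedding and the sequence are existentially quantified so
    that the relations between the weights are derived without computing with
    actual fractions. *)
Lemma tame_orbit p m : tame p ->
  exponents_return (Ftop p) (Flow p) (Gtop p) (Glow p) m (1, 0) (0, 1) ->
  exists (K : fieldType) (io : {rmorphism R -> K}) (z : nat -> K), orbit io
    (fun u => quad (io (p (-1) 1)) (io (p (-1) 0)) (io (p (-1) (-1))) u /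
              quad (io (p 1 1)) (io (p 1 0)) (io (p 1 (-1))) u)
    (fun u => quad (io (p 1 (-1))) (io (p 0 (-1))) (io (p (-1) (-1))) u /
              quad (io (p 1 1)) (io (p 0 1)) (io (p (-1) 1)) u) m z.
Proof.
move=> Tp T; exists (ratfun (R : fieldType)), (cst : {rmorphism R -> _}), (orbitK p).
exact: (orbitK_orbit (tame_adm Tp) (tame_period Tp T)).
Qed.

Lemma quad_linear_form (b c d f : R) : 0 < b -> 0 < c -> quad d f 0 (- c / b) = 0 -> b * f = c * d.
Proof.
move=> b0 c0; have bn := lt0r_neq0 b0; have cn := lt0r_neq0 c0.
have -> : quad d f 0 (- c / b) = (c * d - b * f) * (c / b ^+ 2) by rewrite /quad; field; conjs.
move/eqP; rewrite mulf_eq0 (negPf (mulf_neq0 cn (invr_neq0 (expf_neq0 2 bn)))) orbF subr_eq0 =>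
  /eqP.
exact: esym.
Qed.

Section Patterns.
Variable p : weights R.
Hypotheses (T : tame p) (a0 : p 1 1 = 0).

(** If F has no pole then neither does G, and the recurrence becomes that of
    [lyness_period5]. *)
Lemma walk_d_cancel : 0 < p 1 0 -> 0 < p 1 (-1) -> 0 < p 0 1 -> 0 < p (-1) 1 -> 0 < p (-1) (-1) ->
  quad (p (-1) 1) (p (-1) 0) (p (-1) (-1)) (- p 1 (-1) / p 1 0) = 0 ->
  quad (p 1 (-1)) (p 0 (-1)) (p (-1) (-1)) (- p (-1) 1 / p 0 1) = 0 /\
  p (-1) (-1) * p 1 0 ^+ 2 = p (-1) 1 * p 1 (-1) ^+ 2.
Proof.
move=> b0 c0 d0 f0 h0 N0.
have [K [io [z O]]] := tame_orbit (m := 5) T ltac:(degrees).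
have e0 : 0 <= p 0 (-1) by exact: (adm_ge0 (tame_adm T)).
rewrite a0 in O; have M0 := orbit_d b0 c0 d0 f0 h0 e0 N0 O.
by split=> //; apply: orbit_d_corner b0 c0 d0 f0 h0 N0 M0 O.
Qed.

Lemma finite_b2 : p 0 1 = 0 ->
  0 < p 1 0 -> 0 < p 1 (-1) -> 0 < p (-1) 1 -> 0 < p (-1) (-1) -> form_b2 p.
Proof.
move=> d0 b0 c0 f0 h0.
have [K [io [z O]]] := tame_orbit (m := 3) T ltac:(degrees).
have e0 : 0 <= p 0 (-1) by exact: (adm_ge0 (tame_adm T)).
rewrite a0 d0 in O; have [gE hE] := orbit_b2 b0 c0 f0 h0 e0 O.
split; last by rewrite !mulf_neq0 // lt0r_neq0.
by apply/mx33P; split; split=> //; rewrite ?gE ?hE.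
Qed.

Lemma finite_b3 : p (-1) (-1) = 0 ->
  0 < p 1 0 -> 0 < p 1 (-1) -> 0 < p 0 1 -> 0 < p 0 (-1) -> 0 < p (-1) 1 -> 0 < p (-1) 0 ->
  p 1 0 * p (-1) 0 = p 1 (-1) * p (-1) 1 -> form_b3 p.
Proof.
move=> h0 b0 c0 d0 e0 f0 g0 bg.
have [K [io [z O]]] := tame_orbit (m := 3) T ltac:(degrees).
rewrite a0 h0 in O.
have de : p 1 (-1) * p (-1) 1 = p 0 1 * p 0 (-1).
  apply: (orbit_b3 b0 c0 d0 e0 f0 _ O).
  have -> : p (-1) 0 = p 1 (-1) * p (-1) 1 / p 1 0 by rewrite -bg; field; exact: lt0r_neq0.
  by rewrite /quad; field; exact: lt0r_neq0.
split; last by rewrite !mulf_neq0 // lt0r_neq0.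
apply/mx33P; split; split=> //.
  by rewrite -bg mulfK // lt0r_neq0.
by rewrite de mulfK // lt0r_neq0.
Qed.

Lemma crossing_b3 : p (-1) (-1) = 0 ->
  0 < p 1 0 -> 0 < p 1 (-1) -> 0 < p 0 1 -> 0 < p 0 (-1) -> 0 < p (-1) 1 -> 0 < p (-1) 0 ->
  p 1 0 * p (-1) 0 = p 1 (-1) * p (-1) 1 \/ p 0 1 * p 0 (-1) = p (-1) 1 * p 1 (-1).
Proof.
move=> h0 b0 c0 d0 e0 f0 g0.
have [K [io [z O]]] := tame_orbit (m := 3) T ltac:(degrees).
rewrite a0 h0 in O.
by have [] := orbit_crossing b0 c0 d0 f0 O isT; [left|right]; apply: quad_linear_form.
Qed.

Lemma crossing_d : 0 < p 1 0 -> 0 < p 1 (-1) -> 0 < p 0 1 -> 0 < p (-1) 1 -> 0 < p (-1) (-1) ->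
  quad (p (-1) 1) (p (-1) 0) (p (-1) (-1)) (- p 1 (-1) / p 1 0) = 0 \/
  quad (p 1 (-1)) (p 0 (-1)) (p (-1) (-1)) (- p (-1) 1 / p 0 1) = 0.
Proof.
move=> b0 c0 d0 f0 h0.
have [K [io [z O]]] := tame_orbit (m := 5) T ltac:(degrees).
by rewrite a0 in O; exact: (orbit_crossing b0 c0 d0 f0 O isT).
Qed.

Lemma finite_c : p 0 1 = 0 -> p 0 (-1) = 0 -> p (-1) (-1) = 0 ->
  0 < p 1 0 -> 0 < p 1 (-1) -> 0 < p (-1) 1 -> 0 < p (-1) 0 -> form_c p.
Proof.
move=> d0 e0 h0 b0 c0 f0 g0.
have [K [io [z O]]] := tame_orbit (m := 4) T ltac:(degrees).
rewrite a0 d0 e0 h0 in O.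
have q0 := divr_gt0 g0 b0.
have bg := orbit_c b0 c0 f0 g0 (lt0r_neq0 (etrans (sqrtr_gt0 _) q0)) (sqr_sqrtr (ltW q0)) O.
split; last by rewrite !mulf_neq0 // lt0r_neq0.
apply/mx33P; split; split=> //.
by rewrite -bg mulrAC mulfV ?mul1r // lt0r_neq0.
Qed.

Lemma infinite_period4 : p 0 1 = 0 -> p (-1) 0 = 0 -> p (-1) (-1) = 0 ->
  0 < p 1 0 -> 0 < p 1 (-1) -> 0 < p (-1) 1 -> 0 < p 0 (-1) -> False.
Proof.
move=> d0 g0 h0 b0 c0 f0 e0.
have [K [io [z O]]] := tame_orbit (m := 4) T ltac:(degrees).
by rewrite a0 d0 g0 h0 in O; exact: (orbit_not4 b0 c0 f0 e0 O).
Qed.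

Lemma infinite_period7_c : p 0 (-1) = 0 -> p (-1) (-1) = 0 ->
  0 < p 1 0 -> 0 < p 1 (-1) -> 0 < p 0 1 -> 0 < p (-1) 1 -> 0 < p (-1) 0 -> False.
Proof.
move=> e0 h0 b0 c0 d0 f0 g0.
have [K [io [z O]]] := tame_orbit (m := 7) T ltac:(degrees).
by rewrite a0 e0 h0 in O; exact: (orbit_not7_c b0 c0 d0 f0 O).
Qed.

Lemma infinite_period7_h : p 1 (-1) = 0 -> p 0 1 = 0 ->
  0 < p 1 0 -> 0 < p 0 (-1) -> 0 < p (-1) 1 -> 0 < p (-1) (-1) -> False.
Proof.
move=> c0 d0 b0 e0 f0 h0.
have [K [io [z O]]] := tame_orbit (m := 7) T ltac:(degrees).
have g0 : 0 <= p (-1) 0 by exact: (adm_ge0 (tame_adm T)).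
by rewrite a0 c0 d0 in O; exact: (orbit_not7_h b0 e0 f0 g0 h0 O).
Qed.

Lemma infinite_period8 : p 1 (-1) = 0 -> p 0 1 = 0 -> p (-1) (-1) = 0 ->
  0 < p 1 0 -> 0 < p 0 (-1) -> 0 < p (-1) 1 -> 0 < p (-1) 0 -> False.
Proof.
move=> c0 d0 h0 b0 e0 f0 g0.
have [K [io [z O]]] := tame_orbit (m := 8) T ltac:(degrees).
by rewrite a0 c0 d0 h0 in O; exact: (orbit_not8 b0 e0 f0 g0 O).
Qed.

Lemma infinite_period7_g : p 1 (-1) = 0 -> p (-1) (-1) = 0 ->
  0 < p 1 0 -> 0 < p 0 1 -> 0 < p 0 (-1) -> 0 < p (-1) 1 -> 0 < p (-1) 0 -> False.
Proof.
move=> c0 h0 b0 d0 e0 f0 g0.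
have [K [io [z O]]] := tame_orbit (m := 7) T ltac:(degrees).
by rewrite a0 c0 h0 in O; exact: (orbit_not7_g b0 d0 e0 f0 g0 O).
Qed.

(** Both F and G are linear, which gives p_-10 and p_0-1; the two remaining
    relations express p_01 and the corner p_-1-1 through the other weights. *)
Lemma tame_form_d : 0 < p 1 0 -> 0 < p 1 (-1) -> 0 < p 0 1 -> 0 < p (-1) 1 -> 0 < p (-1) (-1) ->
  quad (p (-1) 1) (p (-1) 0) (p (-1) (-1)) (- p 1 (-1) / p 1 0) = 0 ->
  quad (p 1 (-1)) (p 0 (-1)) (p (-1) (-1)) (- p (-1) 1 / p 0 1) = 0 ->
  p (-1) (-1) * p 1 0 ^+ 2 = p (-1) 1 * p 1 (-1) ^+ 2 ->
  p (-1) (-1) * p 0 1 ^+ 2 = p 1 (-1) * p (-1) 1 ^+ 2 -> form_d p.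
Proof.
move=> b0 c0 d0 f0 h0 N0 M0.
have t0 : 0 <= p 0 0 by exact: (adm_ge0 (tame_adm T)).
have S1 := tame_total T.
have gE := middle_coef (lt0r_neq0 b0) (lt0r_neq0 c0) N0.
have eE := middle_coef (lt0r_neq0 d0) (lt0r_neq0 f0) M0.
move: S1; rewrite /form_d /total /Pinf.
move: (p 1 0) b0 gE {N0 M0} eE => b b0 gE eE.
move: (p 1 (-1)) c0 gE eE => c c0 gE eE.
move: (p 0 1) d0 gE eE => d d0 gE eE.
move: (p (-1) 1) f0 gE eE => f f0 gE eE.
move: (p (-1) (-1)) h0 gE eE => h h0 gE eE.
rewrite gE eE a0; move: (p 0 0) t0 => t t0 S1 H1 H2.
have bn := lt0r_neq0 b0; have cn := lt0r_neq0 c0; have dn := lt0r_neq0 d0; have fn := lt0r_neq0 f0.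
have hE : h = f * c ^+ 2 / b ^+ 2 by rewrite -H1; field; conjs.
have cdE : c * d ^+ 2 = f * b ^+ 2.
  have : h * d ^+ 2 * (b ^+ 2 / (f * c)) = c * f ^+ 2 * (b ^+ 2 / (f * c)) by rewrite H2.
  have -> : h * d ^+ 2 * (b ^+ 2 / (f * c)) = c * d ^+ 2 by rewrite hE; field; conjs.
  by move=> ->; field; conjs.
(* forced by the form: S^2 = b d / (c f), R = b / (c S) and 1 / Z = c / S^2 *)
have s2 : 0 < b * d / (c * f) by rewrite divr_gt0 // mulr_gt0.
have [s [s0 sE]] : exists s : R, 0 < s /\ s ^+ 2 = b * d / (c * f).
  by exists (Num.sqrt (b * d / (c * f))); rewrite sqrtr_gt0 sqr_sqrtr // ltW.
have sn := lt0r_neq0 s0.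
have fE : f = c * d ^+ 2 / b ^+ 2 by rewrite cdE; field; conjs.
have {}sE : s ^+ 2 = b ^+ 3 / (c ^+ 2 * d) by rewrite sE fE; field; conjs.
have dE : d = b ^+ 3 / (c ^+ 2 * s ^+ 2) by rewrite sE; field; conjs.
exists s, (b / (c * s)), (t * s ^+ 2 / c); split=> //.
- by rewrite divr_gt0 // mulr_gt0.
- by rewrite divr_ge0 ?mulr_ge0 ?exprn_ge0 // ltW.
set Z := (X in X^-1 *: _); have ZE : Z^-1 = c / s ^+ 2.
  rewrite -[c / _]invrK invf_div; congr (_^-1); rewrite -[RHS]mulr1 -S1 /Z hE fE dE; field; conjs.
rewrite ZE mx33Z mulr0; apply/mx33P; split; split=> //.
all: rewrite ?hE ?fE ?dE; field; conjs.
Qed.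

End Patterns.
End Classification.

Section Tree.
Variable R : realType.
Implicit Types p q : weights R.

Lemma zero_or_gt0 (x : R) : 0 <= x -> x = 0 \/ 0 < x.
Proof. by rewrite le_eqVlt => /orP [/eqP <-|]; [left|right]. Qed.

Lemma tame_zero_or_gt0 p i j : tame p -> i \in steps -> j \in steps -> p i j = 0 \/ 0 < p i j.
Proof. by move=> [A _ _] iS jS; apply: zero_or_gt0; apply: (adm_ge0 A). Qed.

Definition rotate p := flip_rows (flip_cols p).

Lemma tame_rotate p : tame p -> tame (rotate p).
Proof. by move=> T; apply/tame_rows/tame_cols. Qed.

Lemma listed_rotate p : tame p -> listed (rotate p) -> listed p.
Proof.
by move=> [A _ _] H; apply: (listed_cols A); apply: listed_rows H; apply: admissible_cols.
Qed.

Ltac flipped := rewrite /rotate /flip_rows /flip_cols /transpose ?opprK ?oppr0.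

Lemma not_half_plane p : tame p -> p 1 1 = 0 -> p 1 0 = 0 -> p 0 1 = 0 ->
  0 < p 1 (-1) -> 0 < p (-1) 1 -> False.
Proof. by move=> [A _ [M per]] a0 b0 d0 c0 f0; apply:
  (half_plane_aperiodic A a0 b0 d0 c0 f0 per). Qed.

(** The crossing argument gives one of two relations that are exchanged by
    transposition, and either implies the other. *)
Lemma listed_d p : tame p -> p 1 1 = 0 ->
  0 < p 1 0 -> 0 < p 1 (-1) -> 0 < p 0 1 -> 0 < p (-1) 1 -> 0 < p (-1) (-1) -> listed p.
Proof.
move=> T a0 b0 c0 d0 f0 h0; constructor 4; exists p; first exact: sym_refl.
have [N0|M0] := crossing_d T a0 b0 c0 d0 f0 h0.
  have [M0 h1] := walk_d_cancel T a0 b0 c0 d0 f0 h0 N0.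
  have [_ h2] := walk_d_cancel (tame_tr T) a0 d0 f0 b0 c0 h0 M0.
  exact: (tame_form_d T a0 b0 c0 d0 f0 h0 N0 M0 h1 h2).
have [N0 h2] := walk_d_cancel (tame_tr T) a0 d0 f0 b0 c0 h0 M0.
have [_ h1] := walk_d_cancel T a0 b0 c0 d0 f0 h0 N0.
exact: (tame_form_d T a0 b0 c0 d0 f0 h0 N0 M0 h1 h2).
Qed.

Lemma listed_b3 p : tame p -> p 1 1 = 0 -> p (-1) (-1) = 0 ->
  0 < p 1 0 -> 0 < p 1 (-1) -> 0 < p 0 1 -> 0 < p 0 (-1) -> 0 < p (-1) 1 -> 0 < p (-1) 0 ->
    listed p.
Proof.
move=> T a0 h0 b0 c0 d0 e0 f0 g0; constructor 2.
have [bg|de] := crossing_b3 T a0 h0 b0 c0 d0 e0 f0 g0.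
  exists p; [exact: sym_refl|constructor 3; exact: finite_b3].
apply: up_to_tr; exists (transpose p); [exact: sym_refl|constructor 3].
exact: (finite_b3 (tame_tr T)).
Qed.

Lemma listed_cf_b p : tame p -> p 1 1 = 0 -> 0 < p 1 0 -> 0 < p 1 (-1) -> 0 < p (-1) 1 -> listed p.
Proof.
move=> T a0 b0 c0 f0.
have [h0|h0] := @tame_zero_or_gt0 p (-1) (-1) T isT isT; last first.
  have [d0|d0] := @tame_zero_or_gt0 p 0 1 T isT isT; last exact: listed_d.
  by constructor 2; exists p; [exact: sym_refl|constructor 2; exact: finite_b2].
have [e0|e0] := @tame_zero_or_gt0 p 0 (-1) T isT isT;
have [g0|g0] := @tame_zero_or_gt0 p (-1) 0 T isT isT;
have [d0|d0] := @tame_zero_or_gt0 p 0 1 T isT isT.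
- by case: (not_half_plane (tame_rotate T)); flipped.
- by case: (not_half_plane (tame_rotate T)); flipped.
- by constructor 3; exists p; [exact: sym_refl|exact: finite_c].
- by case: (infinite_period7_c T).
- by case: (infinite_period4 T).
- by case: (infinite_period7_c (tame_tr T)).
- by case: (infinite_period7_c (tame_rotate T)); flipped.
- exact: listed_b3.
Qed.

Lemma listed_cf p : tame p -> p 1 1 = 0 -> 0 < p 1 (-1) -> 0 < p (-1) 1 -> listed p.
Proof.
move=> T a0 c0 f0.
have [b0|b0] := @tame_zero_or_gt0 p 1 0 T isT isT; last exact: listed_cf_b.
have [d0|d0] := @tame_zero_or_gt0 p 0 1 T isT isT; first by case: (not_half_plane T).
by apply: (listed_tr (tame_adm T)); apply: (listed_cf_b (tame_tr T)).
Qed.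

Lemma listed_f_h p : tame p -> p 1 1 = 0 -> p 1 (-1) = 0 -> 0 < p (-1) 1 -> 0 < p (-1) (-1) ->
  listed p.
Proof.
move=> T a0 c0 f0 h0; have t0 := adm_top (tame_adm T).
have b0 : 0 < p 1 0 by lra.
have [d0|d0] := @tame_zero_or_gt0 p 0 1 T isT isT;
have [e0|e0] := @tame_zero_or_gt0 p 0 (-1) T isT isT.
- by constructor 1; apply: tame_period T _; degrees.
- by case: (infinite_period7_h T).
- by case: (infinite_period7_h (tame_cols T)); flipped.
- by constructor 1; apply: tame_period T _; degrees.
Qed.

Lemma listed_f p : tame p -> p 1 1 = 0 -> p 1 (-1) = 0 -> 0 < p (-1) 1 -> listed p.
Proof.
move=> T a0 c0 f0; have [h0|h0] := @tame_zero_or_gt0 p (-1) (-1) T isT isT; last exact: listed_f_h.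
have t0 := adm_top (tame_adm T); have r0 := adm_right (tame_adm T).
have b0 : 0 < p 1 0 by lra.
have e0 : 0 < p 0 (-1) by lra.
have [d0|d0] := @tame_zero_or_gt0 p 0 1 T isT isT;
have [g0|g0] := @tame_zero_or_gt0 p (-1) 0 T isT isT.
- constructor 2; exists p; [exact: sym_refl|constructor 1].
  by split; [apply/mx33P|rewrite !mulf_neq0 // lt0r_neq0].
- by case: (infinite_period8 T).
- by case: (infinite_period8 (tame_tr (tame_rotate T))); flipped.
- by case: (infinite_period7_g T).
Qed.

(** When only the corner (-1, -1) is present, reversing the columns moves it to
    (-1, 1). *)
Lemma listed_a p : tame p -> p 1 1 = 0 -> listed p.
Proof.
move=> T a0; have A := tame_adm T.
have [c0|c0] := @tame_zero_or_gt0 p 1 (-1) T isT isT;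
have [f0|f0] := @tame_zero_or_gt0 p (-1) 1 T isT isT.
- have [h0|h0] := @tame_zero_or_gt0 p (-1) (-1) T isT isT.
    constructor 1; apply: tame_period T _.
    have b0 : 0 < p 1 0 by have := adm_top A; lra.
    have g0 : 0 < p (-1) 0 by have := adm_bot A; lra.
    have d0 : 0 < p 0 1 by have := adm_left A; lra.
    have e0 : 0 < p 0 (-1) by have := adm_right A; lra.
    by degrees.
  apply: (listed_cols A); apply: (listed_f (tame_cols T)); by flipped.
- exact: listed_f.
- by apply: (listed_tr A); apply: (listed_f (tame_tr T)).
- exact: listed_cf.
Qed.

Lemma tame_listed p : tame p -> listed p.
Proof.
move=> T; have A := tame_adm T.
have [a0|a0] := @tame_zero_or_gt0 p 1 1 T isT isT; first exact: listed_a.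
have [c0|c0] := @tame_zero_or_gt0 p 1 (-1) T isT isT.
  by apply: (listed_cols A); apply: (listed_a (tame_cols T)); flipped.
have [f0|f0] := @tame_zero_or_gt0 p (-1) 1 T isT isT.
  by apply: (listed_rows A); apply: (listed_a (tame_rows T)); flipped.
have [h0|h0] := @tame_zero_or_gt0 p (-1) (-1) T isT isT.
  by apply: (listed_rotate T); apply: (listed_a (tame_rotate T)); flipped.
by constructor 1; apply: tame_period T _; degrees.
Qed.

End Tree.

(** * Orders of the groups *)

Section Orders.
Variable R : realType.
Implicit Types p q : weights R.

Lemma period_mul p i k : period p i -> period p (k * i).
Proof.
move=> per u qu; elim: k => [|k IH]; first by rewrite mul0n.
by rewrite mulSn iterD IH per.
Qed.

Lemma period_addr p i j : period p (i + j) -> period p j -> period p i.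
Proof. by move=> pij pj u qu; rewrite -[in RHS](pij u qu) iterD pj. Qed.

(** By Bezout. *)
Lemma period_gcd p i j : (0 < i)%N -> period p i -> period p j -> period p (gcdn i j).
Proof.
move=> i0 pi pj; have [a _ /dvdnP [k E]] := Bezoutl j i0.
apply: (@period_addr p _ (a * j)); last exact: period_mul.
by rewrite E; apply: period_mul.
Qed.

Lemma not_period1 p : admissible p -> ~ period p 1.
Proof.
move=> A per; apply: (refl_id A (b := false)) => u qu.
have := congr1 fst (per u qu); rewrite /= /turn /=.
by case: u {qu} => x y /= ->.
Qed.

Lemma not_period_coprime p m j : admissible p -> (0 < m)%N -> period p m -> coprime m j ->
  ~ period p j.
Proof.
move=> A m0 pm /eqP co pj; apply: (not_period1 A); rewrite -co; exact: period_gcd.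
Qed.

(** A smaller period would be coprime to m, and 1 is not a period. *)
Lemma card_prime p m : admissible p -> prime m -> period p m -> walk_group p #= `I_(2 * m).
Proof.
move=> A pr pm; apply: card_walk_group => //; first exact: prime_gt0.
move=> j /andP [j0 jm]; apply: (not_period_coprime A (prime_gt0 pr) pm).
by rewrite prime_coprime // gtnNdvd.
Qed.

Lemma case_a_period2 p : admissible p -> case_a p <-> period p 2.
Proof.
move=> A; rewrite (case_a_proportional A); split; last exact: period2_proportional.
exact: proportional_period2.
Qed.

Lemma symmetric_adm p q : admissible p -> symmetric_weights p q -> admissible q.
Proof. by move=> A s; apply/(symmetric_period 0 s).1. Qed.

Lemma case_b_period p : admissible p -> case_b p -> period p 3.
Proof.
move=> A [q s F]; apply/(symmetric_period 3 s).2 => //.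
have B := symmetric_adm A s.
by case: F => F; [exact: form_b1_period|exact: form_b2_period|exact: form_b3_period].
Qed.

Lemma case_d_period p : admissible p -> case_d p -> period p 5.
Proof.
move=> A [q s F]; apply/(symmetric_period 5 s).2 => //.
exact: (form_d_period (symmetric_adm A s)).
Qed.

Lemma card_a p : admissible p -> case_a p -> walk_group p #= `I_4.
Proof. by move=> A /(case_a_period2 A); apply: (@card_prime p 2 A). Qed.

Lemma card_b p : admissible p -> case_b p -> walk_group p #= `I_6.
Proof. by move=> A /(case_b_period A); apply: (@card_prime p 3 A). Qed.

Lemma card_d p : admissible p -> case_d p -> walk_group p #= `I_10.
Proof. by move=> A /(case_d_period A); apply: (@card_prime p 5 A). Qed.

(** Period 2 forces p_11 p_-1-1 = p_1-1 p_-11, but here the left side vanishes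
    and the right side does not. *)
Lemma form_c_not_period2 p : admissible p -> form_c p -> ~ period p 2.
Proof.
move=> A [/mx33P [[a0 _ _] _ _] nz] per2.
have E : p 1 (-1) * p (-1) 1 = 0.
  by have [[_ <- _]|[_ + _]] := period2_proportional A per2; rewrite /transpose a0 mul0r // mulrC.
by move: nz; rewrite -mulrA E mulr0 eqxx.
Qed.

Lemma card_c p : admissible p -> case_c p -> walk_group p #= `I_8.
Proof.
move=> A [q s F]; have B := symmetric_adm A s.
have p4 : period p 4 by apply/(symmetric_period 4 s).2 => //; apply: form_c_period.
apply: (@card_walk_group R p 4) => // -[|[|[|[|j]]]] // _.
- exact: (not_period1 A).
- by move/((symmetric_period 2 s).2 A); apply: form_c_not_period2.
- exact: (not_period_coprime A _ p4).
Qed.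

Lemma total_sum p : \sum_(i <- steps) \sum_(j <- steps) p i j = total p.
Proof. by rewrite /steps /total !big_cons !big_nil; ring. Qed.

End Orders.

Theorem theorem8p1 (R : realType) (p : weights R)
    (hp : walk_weights p)
    (hA1 : A1 p != 0) (hC1 : C1 p != 0) (hA2 : A2 p != 0) (hC2 : C2 p != 0) :
  (finite_set (walk_group p) <->
     [\/ case_a p, case_b p, case_c p | case_d p]) /\
  (case_a p <-> case_a_param p) /\
  (case_a p -> walk_group p #= `I_4) /\
  (case_b p -> walk_group p #= `I_6) /\
  (case_c p -> walk_group p #= `I_8) /\
  (case_d p -> walk_group p #= `I_10) /\
  (forall n : nat, walk_group p #= `I_n -> (n <= 10)%N).
Proof.
have A : admissible p by case: hp => p0 _; apply: coef_adm.
have S1 : total p = 1 by rewrite -total_sum; case: hp.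
have finite_listed : finite_set (walk_group p) -> [\/ case_a p, case_b p, case_c p | case_d p].
  move=> /(finite_period A) per; have [H|H|H|H] := tame_listed (Tame A S1 per).
  - by constructor 1; apply/(case_a_period2 A).
  - by constructor 2.
  - by constructor 3.
  - by constructor 4.
have order : [\/ case_a p, case_b p, case_c p | case_d p] -> exists2 n,
  (n <= 10)%N & walk_group p #= `I_n.
  by case=> H; [exists 4%N => //; exact: card_a|exists 6%N => //; exact: card_b
    |exists 8%N => //; exact: card_c|exists 10%N => //; exact: card_d].
split; first by split=> // /order [n _ En]; apply/finite_setP; exists n.
split; first exact: case_a_paramP.
do 4?[split]; [exact: card_a|exact: card_b|exact: card_c|exact: card_d|].
move=> n En; have [k k10 Ek] : exists2 k, (k <= 10)%N & walk_group p #= `I_k.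
  by apply/order/finite_listed/finite_setP; exists n.
have : `I_n #= `I_k by apply: card_eq_trans Ek; rewrite card_eq_sym.
by move/card_eq_II->.
Qed.
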